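(* Let $n\in\{2,3\}$ and let $\Omega\subset\mathbb R^n$ be a domain of diameter $R$ that is star-shaped with respect to a ball of radius $\rho$. Let $C_{NL,0}$, $C^A$, $C^B$, $C_P$ be the positive constants described in the context. Then there exists a positive constant $C^*$, depending only on $n$, $R$, $\rho$ through the constants $C_{NL,0}$, $C^A$, $C^B$, $C_P$, such that for all $\mathbf v\in[L^2(\Omega)]^n$ $$ \|\mathbf v-\boldsymbol\Pi_{RM}\mathbf v\|_{0,\Omega}\le C^*\,\|\nabla_S\mathbf v\|_{-1,\Omega}\le C_{NL,0}\left[1+\sqrt2\,\bigl(C^A C_P R+C^B\bigr)\right]\|\nabla_S\mathbf v\|_{-1,\Omega}. $$
   Context: Star-shaped with respect to a ball $B$: for every $x\in\Omega$, $y\in B$ the segment joining $x$ and $y$ lies in $\Omega$. $\|\cdot\|_{0,\Omega}$ is the $L^2(\Omega)$ norm; $|\cdot|_{s,\Omega}$ is the $H^s(\Omega)$ seminorm (the $L^2$ norm of all derivatives of order $s$); the same symbols are used for vector fields and tensors. $H^s_0(\Omega)$ is the closure of $\mathcal C_0^\infty(\Omega)$ in $H^s(\Omega)$; $L^2_0(\Omega)$ is the space of zero-average $L^2(\Omega)$ functions. $H^{-1}(\Omega)=[H^1_0(\Omega)]^*$ has norm $\|u\|_{-1,\Omega}:=\sup_{v\in H^1_0(\Omega)\setminus\{0\}}\langle u,v\rangle/|v|_{1,\Omega}$, and similarly for vector- and tensor-valued distributions (test functions in $[H^1_0(\Omega)]^n$, $[H^1_0(\Omega)]^{n\times n}$).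 $\nabla_S\mathbf v=\frac12(\nabla\mathbf v+(\nabla\mathbf v)^T)$ is the (distributional) symmetric gradient. The space of rigid body motions is $RM(\Omega)=\{\boldsymbol\alpha+b\,(x_2,-x_1)^T:\boldsymbol\alpha\in\mathbb R^2,\ b\in\mathbb R\}$ if $n=2$, and $RM(\Omega)=\{\boldsymbol\alpha+\boldsymbol\omega\times(x_1,x_2,x_3)^T:\boldsymbol\alpha,\boldsymbol\omega\in\mathbb R^3\}$ if $n=3$; $\boldsymbol\Pi_{RM}$ is the $L^2(\Omega)$ projection onto $RM(\Omega)$. Constants: - $C_{NL,0}$ is the constant of the lowest order Nečas–Lions inequality: $\|f-\Pi^0f\|_{0,\Omega}\le C_{NL,0}\|\nabla f\|_{-1,\Omega}$ for all $f\in L^2(\Omega)$, where $\Pi^0f$ is the average of $f$ over $\Omega$; i.e. $C_{NL,0}=\sup_f \|f-\Pi^0f\|_{0,\Omega}/\|\nabla f\|_{-1,\Omega}$ (over non-constant $f\in L^2(\Omega)$). - $C^A,C^B$ are positive constants such that for every $f\in H^1_0(\Omega)\cap L^2_0(\Omega)$ there is $\mathbf u\in[H^2_0(\Omega)]^n$ with $\nabla\cdot\mathbf u=f$ and $|\mathbf u|_{2,\Omega}\le C^A\|f\|_{0,\Omega}+C^B|f|_{1,\Omega}$. - $C_P$ is a positive constant, independent of $R$ and $\rho$, such that $\|f\|_{0,\Omega}\le C_P R\,|f|_{1,\Omega}$ for all $f\in H^1_0(\Omega)$. *)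

(* Defs.v *)
From HB Require Import structures.
From mathcomp Require Import all_boot all_order all_algebra.
From mathcomp Require Import all_classical all_reals all_analysis.

Set Implicit Arguments.
Unset Strict Implicit.
Unset Printing Implicit Defensive.

Import Order.TTheory GRing.Theory Num.Theory.
Import numFieldNormedType.Exports.

Local Open Scope classical_set_scope.
Local Open Scope ring_scope.

(* R^n carries the sigma-algebra generated by the coordinates, and the Lebesgue
   measure is the iterated product of the Lebesgue measure on R. *)
Section measurable_rV.
Context {R : realType} (n : nat).

Let coors : 'I_n -> 'rV[R]_n -> R := fun i x => x ord0 i.

Let rV_set0 : g_sigma_preimage coors set0.
Proof. exact: sigma_algebra0. Qed.

Let rV_setC A : g_sigma_preimage coors A -> g_sigma_preimage coors (~` A).
Proof. exact: sigma_algebraC. Qed.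

Let rV_bigcup (F : _^nat) : (forall i, g_sigma_preimage coors (F i)) ->
  g_sigma_preimage coors (\bigcup_i (F i)).
Proof. exact: sigma_algebra_bigcup. Qed.

HB.instance Definition _ := @isMeasurable.Build default_measure_display
  'rV[R]_n (g_sigma_preimage coors) rV_set0 rV_setC rV_bigcup.

End measurable_rV.

Lemma measurable_coor (R : realType) n (i : 'I_n) :
  measurable_fun [set: 'rV[R]_n] (fun x => x ord0 i).
Proof.
move=> _ Y mY; rewrite setTI; apply: sub_sigma_algebra => /=.
rewrite -bigcup_seq/=; exists i => /=; first by rewrite mem_index_enum.
by exists Y => //; rewrite setTI.
Qed.

Lemma measurable_fun_rVP d (T : measurableType d) (R : realType) n
    (f : T -> 'rV[R]_n) :
  (forall i, measurable_fun [set: T] (fun t => f t ord0 i)) ->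
  measurable_fun [set: T] f.
Proof.
move=> mf _ A mA; rewrite setTI.
have : (g_sigma_preimage (fun i t => f t ord0 i)) (f @^-1` A).
  rewrite (g_sigma_preimage_comp (fun i (x : 'rV[R]_n) => x ord0 i) f).
  by exists A => //; rewrite setTI.
apply: smallest_sub; first exact: sigma_algebra_measurable.
rewrite -bigcup_seq; apply: bigcup_sub => i _ _ [B mB <-].
exact: mf.
Qed.

Definition consV (R : realType) n (p : measurableTypeR R * 'rV[R]_n) :
  'rV[R]_n.+1 := row_mx (p.1 : R)%:M p.2.

Lemma measurable_consV (R : realType) n : measurable_fun setT (@consV R n).
Proof.
apply: measurable_fun_rVP => i; case: (split_ordP (i : 'I_(1 + n))) => j ->.
  rewrite (_ : (fun _ => _) = fst); first exact: measurable_fst.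
  apply/funext => p; apply: etrans (row_mxEl (p.1 : R)%:M p.2 ord0 j) _.
  by rewrite (ord1 j) mxE.
rewrite (_ : (fun _ => _) = (fun x : 'rV[R]_n => x ord0 j) \o snd).
  exact: (measurableT_comp (measurable_coor j) measurable_snd).
by apply/funext => p; exact: (row_mxEr (p.1 : R)%:M p.2 ord0 j).
Qed.

Definition unconsV (R : realType) n (x : 'rV[R]_n.+1) :
  measurableTypeR R * 'rV[R]_n := (x ord0 ord0, \row_j x ord0 (lift ord0 j)).

Lemma consVK (R : realType) n : cancel (@consV R n) (@unconsV R n).
Proof.
case=> a x; congr pair.
  transitivity (@consV R n (a, x) ord0 (lshift n (ord0 : 'I_1))).
    by congr (consV _ _ _); exact: val_inj.
  by apply: etrans (row_mxEl (a : R)%:M x ord0 ord0) _; rewrite mxE.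
apply/rowP => j; rewrite mxE.
apply: etrans (row_mxEr (a : R)%:M x ord0 j).
by congr (consV _ _ _); exact: val_inj.
Qed.

Lemma unconsVK (R : realType) n : cancel (@unconsV R n) (@consV R n).
Proof.
move=> x; apply/rowP => i; case: (split_ordP (i : 'I_(1 + n))) => j ->.
  apply: etrans (row_mxEl (x ord0 ord0)%:M _ ord0 j) _.
  by rewrite (ord1 j) mxE; congr (x _ _); exact: val_inj.
apply: etrans (row_mxEr (x ord0 ord0)%:M _ ord0 j) _.
by rewrite mxE; congr (x _ _); exact: val_inj.
Qed.

Lemma measurable_unconsV (R : realType) n : measurable_fun setT (@unconsV R n).
Proof.
apply/measurable_fun_pair => /=; first exact: measurable_coor.
apply: measurable_fun_rVP => i.
rewrite (_ : (fun _ => _) = (fun x : 'rV[R]_n.+1 => x ord0 (lift ord0 i))).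
  exact: measurable_coor.
by apply/funext => x; rewrite mxE.
Qed.

Section lebesgueV_succ.
Context {R : realType} (n : nat).
Variable mu : {sigma_finite_measure set 'rV[R]_n -> \bar R}.

Definition lebesgueV_succ : set 'rV[R]_n.+1 -> \bar R :=
  pushforward (@lebesgue_measure R \x mu)%E (@consV R n).

Let mcons := @measurable_consV R n.

Let succ0 : lebesgueV_succ set0 = 0%E.
Proof. exact: measure0. Qed.

Let succ_ge0 A : (0 <= lebesgueV_succ A)%E.
Proof. exact: measure_ge0. Qed.

Let succ_sigma_additive : semi_sigma_additive lebesgueV_succ.
Proof. exact: measure_semi_sigma_additive. Qed.

HB.instance Definition _ := isMeasure.Build _ _ _ lebesgueV_succ
  succ0 succ_ge0 succ_sigma_additive.

Let succ_sigma_finite : sigma_finite setT lebesgueV_succ.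
Proof.
have /sigma_finiteP[F [TF ndF Foo]] := sigma_finiteT (@lebesgue_measure R).
have /sigma_finiteP[G [TG ndG Goo]] := sigma_finiteT mu.
exists (fun k => @unconsV R n @^-1` (F k `*` G k)).
  rewrite -preimage_bigcup (_ : \bigcup_k _ = setT) ?preimage_setT//.
  apply/seteqP; split=> // -[x y] _.
  have [i _ Fix] : (\bigcup_k F k) x by rewrite -TF.
  have [j _ Gjy] : (\bigcup_k G k) y by rewrite -TG.
  exists (maxn i j) => //; split => /=.
    by move: x Fix; exact/subsetPset/ndF/leq_maxl.
  by move: y Gjy; exact/subsetPset/ndG/leq_maxr.
move=> k; have [mF Fk] := Foo k; have [mG Gk] := Goo k; split.
  rewrite -[X in measurable X]setTI; apply: measurable_unconsV => //.
  exact: measurableX.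
rewrite /lebesgueV_succ /pushforward -comp_preimage.
rewrite (_ : _ \o _ = id); last by apply/funext => p /=; rewrite consVK.
rewrite preimage_id product_measure1E//.
by apply: lte_mul_pinfty => //; rewrite ge0_fin_numE.
Qed.

HB.instance Definition _ := Measure_isSigmaFinite.Build _ _ _ lebesgueV_succ
  succ_sigma_finite.

End lebesgueV_succ.

Fixpoint lebesgueV (R : realType) n :
    {sigma_finite_measure set 'rV[R]_n -> \bar R} :=
  if n is m.+1 then lebesgueV_succ (lebesgueV R m)
  else @dirac _ 'rV[R]_0 0 R.

(* The normed-space structure of 'rV[R]_n carries the max norm, which has the
   same topology as the Euclidean norm but neither the same balls nor the same
   diameters. *)
Definition enorm (R : realType) n (x : 'rV[R]_n) : R :=
  Num.sqrt (\sum_(i < n) x ord0 i ^+ 2).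

Definition ediam (R : realType) n (Omega : set 'rV[R]_n) : \bar R :=
  ereal_sup [set (enorm (x - y))%:E | x in Omega & y in Omega].

Definition star_shaped (R : realType) n (Omega : set 'rV[R]_n)
    (c : 'rV[R]_n) (rho : R) : Prop :=
  forall x y, Omega x -> enorm (y - c) < rho ->
    forall t : R, 0 <= t <= 1 -> Omega (x + t *: (y - x)).

Definition star_domain (R : realType) n (r rho : R) (Omega : set 'rV[R]_n) :
    Prop :=
  [/\ open Omega, connected Omega, Omega !=set0, ediam Omega = r%:E
    & 0 < rho /\ exists c, star_shaped Omega c rho].

(* Functions are defined on the whole of R^n, only their values on Omega being
   relevant; vector and tensor fields are families of functions indexed by a
   finite type, 'I_n for vectors and 'I_n * 'I_n for tensors. *)
Section spaces.
Context {R : realType} {n : nat}.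
Local Notation mu := (lebesgueV R n).
Local Notation fct := ('rV[R]_n -> R).
Implicit Types (Omega : set 'rV[R]_n) (f g phi : fct) (s : seq 'I_n).

Definition L2 Omega : set fct :=
  [set f | (f \_ Omega : fct) \in Lfun mu 2%:E].

Definition L2norm Omega f : R := fine ('N[mu]_2%:E[EFin \o (f \_ Omega)])%E.

Definition dotL2 Omega f g : R := \int[mu]_(x in Omega) (f x * g x).

Definition average Omega f : R :=
  (\int[mu]_(x in Omega) f x) / fine (mu Omega).

(* [pD [:: i1; ...; ik] phi] is the classical d_i1 ... d_ik phi. *)
Definition pD s phi : fct :=
  foldr (fun i g (x : 'rV[R]_n) => 'D_(delta_mx ord0 i) g x) phi s.

Definition smooth phi : Prop := forall s,
  continuous (pD s phi) /\
  forall i x, derivable (pD s phi) x (delta_mx ord0 i).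

Definition test_function Omega : set fct :=
  [set phi | [/\ smooth phi, compact (closure [set x | phi x != 0])
               & closure [set x | phi x != 0] `<=` Omega]].

Definition is_weak_derivative Omega s f g : Prop :=
  L2 Omega g /\ forall phi, test_function Omega phi ->
    dotL2 Omega f (pD s phi) = (-1) ^+ size s * dotL2 Omega g phi.

(* A representative of the weak derivative, meaningful when it exists in
   L2(Omega); it is then unique almost everywhere. *)
Definition wD Omega s f : fct :=
  if s is [::] then f else xget (cst 0) [set g | is_weak_derivative Omega s f g].

(* All derivatives of order k: one term for each k-tuple of indices, so that
   |f|_2 is the L2 norm of the Hessian matrix of f. *)
Definition Hseminorm Omega k f : R :=
  Num.sqrt (\sum_(s : k.-tuple 'I_n) L2norm Omega (wD Omega s f) ^+ 2).

Definition Hspace Omega k : set fct :=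
  [set f | L2 Omega f /\ forall s, (size s <= k)%N ->
             exists g, is_weak_derivative Omega s f g].

(* The H^k(Omega) norm of f - phi, phi being smooth. *)
Definition Hdist Omega k f phi : R :=
  Num.sqrt (\sum_(j < k.+1) \sum_(s : j.-tuple 'I_n)
              L2norm Omega (wD Omega s f \- pD s phi) ^+ 2).

Definition H0space Omega k : set fct :=
  [set f | Hspace Omega k f /\ forall e : R, 0 < e ->
             exists2 phi, test_function Omega phi & Hdist Omega k f phi < e].

Section fields.
Context {I : finType}.
Implicit Types v w : I -> fct.

Definition L2normF Omega v : R := Num.sqrt (\sum_i L2norm Omega (v i) ^+ 2).

Definition dotL2F Omega v w : R := \sum_i dotL2 Omega (v i) (w i).

Definition HseminormF Omega k v : R :=
  Num.sqrt (\sum_i Hseminorm Omega k (v i) ^+ 2).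

(* Distributions are given by their action on H^1_0(Omega), and fields of
   distributions act componentwise. *)
Definition Hm1norm Omega (T : I -> fct -> R) : \bar R :=
  ereal_sup [set ((\sum_i T i (Phi i)) / HseminormF Omega 1 Phi)%:E
    | Phi in [set Phi : I -> fct |
        (forall i, H0space Omega 1 (Phi i)) /\ L2normF Omega Phi != 0]].

End fields.

Definition div Omega (v : 'I_n -> fct) : fct :=
  fun x => \sum_i wD Omega [:: i] (v i) x.

(* d_j f for f in L2(Omega), extended to H^1_0(Omega) by continuity. *)
Definition dist_partial Omega (j : 'I_n) f : fct -> R :=
  fun phi => - dotL2 Omega f (wD Omega [:: j] phi).

Definition dist_grad Omega f : 'I_n -> fct -> R :=
  fun j => dist_partial Omega j f.

Definition dist_sym_grad Omega (v : 'I_n -> fct) : 'I_n * 'I_n -> fct -> R :=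
  fun ij phi => 2^-1 * (dist_partial Omega ij.2 (v ij.1) phi +
                        dist_partial Omega ij.1 (v ij.2) phi).

End spaces.

Section rigid_motions.
Context {R : realType}.

Definition components n (w : 'rV[R]_n -> 'rV[R]_n) : 'I_n -> 'rV[R]_n -> R :=
  fun i x => w x ord0 i.

Definition rot2 (x : 'rV[R]_2) : 'rV[R]_2 :=
  \row_(i < 2) if i == 0 then x 0 1 else - x 0 0.

Definition cross3 (u v : 'rV[R]_3) : 'rV[R]_3 :=
  \row_(i < 3) [:: u 0 1 * v 0 2 - u 0 2 * v 0 1;
                   u 0 2 * v 0 0 - u 0 0 * v 0 2;
                   u 0 0 * v 0 1 - u 0 1 * v 0 0]`_i.

Definition RM n : set ('I_n -> 'rV[R]_n -> R) :=
  match n with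
  | 2%N => [set p | exists (alpha : 'rV[R]_2) (b : R),
                      p = components (fun x => alpha + b *: rot2 x)]
  | 3%N => [set p | exists alpha omega : 'rV[R]_3,
                      p = components (fun x => alpha + cross3 omega x)]
  | _ => set0
  end.

Definition is_RM_projection n (Omega : set 'rV[R]_n)
    (v p : 'I_n -> 'rV[R]_n -> R) : Prop :=
  RM p /\ forall q, RM q -> dotL2F Omega (fun i => v i \- p i) q = 0.

End rigid_motions.

Section constants.
Context {R : realType} {n : nat}.
Implicit Types Omega : set 'rV[R]_n.

Definition is_necas_lions_constant Omega (C : R) : Prop :=
  [/\ 0 < C,
      forall f, L2 Omega f ->
        ((L2norm Omega (fun x => f x - average Omega f))%:E
           <= C%:E * Hm1norm Omega (dist_grad Omega f))%E
    & C%:E = ereal_sup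
        [set (L2norm Omega (fun x => f x - average Omega f) /
              fine (Hm1norm Omega (dist_grad Omega f)))%:E
        | f in [set f | L2 Omega f /\
                        L2norm Omega (fun x => f x - average Omega f) != 0]]].

Definition are_divergence_constants Omega (CA CB : R) : Prop :=
  [/\ 0 < CA, 0 < CB &
    forall f, H0space Omega 1 f ->
      \int[lebesgueV R n]_(x in Omega) f x = 0 ->
      exists u : 'I_n -> 'rV[R]_n -> R,
        [/\ forall i, H0space Omega 2 (u i),
            {ae lebesgueV R n, forall x, Omega x -> div Omega u x = f x}
          & HseminormF Omega 2 u
              <= CA * L2norm Omega f + CB * Hseminorm Omega 1 f]].

End constants.

Definition is_poincare_constant (R : realType) n (CP : R) : Prop :=
  0 < CP /\ forall (r rho : R) (Omega : set 'rV[R]_n),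
    star_domain r rho Omega -> forall f, H0space Omega 1 f ->
      L2norm Omega f <= CP * r * Hseminorm Omega 1 f.

(* Main.v *)
Require Import Defs.
From mathcomp Require Import all_boot all_order all_algebra.
From mathcomp Require Import all_classical all_reals all_analysis.
From mathcomp Require Import measurable_realfun ring lra.

(* Test grad v against a tensor Phi in H^1_0 whose skew part f_ij =
   (Phi_ij - Phi_ji)/2 has zero averages. Then f_ij = sum_k d_k w_ijk with w
   antisymmetric in i, j and in H^2_0, |w|_2 being controlled by the divergence
   constants and the Poincare inequality. Integrating by parts,
   <grad v, Phi> = <grad_S v, Phi> + 2 <grad_S v, Psi> where
   Psi_ak = sum_j d_j w_ajk, and |Psi|_1^2 <= 1/2 sum |w_ajk|_2^2, because
   |d* w|^2 <= |grad w|^2 for compactly supported 2-forms. Hence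
   <grad v, Phi> <= M |Phi|_1 with M = (1 + sqrt 2 (C^A C_P R + C^B)) |grad_S v|_-1.
   The averages of the skew part are finitely many functionals, so by
   Hahn-Banach there is a skew matrix K such that z = v - K x satisfies
   <grad z, Phi> <= M |Phi|_1 for every Phi in H^1_0. The Necas-Lions inequality,
   applied to each component, gives |z - avg z|_0 <= C_NL M; and K x + avg z is a
   rigid motion, so the L2 projection onto rigid motions does at least as well. *)

Set Implicit Arguments.
Unset Strict Implicit.
Unset Printing Implicit Defensive.

Import Order.TTheory GRing.Theory Num.Theory.
Import numFieldNormedType.Exports.
Local Open Scope classical_set_scope.
Local Open Scope ring_scope.

(** * Lebesgue measure on 'rV_n *)

Section measure_rV.
Context {R : realType}.

(** The obstacle is that only the symmetric part e of [grad v] is controlled. Classically the skew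
    part is recovered from d_k (d_j v_i - d_i v_j) = 2 (d_j e_ik - d_i e_jk), which costs an
    estimate in H^-2. Here that identity is transposed onto test tensors, where an inverse of the
    divergence with values in H^2_0 takes its place. The divergence is inverted on zero averages
    only, and the averages left over are exactly what the gradient of a skew linear field sees:
    hence the rotation. The translation comes from the averages in Necas-Lions. Hahn-Banach supplies
    K without enlarging the bound M. The constant sqrt 2 is 2 / sqrt 2: the 2 in front of Psi, and
    sqrt (1/2) from the inequality on 2-forms, which is independent of n. Taking skew parts, of
    tensors or of potentials, costs nothing. Weak derivatives are chosen representatives, so [wD] is
    linear only up to null sets; identities between them are therefore stated after pairing with an
    L2 function. *)

Lemma box_measurable n (D : 'I_n -> set R) : (forall i, measurable (D i)) ->
  measurable [set x : 'rV[R]_n | forall i, D i (x ord0 i)].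
Proof.
move=> mD.
rewrite (_ : [set _ | _] = \big[setI/setT]_(i < n)
    ((fun x : 'rV[R]_n => x ord0 i) @^-1` D i)).
  apply: bigsetI_measurable => i _; rewrite -[X in measurable X]setTI.
  exact: measurable_coor.
rewrite -bigcap_seq; apply/seteqP; split=> x /= h i.
  by move=> _; exact: h.
exact: (h i (mem_index_enum i)).
Qed.

Definition obox n (a b : 'I_n -> R) : set 'rV[R]_n :=
  [set x | forall i, `]a i, b i[%classic (x ord0 i)].

Definition kbox n (a b : 'I_n -> R) : set 'rV[R]_n :=
  [set x | forall i, `[a i, b i]%classic (x ord0 i)].

Lemma obox_measurable n (a b : 'I_n -> R) : measurable (obox a b).
Proof.
by apply: (@box_measurable n (fun i => `]a i, b i[%classic)) => i; exact: measurable_itv.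
Qed.

(** Boxes with rational centre and half-width 1/(k+1) are countably many and form a base. Keeping
    the closed boxes inside [A] makes them supports of test functions later on. *)
Lemma open_bigcup_obox n (A : set 'rV[R]_n) : open A ->
  exists (P : set nat) (a b : nat -> 'I_n -> R),
    (forall k, P k -> kbox (a k) (b k) `<=` A) /\ A = \bigcup_(k in P) obox (a k) (b k).
Proof.
move=> oA.
pose a (p : 'rV[rat]_n * nat) (i : 'I_n) : R := ratr (p.1 ord0 i) - p.2.+1%:R^-1.
pose b (p : 'rV[rat]_n * nat) (i : 'I_n) : R := ratr (p.1 ord0 i) + p.2.+1%:R^-1.
pose code k : 'rV[rat]_n * nat := odflt (0, 0%N) (unpickle k).
exists [set k | kbox (a (code k)) (b (code k)) `<=` A], (a \o code), (b \o code).
split=> //; apply/seteqP; split=> [x Ax|x [k] /= kA xk]; last first.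
  by apply: kA => i; apply: subset_itv_oo_cc; exact: xk.
have /nbhs_ballP[e /= e0 eA] : nbhs x A by apply: open_nbhs_nbhs; split.
(* A box of half-width 1/(k+1), with centre that close to x, stays within 2/(k+1) of x. *)
have [k ke] : exists k : nat, k.+1%:R^-1 < e / 2.
  have [k _ kP] := near_infty_natSinv_lt (PosNum (divr_gt0 e0 (ltr0Sn R 1))).
  by exists k; exact: (kP k (leqnn k)).
have k0 : (0 : R) < k.+1%:R^-1 by rewrite invr_gt0.
have /choice[q qP] : forall i : 'I_n, exists q : rat,
    `|ratr q - x ord0 i| < k.+1%:R^-1.
  move=> i; have : x ord0 i - k.+1%:R^-1 < x ord0 i + k.+1%:R^-1.
    by rewrite ltrBlDr -addrA ltrDl addr_gt0.
  move=> /rat_in_itvoo[q]; rewrite in_itv /= => /andP[h1 h2].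
  by exists q; rewrite ltr_distl h1 h2.
have codeE : code (pickle (\row_i q i, k)) = (\row_i q i, k) by rewrite /code pickleK.
exists (pickle (\row_i q i, k)); rewrite /= codeE /a /b /=; last first.
  move=> i; rewrite /= in_itv /= !mxE.
  by have := qP i; rewrite distrC ltr_distl.
move=> y By; apply: eA; split=> // i j; rewrite (ord1 i).
have := By j; rewrite /= in_itv /= !mxE -ler_distl distrC => h2.
have h1 := qP j; rewrite /ball /=.
have -> : x ord0 j - y ord0 j = (x ord0 j - ratr (q j)) + (ratr (q j) - y ord0 j) by ring.
have kke : k.+1%:R^-1 + k.+1%:R^-1 < e by rewrite [e]splitr ltrD.
apply: le_lt_trans (ler_normD _ _) _; rewrite (distrC (x ord0 j)).
exact: lt_trans (ltr_leD h1 h2) kke.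
Qed.

(** Links the topology to the sigma-algebra, which is generated by the coordinates and not by the
    open sets. *)
Lemma open_measurable_rV n (A : set 'rV[R]_n) : open A -> measurable A.
Proof.
move=> /open_bigcup_obox[P [a [b [_ ->]]]].
by apply: bigcup_measurable => k _; exact: obox_measurable.
Qed.

Lemma continuous_measurable_rV n (f : 'rV[R]_n -> R) : continuous f ->
  measurable_fun setT f.
Proof.
move=> /continuousP cf; apply: (measurability _ (RGenOpens.measurableE R)).
move=> _ [_ [a [b ->] <-]]; rewrite setTI; apply: open_measurable_rV.
exact/cf/interval_open.
Qed.

Definition cbox n (B : R) : set 'rV[R]_n := [set x | forall i, `|x ord0 i| <= B].

Lemma measurable_cbox n B : measurable (@cbox n B).
Proof.
rewrite (_ : cbox _ = [set x : 'rV[R]_n | forall i, [set t | `|t| <= B] (x ord0 i)]) //.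
apply: (@box_measurable n (fun=> [set t | `|t| <= B])) => _.
rewrite (_ : [set _ | _] = `[-B, B]%classic); first exact: measurable_itv.
by apply/seteqP; split=> x /=; rewrite in_itv /= ler_norml.
Qed.

Lemma consV0 n (a : R) (x : 'rV[R]_n) : consV (a, x) ord0 ord0 = a.
Proof. by have /(congr1 fst) := consVK (a, x). Qed.

Lemma consVS n (a : R) (x : 'rV[R]_n) i : consV (a, x) ord0 (lift ord0 i) = x ord0 i.
Proof.
by have /(congr1 snd)/matrixP/(_ ord0 i) := consVK (a, x); rewrite /unconsV /= mxE.
Qed.

Lemma cbox_finite n B : (lebesgueV R n (cbox B) < +oo)%E.
Proof.
elim: n => [|n IH].
  rewrite /= diracE; case: (_ \in _) => /=; exact: ltry.
have -> : lebesgueV R n.+1 (cbox B) =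
    ((@lebesgue_measure R) \x lebesgueV R n)%E ((@consV R n) @^-1` cbox B) by [].
have -> : (@consV R n) @^-1` cbox B = `[-B, B]%classic `*` cbox B.
  apply/seteqP; split=> -[a x] /= h.
    split; first by have := h ord0; rewrite consV0 in_itv /= ler_norml.
    by move=> i; have := h (lift ord0 i); rewrite consVS.
  move=> i; case: (unliftP ord0 i) => [j|] ->.
    by rewrite consVS; exact: h.2.
  by rewrite consV0; have := h.1; rewrite in_itv /= ler_norml.
rewrite product_measure1E //; last exact: measurable_cbox.
apply: lte_mul_pinfty => //.
  by rewrite [X in X \is a fin_num]lebesgue_measure_itv /=; case: ifP.
Qed.

Lemma cbox_compact n B : compact (@cbox n B).
Proof.
rewrite (_ : cbox _ = [set x : 'rV[R]_n | forall i, `[-B, B]%classic (x ord0 i)]).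
  by apply: (@rV_compact _ n (fun=> `[-B, B]%classic)) => i; exact: segment_compact.
by apply/seteqP; split=> x /= h i; have := h i; rewrite in_itv /= ler_norml.
Qed.

(** A coordinatewise form of compact support, which passes to the slices of a function and so suits
    induction on the dimension. *)
Definition vanishes_off n (B : R) (f : 'rV[R]_n -> R) := 
  forall (x : 'rV[R]_n) (i : 'I_n), B < `|x ord0 i| -> f x = 0.

Lemma vanishes_off_bounded n (B : R) (f : 'rV[R]_n -> R) : continuous f ->
  vanishes_off B f -> exists2 M, 0 <= M & forall x, `|f x| <= M.
Proof.
move=> cf vf.
have : compact (f @` cbox B).
  by apply: continuous_compact (@cbox_compact n B); exact: continuous_subspaceT.
move=> /compact_bounded[M [_ hM]]; exists (`|M| + 1); first by rewrite addr_ge0.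
move=> x; have [xB|] := pselect (cbox B x).
  by apply: hM; [by apply: (le_lt_trans (ler_norm M)); rewrite ltrDl|exists x].
move=> /existsNP[i /negP]; rewrite -ltNge => /vf ->.
by rewrite normr0 addr_ge0.
Qed.

Lemma vanishes_off_integrable n (B : R) (f : 'rV[R]_n -> R) : continuous f ->
  vanishes_off B f -> (lebesgueV R n).-integrable setT (EFin \o f).
Proof.
move=> cf vf; have mf := continuous_measurable_rV cf.
have -> : EFin \o f = (EFin \o f) \_ (cbox B).
  apply/funext => x; rewrite patchE; case: ifPn => // /negP xB /=; congr EFin.
  have /existsNP[i /negP] : ~ cbox B x by move=> h; apply: xB; rewrite inE.
  by rewrite -ltNge; exact: vf.
apply/(integrable_mkcond _ (measurable_cbox B)).
apply: measurable_bounded_integrable.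
- exact: measurable_cbox.
- exact: cbox_finite.
- exact: measurable_funTS.
have [M M0 hM] := vanishes_off_bounded cf vf.
exists M; split; first exact: num_real.
by move=> y My x _; apply: le_trans (hM x) (ltW My).
Qed.

(** Both orders are needed: the inner integral must contain the coordinate of differentiation, be it
    the head or one of the tail. *)
Lemma integral_consV n (f : 'rV[R]_n.+1 -> R) :
  measurable_fun setT f ->
  (lebesgueV R n.+1).-integrable setT (EFin \o f) ->
  (\int[lebesgueV R n.+1]_x (f x)%:E =
     \int[lebesgue_measure]_a \int[lebesgueV R n]_x (f (consV (a, x)))%:E)%E /\
  (\int[lebesgueV R n.+1]_x (f x)%:E =
     \int[lebesgueV R n]_x \int[lebesgue_measure]_a (f (consV (a, x)))%:E)%E.
Proof.
move=> mf fi.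
have mc := @measurable_consV R n.
pose m := (@lebesgue_measure R \x lebesgueV R n)%E.
have mF : measurable_fun [set: measurableTypeR R * 'rV[R]_n] (EFin \o f \o @consV R n).
  by apply: measurableT_comp => //; exact: measurableT_comp.
have iF : m.-integrable setT (EFin \o f \o @consV R n).
  apply/integrableP; split=> //.
  have /integrableP[_] := fi; apply: le_lt_trans.
  rewrite [leRHS](ge0_integral_pushforward mc) //=.
  by apply: measurableT_comp => //; exact: measurableT_comp.
have -> : (\int[lebesgueV R n.+1]_x (f x)%:E = \int[m]_x (EFin \o f \o @consV R n) x)%E.
  have mEf : measurable_fun setT (EFin \o f) by exact: measurableT_comp.
  exact: (@integral_pushforward _ _ _ _ _ _ mc m setT (EFin \o f) mEf iF measurableT).
split; first by rewrite -(integral12_prod_meas1 iF).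
by rewrite -(integral21_prod_meas1 iF).
Qed.

Lemma integral_derive1_eq0 (B : R) (g : R -> R) : (forall x, derivable g x 1) ->
  continuous g^`()%classic -> (forall x, B < `|x| -> g x = 0) ->
  (\int[lebesgue_measure]_x (g^`()%classic x)%:E = 0)%E.
Proof.
(* [C] is positive whatever the sign of [B], and exceeds [B], so that [g] vanishes at the end points
   and near every point outside. *)
move=> dg cg gB; pose C : R := `|B| + 1.
have BC : B < C by rewrite /C; have := ler_norm B; lra.
have C0 : 0 < C by rewrite /C; have := normr_ge0 B; lra.
have g'0 x : ~ `[-C, C]%classic x -> g^`()%classic x = 0.
  move: x => /= x; rewrite in_itv /= -ler_norml => /negP; rewrite -ltNge => Cx.
  rewrite derive1E -[RHS](derive_cst (0 : R) x 1); apply: near_eq_derive.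
  have : \forall y \near x, B < `|y|.
    apply/nbhs_ballP; exists (`|x| - B) => /=; first by rewrite subr_gt0; lra.
    by move=> y; rewrite /ball /= => xy; have := lerB_dist x y; lra.
  by apply: filterS => y By; rewrite gB.
have -> : (\int[lebesgue_measure]_x (g^`()%classic x)%:E =
           \int[lebesgue_measure]_(x in `[(- C)%R, C]) (g^`()%classic x)%:E)%E.
  rewrite [RHS]integral_mkcond; apply: eq_integral => x _.
  rewrite patchE; case: ifPn => // /negP xB; rewrite g'0 // => h.
  by apply: xB; rewrite inE.
rewrite (@continuous_FTC2 _ _ g).
- by rewrite !gB ?subee // ?normrN ger0_norm // ltW.
- lra.
- exact: continuous_subspaceT.
- have cg' x : {for x, continuous g}.
    by apply: differentiable_continuous; exact/derivable1_diffP.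
  split=> [x _||]; first exact: dg.
    by apply: cvg_at_right_filter; exact: cg'.
  by apply: cvg_at_left_filter; exact: cg'.
- by [].
Qed.

Lemma delta_mxDE n (h : R) (k i : 'I_n) (y : 'rV[R]_n) :
  (h *: delta_mx ord0 k + y) ord0 i = h * (i == k)%:R + y ord0 i.
Proof. by rewrite !mxE eqxx. Qed.

Lemma delta_consV0 n (h a : R) (x : 'rV[R]_n) :
  h *: delta_mx ord0 ord0 + consV (a, x) = consV (h + a, x).
Proof.
apply/rowP => i; rewrite delta_mxDE; case: (unliftP ord0 i) => [j|] ->.
  by rewrite !consVS eq_sym (negbTE (neq_lift _ _)) mulr0 add0r.
by rewrite !consV0 !eqxx mulr1.
Qed.

Lemma delta_consVS n (h a : R) (x : 'rV[R]_n) j :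
  h *: delta_mx ord0 (lift ord0 j) + consV (a, x) =
  consV (a, h *: delta_mx ord0 j + x).
Proof.
apply/rowP => i; rewrite delta_mxDE; case: (unliftP ord0 i) => [k|] ->.
  by rewrite !consVS delta_mxDE (inj_eq lift_inj).
by rewrite !consV0 (negbTE (neq_lift _ _)) mulr0 add0r.
Qed.

(** A directional derivative sees only the restriction to a line, so agreement along lines
    transports it from one space to another. *)
Lemma difference_quotient_slice (V W U : normedModType R)
    (g : V -> U) (f : W -> U) x v y w :
  (forall h, g (h *: v + x) = f (h *: w + y)) ->
  (fun h => h^-1 *: ((g \o shift x) (h *: v) - g x)) =
  (fun h => h^-1 *: ((f \o shift y) (h *: w) - f y)).
Proof.
move=> E; apply/funext => h /=; rewrite E; congr (_ *: (_ - _)).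
by have := E 0; rewrite !scale0r !add0r.
Qed.

Lemma derive_slice (V W U : normedModType R) (g : V -> U) (f : W -> U) x v y w :
  (forall h, g (h *: v + x) = f (h *: w + y)) -> 'D_v g x = 'D_w f y.
Proof. by move=> /difference_quotient_slice E; rewrite /derive E. Qed.

Lemma derivable_slice (V W U : normedModType R) (g : V -> U) (f : W -> U) x v y w :
  (forall h, g (h *: v + x) = f (h *: w + y)) -> derivable f y w -> derivable g x v.
Proof. by move=> /difference_quotient_slice E; rewrite /derivable E. Qed.

Lemma consV_continuous1 n (x : 'rV[R]_n) : continuous (fun a : R => consV (a, x)).
Proof.
move=> a A /nbhs_ballP[e /= e0 eA]; apply/nbhs_ballP; exists e => //= b ab.
apply: eA; split=> // i j; rewrite (ord1 i).
case: (unliftP ord0 j) => [k|] ->; first by rewrite !consVS; exact: ballxx.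
by rewrite !consV0.
Qed.

Lemma consV_continuous2 n (a : R) : continuous (fun x : 'rV[R]_n => consV (a, x)).
Proof.
move=> x A /nbhs_ballP[e /= e0 eA]; apply/nbhs_ballP; exists e => //= y [_ xy].
apply: eA; split=> // i j; rewrite (ord1 i).
case: (unliftP ord0 j) => [k|] ->; first by rewrite !consVS; exact: xy.
by rewrite !consV0; exact: ballxx.
Qed.

Lemma comp_consV_continuous1 n (f : 'rV[R]_n.+1 -> R) (x : 'rV[R]_n) :
  continuous f -> continuous (fun a : R => f (consV (a, x))).
Proof.
move=> cf a; apply: (@continuous_comp _ _ _ (fun a : R => consV (a, x)) f).
  exact: consV_continuous1.
exact: cf.
Qed.

Lemma comp_consV_continuous2 n (f : 'rV[R]_n.+1 -> R) (a : R) :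
  continuous f -> continuous (fun x : 'rV[R]_n => f (consV (a, x))).
Proof.
move=> cf x; apply: (@continuous_comp _ _ _ (fun x : 'rV[R]_n => consV (a, x)) f).
  exact: consV_continuous2.
exact: cf.
Qed.

Lemma vanishes_off_derive n (B : R) (f : 'rV[R]_n -> R) v : vanishes_off B f ->
  vanishes_off B (fun x => 'D_v f x).
Proof.
move=> vf x i Bx; rewrite -[RHS](derive_cst (0 : R) x v); apply: near_eq_derive.
have : \forall y \near x, B < `|(y : 'rV[R]_n) ord0 i|.
  apply/nbhs_ballP; exists (`|x ord0 i| - B) => /=; first by rewrite subr_gt0.
  move=> y [_ /(_ ord0 i)]; rewrite /ball /= => xy.
  have := lerB_dist (x ord0 i) (y ord0 i); lra.
by apply: filterS => y By; rewrite (vf y i).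
Qed.

(** By Fubini the differentiated coordinate is integrated first: by the fundamental theorem of
    calculus if it is the head, by induction if it is in the tail. *)
Lemma integral_derive_eq0 n (j : 'I_n) (B : R) (f : 'rV[R]_n -> R) :
  continuous f -> (forall x, derivable f x (delta_mx ord0 j)) ->
  continuous (fun x => 'D_(delta_mx ord0 j) f x) -> vanishes_off B f ->
  (\int[lebesgueV R n]_x ('D_(delta_mx ord0 j) f x)%:E = 0)%E.
Proof.
elim: n j f => [[]//|n IH] j f cf df cdf vf.
have mD := continuous_measurable_rV cdf.
have iD := vanishes_off_integrable cdf (vanishes_off_derive (delta_mx ord0 j) vf).
have [h1 h2] := integral_consV mD iD.
move: j df cdf mD iD h1 h2 => j; case: (unliftP ord0 j) => [k|] -> df cdf mD iD h1 h2.
  rewrite h1; apply: integral0_eq => a _.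
  pose g x := f (consV (a, x)).
  have gE x h : g (h *: delta_mx ord0 k + x) =
      f (h *: delta_mx ord0 (lift ord0 k) + consV (a, x)).
    by rewrite /g delta_consVS.
  have gD x := derive_slice (gE x).
  under eq_integral do rewrite -gD.
  apply: IH.
  - exact: (comp_consV_continuous2 (a := a) cf).
  - by move=> x; exact: derivable_slice (gE x) (df _).
  - move=> x; rewrite (_ : (fun _ => _) =
      (fun x => 'D_(delta_mx ord0 (lift ord0 k)) f (consV (a, x)))); last exact/funext.
    exact: (comp_consV_continuous2 (a := a) cdf).
  - by move=> x i Bx; apply: (vf _ (lift ord0 i)); rewrite consVS.
rewrite h2; apply: integral0_eq => x _.
pose g a := f (consV (a, x)).
have gE a (h : R) : g (h *: (1 : R) + a) = f (h *: delta_mx ord0 ord0 + consV (a, x)).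
  by rewrite /g delta_consV0 [_ *: 1]mulr1.
have gD a : g^`()%classic a = 'D_(delta_mx ord0 ord0) f (consV (a, x)).
  by rewrite derive1E (derive_slice (gE a)).
under eq_integral do rewrite -gD.
apply: (@integral_derive1_eq0 B).
- by move=> a; exact: derivable_slice (gE a) (df _).
- move=> a; rewrite (_ : g^`()%classic =
    (fun a => 'D_(delta_mx ord0 ord0) f (consV (a, x)))); last exact/funext.
  exact: (comp_consV_continuous1 (x := x) cdf).
- by move=> a Ba; apply: (vf _ ord0); rewrite consV0.
Qed.

End measure_rV.

(** * Smooth functions *)

Section smooth_functions.
Context {R : realType}.

Lemma MVT_line (V : normedModType R) (f : V -> R) v x (h : R) : 0 < h ->
  (forall y, derivable f y v) ->
  exists c : R, [/\ 0 < c, c < h & f (h *: v + x) - f x = h * 'D_v f (c *: v + x)].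
Proof.
move=> h0 df; pose g (t : R) := f (t *: v + x).
have gE (t k : R) : g (k *: (1 : R) + t) = f (k *: v + (t *: v + x)).
  by rewrite /g [_ *: 1]mulr1 scalerDl addrA.
have dg (t : R) : is_derive t (1 : R) g ('D_v f (t *: v + x)).
  by apply: DeriveDef; [exact: derivable_slice (gE t) (df _)|exact: derive_slice (gE t)].
have cg : {within `[0, h], continuous g}.
  apply: derivable_within_continuous => t _; exact: ex_derive.
have [c] := MVT h0 (fun t _ => dg t) cg.
rewrite in_itv /= => /andP[c0 ch]; rewrite subr0 {1}/g => E.
exists c; split=> //; rewrite mulrC -E /g scale0r add0r //.
Qed.

(** Mean value theorem along [v] for y -> f (y + h w) - f y, then along [w] for the derivative of
    [f] along [v]. *)
Lemma MVT_second_difference (V : normedModType R) (f : V -> R) v w :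
  (forall y, derivable f y v) -> (forall y, derivable (fun z => 'D_v f z) y w) ->
  forall x (h : R), 0 < h -> exists c d : R, [/\ 0 < c < h, 0 < d < h &
    f (h *: v + (h *: w + x)) - f (h *: w + x) - (f (h *: v + x) - f x) =
    h * h * 'D_w (fun z => 'D_v f z) (c *: v + d *: w + x)].
Proof.
move=> dv dvw x h h0.
pose f1 y := f (h *: w + y).
have df1 y : is_derive y v f1 ('D_v f (h *: w + y)).
  have E (k : R) : f1 (k *: v + y) = f (k *: v + (h *: w + y)).
    by rewrite /f1 addrCA.
  by apply: DeriveDef; [exact: derivable_slice E (dv _)|exact: derive_slice E].
have dg y : is_derive y v (f1 - f) ('D_v f (h *: w + y) - 'D_v f y).
  by apply: is_deriveB; exact: derivableP.
have [c [c0 ch E]] := @MVT_line V (f1 - f) v x h h0 (fun y => @ex_derive _ _ _ _ _ _ _ (dg y)).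
have [d [d0 dh E']] := @MVT_line V (fun z => 'D_v f z) w (c *: v + x) h h0 dvw.
exists c, d; split; [by rewrite c0|by rewrite d0|].
move: E; rewrite (@derive_val _ _ _ _ _ _ _ (dg _)) E' => E.
rewrite mulrA in E.
have -> : c *: v + d *: w + x = d *: w + (c *: v + x) by rewrite addrA (addrC (d *: w)).
apply: etrans _ E.
change (f (h *: v + (h *: w + x)) - f (h *: w + x) - (f (h *: v + x) - f x) =
  f (h *: w + (h *: v + x)) - f (h *: v + x) - (f (h *: w + x) - f x)).
rewrite [h *: w + (h *: v + x)]addrCA.
by move: (f _) (f (h *: w + x)) (f (h *: v + x)) (f x) => A B C D; ring.
Qed.

(** The second difference is symmetric in [v] and [w], so [G] and [H] take a common value at two
    points close to [x]; continuity concludes. *)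
Lemma eq_mean_values (V : normedModType R) (f G H : V -> R) v w x :
  (forall h : R, 0 < h -> exists c d : R, [/\ 0 < c < h, 0 < d < h &
    f (h *: v + (h *: w + x)) - f (h *: w + x) - (f (h *: v + x) - f x) =
    h * h * G (c *: v + d *: w + x)]) ->
  (forall h : R, 0 < h -> exists c d : R, [/\ 0 < c < h, 0 < d < h &
    f (h *: w + (h *: v + x)) - f (h *: v + x) - (f (h *: w + x) - f x) =
    h * h * H (c *: w + d *: v + x)]) ->
  {for x, continuous G} -> {for x, continuous H} -> G x = H x.
Proof.
move=> mG mH cG cH; apply/eqP; rewrite -subr_eq0 -normr_le0.
apply/ler_addgt0Pl => e e0; rewrite addr0.
have e2 : 0 < e / 2 by rewrite divr_gt0.
have /cvgrPdist_lt/(_ _ e2)/nbhs_ballP[d1 /= d10 b1] := cG.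
have /cvgrPdist_lt/(_ _ e2)/nbhs_ballP[d2 /= d20 b2] := cH.
pose d := Num.min d1 d2; have d0 : 0 < d by rewrite lt_min d10.
have dd1 : d <= d1 by rewrite /d ge_min lexx.
have dd2 : d <= d2 by rewrite /d ge_min lexx orbT.
(* The added 1 keeps [N] positive for zero directions and the ball inequality strict. *)
pose N := `|v| + `|w| + 1; have N0 : 0 < N by rewrite ltr_wpDl // addr_ge0.
pose h := d / N; have h0 : 0 < h by rewrite divr_gt0.
have small (c k : R) : 0 < c < h -> 0 < k < h -> ball x d (c *: v + k *: w + x).
  move=> /andP[c0 ch] /andP[k0 kh]; rewrite -ball_normE /=.
  rewrite opprD addrCA subrr addr0 normrN.
  apply: le_lt_trans (ler_normD _ _) _; rewrite !normrZ !gtr0_norm //.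
  have -> : d = h * `|v| + h * `|w| + h * 1.
    by rewrite -!mulrDr -/N /h divfK // gt_eqF.
  have := ler_wpM2r (normr_ge0 v) (ltW ch); have := ler_wpM2r (normr_ge0 w) (ltW kh).
  lra.
have [c1 [k1 [H1 H2 E1]]] := mG h h0.
have [c2 [k2 [H3 H4 E2]]] := mH h h0.
have B1 := b1 _ (le_ball dd1 (small _ _ H1 H2)).
have B2 := b2 _ (le_ball dd2 (small _ _ H4 H3)).
rewrite (addrCA (h *: w)) in E2; rewrite [c2 *: w + _]addrC in E2.
move: B1 B2 E1 E2 => /=.
move: (G (_ + x)) (H (_ + x)) (G x) (H x) (f _) (f _) (f _) (f _).
move=> G' H' Gx Hx a b a' b' B1 B2 E1 E2.
have E : G' = H'.
  apply: (mulfI (x := h * h)); first by rewrite mulf_neq0 // gt_eqF.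
  by rewrite -E1 -E2; ring.
rewrite E in B1; move: B1 B2; rewrite !ltr_norml => /andP[? ?] /andP[? ?].
by rewrite ler_norml; apply/andP; split; lra.
Qed.

Lemma derive_commute (V : normedModType R) (f : V -> R) v w :
  (forall y, derivable f y v) -> (forall y, derivable f y w) ->
  (forall y, derivable (fun z => 'D_v f z) y w) ->
  (forall y, derivable (fun z => 'D_w f z) y v) ->
  continuous (fun y => 'D_w (fun z => 'D_v f z) y) ->
  continuous (fun y => 'D_v (fun z => 'D_w f z) y) ->
  forall x, 'D_w (fun z => 'D_v f z) x = 'D_v (fun z => 'D_w f z) x.
Proof.
move=> dv dw dvw dwv cvw cwv x.
apply: (@eq_mean_values V f (fun y => 'D_w (fun z => 'D_v f z) y)
  (fun y => 'D_v (fun z => 'D_w f z) y) v w x).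
- exact: MVT_second_difference dv dvw x.
- exact: MVT_second_difference dw dwv x.
- exact: cvw.
- exact: cwv.
Qed.

Lemma pD_cat n (s t : seq 'I_n) (phi : 'rV[R]_n -> R) : pD (s ++ t) phi = pD s (pD t phi).
Proof. exact: foldr_cat. Qed.

Lemma smooth_pD n (t : seq 'I_n) (phi : 'rV[R]_n -> R) : smooth phi -> smooth (pD t phi).
Proof. by move=> sphi s; rewrite -pD_cat; exact: sphi. Qed.

Lemma pD_comb n (s : seq 'I_n) (a : R) (phi psi : 'rV[R]_n -> R) : smooth phi -> smooth psi ->
  pD s (a *: phi + psi) = a *: pD s phi + pD s psi.
Proof.
move=> sphi spsi; elim: s => //= i s ->; apply/funext => x.
rewrite deriveD; [|exact/derivableZ/(sphi s).2|exact: (spsi s).2].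
by rewrite deriveZ //; exact: (sphi s).2.
Qed.

Lemma smooth_comb n (a : R) (phi psi : 'rV[R]_n -> R) : smooth phi -> smooth psi ->
  smooth (a *: phi + psi).
Proof.
move=> sphi spsi s; rewrite pD_comb //; split=> [x|i x].
  apply: continuousD; last exact: (spsi s).1.
  by apply: continuousZr; exact: (sphi s).1.
by apply: derivableD; [exact/derivableZ/(sphi s).2|exact: (spsi s).2].
Qed.

Lemma pD_commute n (i j : 'I_n) (phi : 'rV[R]_n -> R) : smooth phi ->
  pD [:: i; j] phi = pD [:: j; i] phi.
Proof.
move=> sphi; apply/funext => x /=; apply: derive_commute.
- exact: (sphi [::]).2.
- exact: (sphi [::]).2.
- exact: (sphi [:: j]).2.
- exact: (sphi [:: i]).2.
- exact: (sphi [:: i; j]).1.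
- exact: (sphi [:: j; i]).1.
Qed.

Lemma pD_support n (s : seq 'I_n) (phi : 'rV[R]_n -> R) :
  [set x | pD s phi x != 0] `<=` closure [set x | phi x != 0].
Proof.
elim: s => [|i s IH] x /=; first exact: (@subset_closure _ _ x).
apply: contraPP => xC.
have : \forall y \near x, pD s phi y = 0.
  have : (~` closure [set x | phi x != 0]) x by [].
  move=> /(conj (closed_openC (@closed_closure _ [set x | phi x != 0]))).
  move=> /(@open_nbhs_nbhs _ x); apply: filterS => y yC; apply/eqP/negP => /negP y0; exact/yC/IH.
move=> /near_eq_derive -> ; rewrite -[fun=> 0]/(cst 0) derive_cst => /eqP; exact.
Qed.

Lemma test_function_pD n (s : seq 'I_n) Omega (phi : 'rV[R]_n -> R) :
  test_function Omega phi -> test_function Omega (pD s phi).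
Proof.
move=> [sphi cphi phiO].
have sub : closure [set x | pD s phi x != 0] `<=` closure [set x | phi x != 0].
  rewrite [X in _ `<=` X](closure_id _).1; last exact: closed_closure.
  by apply: closureS; exact: pD_support.
split; [exact: smooth_pD| |exact: subset_trans sub phiO].
exact: subclosed_compact (@closed_closure _ _) cphi sub.
Qed.

Lemma test_function_comb n (a : R) Omega (phi psi : 'rV[R]_n -> R) :
  test_function Omega phi -> test_function Omega psi -> test_function Omega (a *: phi + psi).
Proof.
move=> [sphi cphi phiO] [spsi cpsi psiO].
have sub : closure [set x | (a *: phi + psi) x != 0] `<=`
    closure [set x | phi x != 0] `|` closure [set x | psi x != 0].
  rewrite -closureU; apply: closureS => x /= h; apply/orP.
  apply: contraNT h; rewrite negb_or !negbK => /andP[/eqP p0 /eqP q0].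
  by rewrite -[_ x]/(a * phi x + psi x) p0 q0 mulr0 addr0.
split; first exact: smooth_comb.
  apply: subclosed_compact (@closed_closure _ _) _ sub; exact: compactU.
by apply: subset_trans sub _; rewrite subUset.
Qed.

Lemma test_function0 n (Omega : set 'rV[R]_n) : test_function Omega (0 : 'rV[R]_n -> R).
Proof.
have E : [set x : 'rV[R]_n | (0 : 'rV[R]_n -> R) x != 0] = set0.
  by apply/seteqP; split=> x //=; rewrite eqxx.
split; rewrite ?E ?closure0 //; last exact: compact0.
have p0 s : pD s (0 : 'rV[R]_n -> R) = cst 0.
  by elim: s => //= i s ->; apply/funext => x; rewrite derive_cst.
move=> s; rewrite p0; split=> [x|i x]; first exact: cst_continuous.
exact: derivable_cst.
Qed.

Lemma test_function_out n Omega (phi : 'rV[R]_n -> R) x :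
  test_function Omega phi -> ~ Omega x -> phi x = 0.
Proof.
move=> [_ _ phiO] xO; apply/eqP/negP => /negP x0; apply/xO/phiO.
exact: subset_closure.
Qed.

Lemma test_function_vanishes_off n Omega (phi : 'rV[R]_n -> R) :
  test_function Omega phi -> exists B : R, vanishes_off B phi.
Proof.
move=> [_ /compact_bounded[M [_ hM]] _]; exists (M + 1) => x i xi.
apply/eqP/negP => /negP x0.
have M1 : M < M + 1 by rewrite ltrDl.
have /= := hM (M + 1) M1 x (@subset_closure _ [set x | phi x != 0] x x0).
apply/negP; rewrite -ltNge; apply: lt_le_trans xi _.
rewrite [leRHS]/Num.norm /= mx_normrE; exact: (le_bigmax _ _ (ord0, i)).
Qed.

(* Polynomial multiples of the flat function [exp(-1/t)], a class closed under
   derivation. *)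
Definition exp_inv (p : {poly R}) (t : R) : R :=
  if 0 < t then p.[t^-1] * expR (- t^-1) else 0.

(** Raise 1 + z <= exp z, taken at z = y / k, to the power k. *)
Lemma powx_le_expR k : exists2 C : R, 0 <= C & forall y, 0 <= y -> y ^+ k <= C * expR y.
Proof.
case: k => [|k].
  exists 1 => // y y0; rewrite expr0 mul1r.
  by apply: le_trans (expR_ge1Dx y); rewrite lerDl.
exists (k.+1%:R ^+ k.+1) => [|y y0]; first exact: exprn_ge0.
have -> : expR y = expR (y / k.+1%:R) ^+ k.+1.
  by rewrite -expRM_natl mulrC divfK // pnatr_eq0.
rewrite -exprMn ler_pXn2r ?nnegrE //.
rewrite -ler_pdivrMl ?ltr0n // mulrC; apply: le_trans (expR_ge1Dx _).
by rewrite lerDr.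
Qed.

(** The additional power of [y] lets the induction on [p] absorb a factor ['X]. *)
Lemma poly_le_expR (p : {poly R}) k : exists2 C : R, 0 <= C &
  forall y, 0 <= y -> `|p.[y]| * y ^+ k <= C * expR y.
Proof.
elim/poly_ind: p k => [|p c IH] k.
  by exists 0 => // y _; rewrite horner0 normr0 !mul0r.
have [C C0 hC] := IH k.+1; have [D D0 hD] := powx_le_expR k.
exists (C + `|c| * D) => [|y y0]; first by rewrite addr_ge0 // mulr_ge0.
rewrite hornerMXaddC; apply: le_trans (ler_wpM2r (exprn_ge0 k y0) (ler_normD _ _)) _.
rewrite !mulrDl lerD //; last by rewrite -mulrA ler_wpM2l // hD.
by rewrite normrM (ger0_norm y0) -mulrA -exprS hC.
Qed.

(** With s = 1/t, so that s' = - s^2, the derivative of p(s) exp(-s) is s^2 (p - p')(s) exp(-s). At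
    0 the exponential beats every polynomial in s. *)
Lemma is_derive_exp_inv (p : {poly R}) (t : R) :
  is_derive t (1 : R) (exp_inv p) (exp_inv ('X ^+ 2 * (p - p^`())) t).
Proof.
have [t0|] := ltP t 0.
  rewrite {2}/exp_inv ltNge (ltW t0) /=.
  have := is_derive_cst (0 : R) t (1 : R); apply: near_eq_is_derive.
  near=> s; rewrite /exp_inv ltNge (ltW _) //=.
  near: s; exact: lt_nbhsl.
rewrite le_eqVlt => /predU1P[<-|t0]; last first.
  rewrite {2}/exp_inv t0.
  apply: (@near_eq_is_derive _ _ _ ((horner p \o GRing.inv) * (expR \o (-%R \o GRing.inv)))).
    near=> s; rewrite /exp_inv ifT //; near: s; exact: lt_nbhsr.
  have dV : is_derive t (1 : R) (GRing.inv : R -> R) (- t ^- 2).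
    have tn0 : t != 0 by rewrite gt_eqF.
    apply: DeriveDef; first exact: (@derivableV _ _ id _ _ tn0 (@derivable_id _ _ _ _)).
    by rewrite (@deriveV _ _ id _ _ tn0 (@derivable_id _ _ _ _)) derive_id [_ *: _]mulr1.
  have dE : is_derive t (1 : R) (expR \o (-%R \o GRing.inv)) (expR (- t^-1) * - (- t ^- 2)).
    by apply: is_derive1_comp; exact: is_deriveN.
  have dP : is_derive t (1 : R) (horner p \o GRing.inv) (p^`().[t^-1] * (- t ^- 2)).
    exact: is_derive1_comp.
  apply: is_derive_eq (is_deriveM dP dE) _.
  rewrite hornerM hornerXn hornerD hornerN exprVn /= /GRing.scale /=; ring.
(* Power 2: one factor pays for the difference quotient, the other leaves [|h|]. *)
have [C C0 hC] := poly_le_expR p 2.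
have e0 : exp_inv p 0 = 0 by rewrite /exp_inv ltxx.
have bound (h : R) : `|h^-1 * exp_inv p h| <= C * `|h|.
  rewrite /exp_inv; case: ifPn => h0; last by rewrite mulr0 normr0 mulr_ge0.
  have hi : 0 <= h^-1 by rewrite invr_ge0 ltW.
  have := hC _ hi; rewrite !normrM (gtr0_norm h0) (ger0_norm hi) (ger0_norm (expR_ge0 _)).
  rewrite expRN -ler_pdivrMr ?expR_gt0 // => /(ler_wpM2l (ltW h0)).
  rewrite [C * h]mulrC; apply: le_trans.
  rewrite le_eqVlt; apply/orP; left; apply/eqP.
  by field; rewrite !gt_eqF ?expR_gt0.
have lim0 : h^-1 *: ((exp_inv p \o shift 0) (h *: (1 : R)) - exp_inv p 0) @[h --> 0^'] --> (0 : R).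
  apply/cvgrPdist_le => e e0'.
  have C1 : 0 < C + 1 by rewrite ltr_wpDl.
  have eC : 0 < e / (C + 1) by rewrite divr_gt0.
  near=> h; rewrite sub0r normrN /= e0 subr0 addr0 [h *: 1]mulr1.
  apply: le_trans (bound h) _.
  have : `|h| <= e / (C + 1) by near: h; exact: (@dnbhs0_le _ R _ eC).
  by rewrite ler_pdivlMr // mulrC; apply: le_trans; rewrite ler_wpM2r // lerDl.
rewrite {2}/exp_inv ltxx; apply: DeriveDef; last exact: cvg_lim lim0.
by apply/cvg_ex; exists 0.
Unshelve. all: by end_near. Qed.

(** A class of continuous functions stable under partial derivatives, so that smoothness needs no
    computation of higher derivatives. *)
Inductive elementary n : ('rV[R]_n -> R) -> Prop :=
| elementary_exp p (i : 'I_n) (a b : R) :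
    elementary (fun x => exp_inv p (a * x ord0 i + b))
| elementary_cst c : elementary (fun=> c)
| elementary_add f g : elementary f -> elementary g -> elementary (fun x => f x + g x)
| elementary_mul f g : elementary f -> elementary g -> elementary (fun x => f x * g x).

Lemma elementary_derive n (f : 'rV[R]_n -> R) j : elementary f ->
  exists2 g, elementary g & forall x, is_derive x (delta_mx ord0 j) f (g x).
Proof.
elim=> {f} [p i a b|c|f g ef [f' ef' df] eg [g' eg' dg]|f g ef [f' ef' df] eg [g' eg' dg]].
- exists (fun x => exp_inv ('X ^+ 2 * (p - p^`())) (a * x ord0 i + b) * (a * (i == j)%:R)).
    apply: elementary_mul; [exact: elementary_exp|exact: elementary_cst].
  move=> x; pose l (s : R) := a * (i == j)%:R * s + (a * x ord0 i + b).
  have dl : is_derive 0 (1 : R) l (a * (i == j)%:R).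
    rewrite (_ : l = (a * (i == j)%:R) \*: id + cst (a * x ord0 i + b)); last exact/funext.
    by apply: is_derive_eq; rewrite addr0 [_ *: 1]mulr1.
  have := is_derive1_comp (is_derive_exp_inv p (l 0)) dl.
  rewrite {2}/l mulr0 add0r => -[dc dcE].
  have E (h : R) : exp_inv p (a * (h *: delta_mx ord0 j + x) ord0 i + b) =
      (exp_inv p \o l) (h *: 1 + 0).
    by rewrite delta_mxDE /l /= addr0 [h *: 1]mulr1; congr exp_inv; ring.
  apply: DeriveDef; first exact: derivable_slice E dc.
  by rewrite -dcE; exact: derive_slice E.
- by exists (fun=> 0) => [|x]; [exact: elementary_cst|exact: is_derive_cst].
- exists (fun x => f' x + g' x) => [|x]; first exact: elementary_add.
  exact: is_deriveD.
exists (fun x => f x * g' x + g x * f' x) => [|x].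
  by apply: elementary_add; exact: elementary_mul.
exact: is_deriveM.
Qed.

Lemma exp_inv_continuous (p : {poly R}) : continuous (exp_inv p).
Proof.
move=> t; apply/differentiable_continuous/derivable1_diffP.
by have [] := is_derive_exp_inv p t.
Qed.

Lemma elementary_continuous n (f : 'rV[R]_n -> R) : elementary f -> continuous f.
Proof.
elim=> {f} [p i a b|c|f g _ cf _ cg|f g _ cf _ cg] x.
- apply: (@continuous_comp _ _ _ (fun x : 'rV[R]_n => a * x ord0 i + b) (exp_inv p));
    last exact: exp_inv_continuous.
  apply: continuousD; last exact: cst_continuous.
  apply: continuousM; [exact: cst_continuous|exact: coord_continuous].
- exact: cst_continuous.
- by apply: continuousD; [exact: cf|exact: cg].
- by apply: continuousM; [exact: cf|exact: cg].
Qed.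

Lemma elementary_smooth n (f : 'rV[R]_n -> R) : elementary f -> smooth f.
Proof.
move=> ef.
have pDe s : elementary (pD s f).
  elim: s => //= i s IH; have [g eg dg] := elementary_derive i IH.
  by rewrite (_ : (fun _ => _) = g) //; apply/funext => x; exact: derive_val.
move=> s; split; first exact: elementary_continuous.
by move=> i x; have [g _ /(_ x)[]] := elementary_derive i (pDe s).
Qed.

Lemma elementary_prod n (I : Type) (r : seq I) (f : I -> 'rV[R]_n -> R) :
  (forall i, elementary (f i)) -> elementary (fun x => \prod_(i <- r) f i x).
Proof.
move=> ef; elim: r => [|i r IH].
  rewrite (_ : (fun _ => _) = fun=> 1); first exact: elementary_cst.
  by apply/funext => x; rewrite big_nil.
rewrite (_ : (fun _ => _) = fun x => f i x * \prod_(j <- r) f j x).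
  exact: elementary_mul.
by apply/funext => x; rewrite big_cons.
Qed.

(** As [m] grows this increases to the indicator of the open box, the support staying in a closed
    box independent of [m]. *)
Definition bumpf n (a b : 'I_n -> R) (m : nat) (x : 'rV[R]_n) : R :=
  \prod_(i < n) (exp_inv 1 (m.+1%:R * (x ord0 i - a i)) * exp_inv 1 (m.+1%:R * (b i - x ord0 i))).

Lemma bump_smooth n (a b : 'I_n -> R) m : smooth (bumpf a b m).
Proof.
apply/elementary_smooth/elementary_prod => i; apply: elementary_mul.
  rewrite (_ : (fun _ => _) = fun x : 'rV[R]_n =>
      exp_inv 1 (m.+1%:R * x ord0 i + - (m.+1%:R * a i))).
    exact: elementary_exp.
  by apply/funext => x; rewrite mulrBr.
rewrite (_ : (fun _ => _) = fun x : 'rV[R]_n => exp_inv 1 (- m.+1%:R * x ord0 i + m.+1%:R * b i)).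
  exact: elementary_exp.
by apply/funext => x; rewrite mulrBr mulNr addrC.
Qed.

Lemma exp_inv1_ge0 t : 0 <= exp_inv 1 t <= 1.
Proof.
rewrite /exp_inv; case: ifPn => [t0|_]; last by rewrite lexx ler01.
by rewrite hornerC mul1r expR_ge0 -[X in _ <= X]expR0 ler_expR oppr_le0 invr_ge0 ltW.
Qed.

Lemma bump_bounds n (a b : 'I_n -> R) m x : 0 <= bumpf a b m x <= 1.
Proof.
rewrite /bumpf; elim/big_ind: _ => [|u v /andP[u0 u1] /andP[v0 v1]|i _].
- by rewrite ler01 lexx.
- by rewrite mulr_ge0 //= mulr_ile1.
have /andP[u0 u1] := exp_inv1_ge0 (m.+1%:R * (x ord0 i - a i)).
have /andP[v0 v1] := exp_inv1_ge0 (m.+1%:R * (b i - x ord0 i)).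
by rewrite mulr_ge0 //= mulr_ile1.
Qed.

Lemma bump_out n (a b : 'I_n -> R) m x : ~ obox a b x -> bumpf a b m x = 0.
Proof.
move=> /existsNP[i] /=; rewrite in_itv /= => /negP; rewrite negb_and -!leNgt => xi.
rewrite /bumpf (bigD1 i) //=.
suff -> : exp_inv 1 (m.+1%:R * (x ord0 i - a i)) * exp_inv 1 (m.+1%:R * (b i - x ord0 i)) = 0.
  by rewrite mul0r.
case/orP: xi => xi; apply/eqP; rewrite mulf_eq0 /exp_inv; apply/orP; [left|right];
  by rewrite ltNge mulr_ge0_le0 //= ?subr_le0.
Qed.

Lemma bump_test n (a b : 'I_n -> R) m Omega : kbox a b `<=` Omega ->
  test_function Omega (bumpf a b m).
Proof.
move=> kO.
have kc : compact (kbox a b).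
  by apply: (@rV_compact _ n (fun i => `[a i, b i]%classic)) => i; exact: segment_compact.
have sub : closure [set x | bumpf a b m x != 0] `<=` kbox a b.
  rewrite [X in _ `<=` X](closure_id _).1; last first.
    by apply: compact_closed => //; exact: norm_hausdorff.
  apply: closureS => x /= /eqP h i.
  have : obox a b x by apply: contrapT => /bump_out.
  by move=> /(_ i) /=; exact: subset_itv_oo_cc.
split; first exact: bump_smooth.
  exact: subclosed_compact (@closed_closure _ _) kc sub.
exact: subset_trans sub kO.
Qed.

Lemma bump_cvg n (a b : 'I_n -> R) x :
  bumpf a b m x @[m --> \oo] --> (\1_(obox a b) x : R).
Proof.
have [xb|xb] := pselect (obox a b x); last first.
  rewrite indicE memNset //=; under eq_fun do rewrite bump_out //.
  exact: cvg_cst.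
rewrite indicE mem_set //=.
have c1 t : 0 < t -> exp_inv 1 (m.+1%:R * t) @[m --> \oo] --> (1 : R).
  move=> t0.
  have : expR (- (t^-1 * harmonic m)) @[m --> \oo] --> expR (- (t^-1 * 0)).
    apply: continuous_cvg; first exact: continuous_expR.
    apply: cvgN; apply: cvgMr; exact: cvg_harmonic.
  rewrite mulr0 oppr0 expR0; apply: cvg_trans; apply: near_eq_cvg.
  near=> m; rewrite /exp_inv ifT ?hornerC ?mul1r ?invfM ?mulr_gt0 //.
  by rewrite mulrC.
rewrite /bumpf; elim: (index_enum _) => [|i r IH].
  by under eq_fun do rewrite big_nil; exact: cvg_cst.
under eq_fun do rewrite big_cons.
have := xb i; rewrite /= in_itv /= => /andP[ax bx].
rewrite -subr_gt0 in ax; rewrite -subr_gt0 in bx.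
have H := cvgM (cvgM (c1 _ ax) (c1 _ bx)) IH.
by rewrite !mulr1 in H; exact: H.
Unshelve. all: by end_near. Qed.

End smooth_functions.

(** * Fundamental lemma of the calculus of variations *)

Section fundamental_lemma.
Context {R : realType} {n : nat}.
Local Notation mu := (lebesgueV R n).

(** Open boxes are stable under intersection, as the pi-lambda theorem asks of generators. A slab u
    < x_i < v is a union of growing boxes. *)
Lemma measurable_rV_obox : @measurable _ 'rV[R]_n = <<s range (fun ab => obox ab.1 ab.2) >>.
Proof.
apply/seteqP; split; last first.
  apply: smallest_sub; first exact: sigma_algebra_measurable.
  by move=> _ [[a b] _ <-]; exact: obox_measurable.
apply: smallest_sub; first exact: smallest_sigma_algebra.
rewrite -bigcup_seq; apply: bigcup_sub => i _ _ [B mB <-].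
rewrite setTI.
pose G := range (fun ab : ('I_n -> R) * ('I_n -> R) => obox ab.1 ab.2).
have : measurable_fun [set: g_sigma_algebraType G] (fun x : 'rV[R]_n => x ord0 i : R).
  apply: (measurability _ (RGenOpens.measurableE R)).
  move=> _ [_ [u [v ->]] <-]; rewrite setTI.
  have -> : (fun x : 'rV[R]_n => x ord0 i : R) @^-1` `]u, v[%classic =
      \bigcup_k obox (fun j => if j == i then u else - k%:R)
                     (fun j => if j == i then v else k%:R).
    apply/seteqP; split=> x /=; last first.
      by move=> [k _ /(_ i)] /=; rewrite eqxx.
    move=> xi; exists (Num.truncn (\sum_j `|x ord0 j|)).+1 => // j /=.
    have [->|ji] := eqVneq j i; first exact: xi.
    rewrite in_itv /= -ltr_norml; apply: le_lt_trans (truncnS_gt _).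
    by rewrite (bigD1 j) //= lerDl sumr_ge0.
  apply: bigcup_measurable => k _; apply: sub_sigma_algebra.
  by eexists (_, _).
by move=> /(_ measurableT B mB); rewrite setTI.
Qed.

Lemma obox_setI (a b c d : 'I_n -> R) : obox a b `&` obox c d =
  obox (fun i => Num.max (a i) (c i)) (fun i => Num.min (b i) (d i)).
Proof.
apply/seteqP; split=> x /= => [[h1 h2] i|h].
  have := h1 i; have := h2 i; rewrite /= !in_itv /= => /andP[? ?] /andP[? ?].
  by rewrite gt_max lt_min; apply/andP; split; apply/andP.
by split=> i; have := h i; rewrite /= !in_itv /= gt_max lt_min;
  move=> /andP[/andP[? ?] /andP[? ?]]; apply/andP.
Qed.

Variables (Omega : set 'rV[R]_n) (g : 'rV[R]_n -> R).
Hypotheses (oO : open Omega) (ig : mu.-integrable Omega (EFin \o g)).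
Hypothesis g0 : forall phi, test_function Omega phi -> dotL2 Omega g phi = 0.

Let mO : measurable Omega. Proof. exact: open_measurable_rV. Qed.

(** Dominated convergence: the bumps are bounded by 1 and tend to the indicator of the box. *)
Lemma integral_obox_eq0 a b : kbox a b `<=` Omega ->
  (\int[mu]_(x in obox a b) (g x)%:E = 0)%E.
Proof.
move=> kO.
have oO' : obox a b `<=` Omega.
  by move=> x xb; apply: kO => i; apply: subset_itv_oo_cc; exact: xb.
have mg : measurable_fun Omega g by apply/measurable_EFinP; exact: measurable_int ig.
have mb m : measurable_fun [set: 'rV[R]_n] (bumpf a b m).
  by apply: continuous_measurable_rV; exact: (bump_smooth a b m [::]).1.
have [] := @dominated_convergence _ _ _ mu Omega mO
  (fun m x => (g x * bumpf a b m x)%:E) (fun x => (g x * \1_(obox a b) x)%:E)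
  (fun x => `|(g x)%:E|%E).
- move=> m; apply/measurable_EFinP; apply: measurable_funM => //.
  exact: measurable_funTS.
- apply/measurable_EFinP; apply: measurable_funM => //.
  by apply: measurable_indic; exact: obox_measurable.
- apply: aeW => x _; apply: cvg_EFin; first exact: nearW.
  by apply: cvgMr; exact: bump_cvg.
- exact: integrable_abse.
- apply: aeW => x m _; rewrite /= lee_fin normrM ler_piMr //.
  by have /andP[h0 h1] := bump_bounds a b m x; rewrite ger0_norm.
move=> ib _.
have -> : (fun m => \int[mu]_(x in Omega) (g x * bumpf a b m x)%:E)%E = (fun=> 0%E).
  apply/funext => m; have := g0 (bump_test m kO).
  (* [dotL2] is a [fine] value, which is 0 at infinity too; integrability excludes that case. *)
  rewrite /dotL2 /Rintegral => h.
  rewrite -[LHS]fineK ?h //; apply: integrable_fin_num => //.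
  apply: (le_integrable mO _ _ ig).
    by apply/measurable_EFinP; apply: measurable_funM => //; exact: measurable_funTS.
  move=> x _; rewrite /= lee_fin normrM ler_piMr //.
  by have /andP[h0 h1] := bump_bounds a b m x; rewrite ger0_norm.
move=> /cvg_unique h.
transitivity (\int[mu]_(x in Omega) (g x * \1_(obox a b) x)%:E)%E.
  rewrite -[X in (\int[mu]_(x in X) _)%E](setIidr oO') integral_mkcondr.
  apply: eq_integral => x _; rewrite patchE indicE.
  by case: ifP => _; rewrite /= ?mulr1 ?mulr0.
by apply: h; [exact: ereal_hausdorff|exact: cvg_cst].
Qed.

(** The sets [E] with this property form a Dynkin class containing the open boxes. *)
Lemma integral_setI_obox_eq0 a b E : kbox a b `<=` Omega -> measurable E ->
  (\int[mu]_(x in E `&` obox a b) (g x)%:E = 0)%E.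
Proof.
move=> kO; have mQ : measurable (obox a b) by exact: obox_measurable.
have oO' : obox a b `<=` Omega.
  by move=> x xb; apply: kO => i; apply: subset_itv_oo_cc; exact: xb.
have iS A : measurable A -> mu.-integrable (A `&` obox a b) (EFin \o g).
  move=> mA; apply: integrableS ig => //; first exact: measurableI.
  by move=> x [_ /oO'].
rewrite measurable_rV_obox; move: E.
apply: (@dynkin_induction _ _ (range (fun ab : ('I_n -> R) * ('I_n -> R) => obox ab.1 ab.2))).
- exact: measurable_rV_obox.
- by move=> _ _ [[c d] _ <-] [[c' d'] _ <-]; rewrite obox_setI; eexists (_, _).
- by rewrite setTI; exact: integral_obox_eq0.
- move=> _ [[c d] _ <-] /=; rewrite obox_setI; apply: integral_obox_eq0.
  apply: subset_trans kO => x h i; have := h i.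
  by rewrite /= !in_itv /= ge_max le_min => /andP[/andP[_ ->] /andP[_ ->]].
- move=> S mS S0; have := integral_obox_eq0 kO.
  have E : obox a b = (S `&` obox a b) `|` (~` S `&` obox a b).
    by rewrite -setIUl setUv setTI.
  rewrite {1}E integral_setU //=.
  + by rewrite S0 add0e.
  + exact: measurableI.
  + by apply: measurableI => //; exact: measurableC.
  + rewrite -setIUl setUv; exact: (measurable_int _ (iS _ measurableT)).
  + by apply/disj_setPS => x [[? _] []].
move=> F mF tF F0; rewrite setI_bigcupl integral_bigcup //.
- by rewrite eseries0.
- apply/trivIsetP => i j _ _ ij; rewrite setIACA setIid.
  by move/trivIsetP: tF => /(_ i j Logic.I Logic.I ij) ->; rewrite set0I.
- by move=> k; exact: measurableI.
- by rewrite -setI_bigcupl; apply: iS; exact: bigcup_measurable.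
Qed.

(** On each box, zero integrals over all measurable subsets force [g] to vanish almost everywhere,
    and countably many such boxes fill [Omega]. *)
Lemma fundamental_lemma : {ae mu, forall x, Omega x -> g x = 0}.
Proof.
have [P [a [b [kO OE]]]] := open_bigcup_obox oO.
have neg k : mu.-negligible [set x | P k /\ obox (a k) (b k) x /\ g x != 0].
  have [Pk|nPk] := pselect (P k); last first.
    by apply: negligibleS (negligible_set0 _) => x [].
  have mQ : measurable (obox (a k) (b k)) by exact: obox_measurable.
  have iQ : mu.-integrable (obox (a k) (b k)) (EFin \o g).
    apply: integrableS ig => // x xb; rewrite OE; by exists k.
  have := @integral_ae_eq _ _ _ mu _ mQ (cst 0%E) _ iQ (measurable_cst _).
  move=> h; apply: negligibleS (h _).
    by move=> x /= [_ [xb /eqP gx]] /(_ xb) [].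
  move=> E EQ mE; rewrite integral0 -(setIidl EQ); apply: integral_setI_obox_eq0 => //.
  exact: kO.
have := negligible_bigcup neg; apply: negligibleS => x /= /not_implyP[].
by rewrite {1}OE => -[k Pk xk] gx; exists k => //; do 2 split=> //; exact/eqP.
Qed.

End fundamental_lemma.

(** * L2 and Sobolev spaces *)

Section L2_space.
Context {R : realType} {n : nat}.
Local Notation mu := (lebesgueV R n).
Variable Omega : set 'rV[R]_n.
Implicit Types f g h : 'rV[R]_n -> R.

Lemma restrict_comb a f g : (a *: f + g) \_ Omega = a *: (f \_ Omega) + g \_ Omega.
Proof.
apply/funext => x; rewrite -[RHS]/(a *: (f \_ Omega) x + (g \_ Omega) x) !patchE.
by case: ifP => // _; rewrite scaler0 addr0.
Qed.

Let one_le2 : (1 <= (2%:E : \bar R))%E. Proof. by rewrite lee_fin ler1n. Qed.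

Lemma L2_comb a f g : L2 Omega f -> L2 Omega g -> L2 Omega (a *: f + g).
Proof.
rewrite /L2 /= restrict_comb => mf mg.
exact: (Lfun_submod_closed mu one_le2).2.
Qed.

Lemma L2_0 : L2 Omega 0.
Proof.
rewrite /L2 /= (_ : 0 \_ Omega = 0); last by apply/funext => x; rewrite patchE; case: ifP.
exact: (Lfun_submod_closed mu one_le2).1.
Qed.

Lemma L2_sum (I : Type) (r : seq I) (F : I -> 'rV[R]_n -> R) :
  (forall i, L2 Omega (F i)) -> L2 Omega (\sum_(i <- r) F i).
Proof.
move=> LF; elim: r => [|i r IH]; first by rewrite big_nil; exact: L2_0.
by rewrite big_cons -[F i]scale1r; exact: L2_comb.
Qed.

Lemma L2_mul_integrable f g : L2 Omega f -> L2 Omega g ->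
  mu.-integrable setT (EFin \o (fun x => (f \_ Omega) x * (g \_ Omega) x)).
Proof. by move=> Lf Lg; apply/Lfun1_integrable; exact: Lfun2_mul_Lfun1. Qed.

Lemma dotL2E f g : dotL2 Omega f g = \int[mu]_x ((f \_ Omega) x * (g \_ Omega) x).
Proof.
rewrite /dotL2 Rintegral_mkcond; congr (Rintegral _ _ _); apply/funext => x.
by rewrite !patchE; case: ifP; rewrite ?mulr0.
Qed.

Lemma dotL2C f g : dotL2 Omega f g = dotL2 Omega g f.
Proof. by rewrite /dotL2; under eq_Rintegral do rewrite mulrC. Qed.

Lemma dotL2_combl a f g h : L2 Omega f -> L2 Omega g -> L2 Omega h ->
  dotL2 Omega (a *: f + g) h = a * dotL2 Omega f h + dotL2 Omega g h.
Proof.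
move=> Lf Lg Lh; rewrite !dotL2E restrict_comb.
rewrite -RintegralZl //; last exact: L2_mul_integrable.
rewrite -RintegralD //.
- congr (Rintegral _ _ _); apply/funext => x.
  by rewrite -[(_ + _) x]/(a * (f \_ Omega) x + (g \_ Omega) x); ring.
- have := integrableZl measurableT a (L2_mul_integrable Lf Lh).
  by apply: eq_integrable => // x _; rewrite /= EFinM.
- exact: L2_mul_integrable.
Qed.

Lemma dotL2_ge0 f : 0 <= dotL2 Omega f f.
Proof. by apply: Rintegral_ge0 => x _; rewrite -expr2 sqr_ge0. Qed.

Lemma L2norm_ge0 f : 0 <= L2norm Omega f.
Proof. by rewrite fine_ge0 // Lnorm_ge0. Qed.

Lemma L2normE f : L2 Omega f -> L2norm Omega f ^+ 2 = dotL2 Omega f f.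
Proof.
rewrite /L2 /= inE => /andP[_ /[!inE]/= ffin].
rewrite dotL2E /L2norm /Rintegral.
have -> : (\int[mu]_x ((f \_ Omega) x * (f \_ Omega) x)%:E =
   'N[mu]_2%:E[EFin \o f \_ Omega] `^ 2)%E.
  rewrite powR_Lnorm ?pnatr_eq0 //; apply: eq_integral => x _.
  by rewrite /= powR_mulrn // real_normK // num_real.
have N0 := Lnorm_ge0 mu 2%:E (EFin \o f \_ Omega).
rewrite -[X in fine (X `^ 2)%E]fineK ?ge0_fin_numE // poweR_EFin /= powR_mulrn //.
by rewrite fine_ge0.
Qed.

Lemma dotL2_combr a f g h : L2 Omega f -> L2 Omega g -> L2 Omega h ->
  dotL2 Omega h (a *: f + g) = a * dotL2 Omega h f + dotL2 Omega h g.
Proof. by move=> Lf Lg Lh; rewrite dotL2C dotL2_combl // ![dotL2 _ h _]dotL2C. Qed.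

Lemma dotL2_sqr a f g : L2 Omega f -> L2 Omega g ->
  dotL2 Omega (a *: f + g) (a *: f + g) =
  a ^+ 2 * dotL2 Omega f f + 2 * a * dotL2 Omega f g + dotL2 Omega g g.
Proof.
move=> Lf Lg; rewrite dotL2_combl // ?dotL2_combr //; try exact: L2_comb.
by rewrite (dotL2C g f); ring.
Qed.

(** Cauchy-Schwarz in abstract form, for the L2 product and for the Dirichlet form alike. *)
Lemma discriminant_le0 (F X G : R) : (forall t, 0 <= t ^+ 2 * F + 2 * t * X + G) ->
  0 <= F -> X ^+ 2 <= F * G.
Proof.
move=> h F0; have [F00|Fn0] := eqVneq F 0.
  rewrite F00 mul0r; have [->|Xn0] := eqVneq X 0; first by rewrite expr0n.
  (* The polynomial is affine here and takes the value -1 at this point. *)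
  have := h (- (G + 1) / (2 * X)); rewrite F00 mulr0 add0r.
  have -> : 2 * (- (G + 1) / (2 * X)) * X + G = -1 by field.
  by rewrite oppr_ge0 ler10.
have Fp : 0 < F by rewrite lt_def Fn0.
have := h (- X / F).
have -> : (- X / F) ^+ 2 * F + 2 * (- X / F) * X + G = (F * G - X ^+ 2) / F by field.
by rewrite pmulr_lge0 ?invr_gt0 // subr_ge0.
Qed.

Lemma dotL2_cauchy_schwarz f g : L2 Omega f -> L2 Omega g ->
  `|dotL2 Omega f g| <= L2norm Omega f * L2norm Omega g.
Proof.
move=> Lf Lg; rewrite -ler_sqr ?nnegrE ?mulr_ge0 ?L2norm_ge0 //.
rewrite real_normK ?num_real // exprMn !L2normE //.
apply: discriminant_le0; last exact: dotL2_ge0.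
by move=> t; rewrite -dotL2_sqr //; exact: dotL2_ge0.
Qed.

Lemma L2norm_comb_le a f g : L2 Omega f -> L2 Omega g ->
  L2norm Omega (a *: f + g) <= `|a| * L2norm Omega f + L2norm Omega g.
Proof.
move=> Lf Lg; rewrite -ler_sqr ?nnegrE ?addr_ge0 ?mulr_ge0 ?L2norm_ge0 //.
rewrite L2normE; last exact: L2_comb.
rewrite dotL2_sqr // sqrrD exprMn !L2normE // real_normK ?num_real //.
have : a * dotL2 Omega f g <= `|a| * (L2norm Omega f * L2norm Omega g).
  apply: le_trans (ler_norm _) _; rewrite normrM ler_wpM2l //.
  exact: dotL2_cauchy_schwarz.
move: (dotL2 _ f g) (dotL2 _ f f) (dotL2 _ g g) (L2norm _ f) (L2norm _ g).
by move=> X F G p q h; rewrite lerD2r lerD2l mulr2n mulrDl !mul1r mulrDl -mulrA lerD.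
Qed.

(** Equality in L2 in the form that rewrites inside [dotL2]; weak derivatives are handled up to this
    relation. *)
Definition L2eq f g := forall z, L2 Omega z -> dotL2 Omega f z = dotL2 Omega g z.

Lemma L2eq_norm f g : L2 Omega f -> L2 Omega g -> L2eq f g ->
  L2norm Omega f = L2norm Omega g.
Proof.
move=> Lf Lg fg; apply/eqP; rewrite -(@eqrXn2 _ 2) ?L2norm_ge0 // !L2normE //.
by rewrite fg // dotL2C fg.
Qed.

Lemma dotL20l z : L2 Omega z -> dotL2 Omega 0 z = 0.
Proof.
by move=> Lz; have := dotL2_combl 1 L2_0 L2_0 Lz; rewrite scaler0 addr0 mul1r; lra.
Qed.

Lemma L2norm_eq0 f : L2 Omega f -> L2norm Omega f = 0 -> L2eq f 0.
Proof.
move=> Lf f0 z Lz; apply/eqP; rewrite dotL20l // -normr_le0.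
by apply: le_trans (dotL2_cauchy_schwarz Lf Lz) _; rewrite f0 mul0r.
Qed.

Lemma L2eq_ae f g : L2 Omega f -> L2 Omega g ->
  {ae mu, forall x, Omega x -> f x = g x} -> L2eq f g.
Proof.
move=> Lf Lg fg z Lz; rewrite !dotL2E /Rintegral; congr fine.
apply: ae_eq_integral => //.
- exact: measurable_int (L2_mul_integrable Lf Lz).
- exact: measurable_int (L2_mul_integrable Lg Lz).
move: fg; apply: filterS => x fg _ /=; rewrite !patchE; case: ifPn => // /set_mem xO.
by rewrite fg.
Qed.

End L2_space.

(** * Weak derivatives and density of test functions on a bounded open set *)

Section bounded_domain.
Context {R : realType} {n : nat}.
Local Notation mu := (lebesgueV R n).
Variables (Omega : set 'rV[R]_n) (B : R).
Hypotheses (oO : open Omega) (bO : Omega `<=` cbox B).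
Implicit Types f g h : 'rV[R]_n -> R.

Lemma domain_measurable : measurable Omega. Proof. exact: open_measurable_rV. Qed.

Lemma domain_finite : (mu Omega < +oo)%E.
Proof.
apply: le_lt_trans (cbox_finite n B); apply: le_measure; rewrite ?inE //.
  exact: domain_measurable.
exact: measurable_cbox.
Qed.

Lemma L2_bounded (M : R) f : measurable_fun setT f -> (forall x, Omega x -> `|f x| <= M) ->
  L2 Omega f.
Proof.
move=> mf fM; have mO := domain_measurable.
have mfO : measurable_fun setT (f \_ Omega).
  by apply/(measurable_restrictT _ mO); exact: measurable_funTS.
rewrite /L2 /= inE; apply/andP; split; rewrite inE //=.
rewrite /finite_norm; apply: (@lty_poweRy _ _ 2); first by rewrite pnatr_eq0.
rewrite powR_Lnorm ?pnatr_eq0 //.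
have -> : (\int[mu]_x (`|(f \_ Omega) x| `^ 2)%:E = \int[mu]_(x in Omega) (f x ^+ 2)%:E)%E.
  rewrite [RHS]integral_mkcond; apply: eq_integral => x _; rewrite !patchE.
  by case: ifP => _; rewrite /= powR_mulrn // real_normK ?num_real // expr0n.
apply: integrable_lty => //; apply: measurable_bounded_integrable => //.
- exact: domain_finite.
- by apply: measurable_funX; exact: measurable_funTS.
exists (M ^+ 2); split; first exact: num_real.
move=> y My x Ox; apply: le_trans (ltW My); rewrite normrX lerXn2r ?nnegrE ?fM //.
exact: le_trans (fM x Ox).
Qed.

Lemma L2_test s phi : test_function Omega phi -> L2 Omega (pD s phi).
Proof.
move=> /(test_function_pD s) tphi; have [C vC] := test_function_vanishes_off tphi.
have [sphi _ _] := tphi; have c := (sphi [::]).1.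
have [M _ hM] := vanishes_off_bounded c vC.
exact: (@L2_bounded M (pD s phi) (continuous_measurable_rV c) (fun x _ => hM x)).
Qed.

Lemma L2_cst c : L2 Omega (cst c).
Proof. by apply: (@L2_bounded `|c|). Qed.

Lemma L2_coord i : L2 Omega (fun x => x ord0 i).
Proof.
by apply: (@L2_bounded B) => [|x /bO]; [exact: measurable_coor|exact].
Qed.

Lemma L2_integrable f : L2 Omega f -> mu.-integrable Omega (EFin \o f).
Proof.
move=> Lf; apply/(integrable_mkcond _ domain_measurable).
have := L2_mul_integrable Lf (L2_cst 1); apply: eq_integrable => // x _.
by rewrite /= !patchE; case: ifP; rewrite /= ?mulr1 ?mulr0.
Qed.

Lemma dotL2_cst1 f : dotL2 Omega f (cst 1) = \int[mu]_(x in Omega) f x.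
Proof. by rewrite /dotL2; under eq_Rintegral do rewrite mulr1. Qed.

Lemma weak_derivative_comb s a f g f' g' : L2 Omega f -> L2 Omega g ->
  is_weak_derivative Omega s f f' -> is_weak_derivative Omega s g g' ->
  is_weak_derivative Omega s (a *: f + g) (a *: f' + g').
Proof.
move=> Lf Lg [Lf' df] [Lg' dg]; split=> [|phi tphi]; first exact: L2_comb.
have Lphi := L2_test [::] tphi; have Lsphi := L2_test s tphi.
by rewrite !dotL2_combl // df // dg //; ring.
Qed.

Lemma weak_derivative_eq s f g f' g' : L2eq Omega f g -> L2eq Omega f' g' -> L2 Omega g' ->
  is_weak_derivative Omega s f f' -> is_weak_derivative Omega s g g'.
Proof.
move=> fg fg' Lg' [Lf' df]; split=> // phi tphi.
by rewrite -fg ?df // ?fg' //; [exact: (L2_test [::])|exact: L2_test].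
Qed.

Lemma weak_derivative_unique s f g1 g2 : is_weak_derivative Omega s f g1 ->
  is_weak_derivative Omega s f g2 -> L2eq Omega g1 g2.
Proof.
move=> [L1 d1] [L2' d2]; apply: L2eq_ae => //.
have Ld : L2 Omega (- 1 *: g2 + g1) by exact: L2_comb.
have := @fundamental_lemma R n Omega (- 1 *: g2 + g1) oO (L2_integrable Ld) _.
have h phi : test_function Omega phi -> dotL2 Omega (- 1 *: g2 + g1) phi = 0.
  move=> tphi; rewrite dotL2_combl //; last exact: (L2_test [::]).
  have sgn0 : (-1) ^+ size s != 0 :> R by rewrite signr_eq0.
  have -> : dotL2 Omega g1 phi = dotL2 Omega g2 phi.
    by apply: (mulfI sgn0); rewrite -d1 // -d2.
  by rewrite mulN1r addNr.
move=> /(_ h); apply: filterS => x hx Ox; have := hx Ox.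
rewrite -[(_ + _) x]/(- 1 * g2 x + g1 x); lra.
Qed.

Lemma weak_derivative_nil f : L2 Omega f -> is_weak_derivative Omega [::] f f.
Proof. by move=> Lf; split=> // phi _; rewrite expr0 mul1r. Qed.

Lemma weak_derivative_wD s f : L2 Omega f -> (exists g, is_weak_derivative Omega s f g) ->
  is_weak_derivative Omega s f (wD Omega s f).
Proof.
case: s => [|i s] Lf [g fg]; first exact: weak_derivative_nil.
exact: (xgetPex _ (ex_intro _ g fg)).
Qed.

Lemma Hspace_wD k s f : Hspace Omega k f -> (size s <= k)%N ->
  is_weak_derivative Omega s f (wD Omega s f).
Proof. by move=> [Lf df] sk; apply: weak_derivative_wD => //; exact: df. Qed.

Lemma Hspace_L2_wD k s f : Hspace Omega k f -> (size s <= k)%N -> L2 Omega (wD Omega s f).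
Proof. by move=> Hf /(Hspace_wD Hf)[]. Qed.

Lemma Hspace_comb k a f g : Hspace Omega k f -> Hspace Omega k g -> Hspace Omega k (a *: f + g).
Proof.
move=> Hf Hg; split=> [|s sk]; first by apply: L2_comb; [exact: Hf.1|exact: Hg.1].
exists (a *: wD Omega s f + wD Omega s g).
apply: weak_derivative_comb; [exact: Hf.1|exact: Hg.1|exact: Hspace_wD Hf sk|].
exact: Hspace_wD Hg sk.
Qed.

Lemma wD_unique k s f g : Hspace Omega k f -> (size s <= k)%N ->
  is_weak_derivative Omega s f g -> L2eq Omega (wD Omega s f) g.
Proof. by move=> Hf sk; apply: weak_derivative_unique; exact: Hspace_wD Hf sk. Qed.

Lemma wD_comb k s a f g : Hspace Omega k f -> Hspace Omega k g -> (size s <= k)%N ->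
  L2eq Omega (wD Omega s (a *: f + g)) (a *: wD Omega s f + wD Omega s g).
Proof.
move=> Hf Hg sk; apply: (wD_unique (k := k)) => //; first exact: Hspace_comb.
apply: weak_derivative_comb; [exact: Hf.1|exact: Hg.1|exact: Hspace_wD Hf sk|].
exact: Hspace_wD Hg sk.
Qed.

(** Replaces the H^k distance by one bound on each derivative; [approx_H0space] is the way back. *)
Lemma H0space_approx k f : H0space Omega k f -> forall e : R, 0 < e ->
  exists2 phi, test_function Omega phi &
    forall s, (size s <= k)%N -> L2norm Omega (wD Omega s f \- pD s phi) < e.
Proof.
move=> [_ hf] e e0; have [phi tphi dphi] := hf e e0; exists phi => // s sk.
apply: le_lt_trans dphi; rewrite -[leLHS]ger0_norm ?L2norm_ge0 // -sqrtr_sqr ler_wsqrtr //.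
have sk' : (size s < k.+1)%N by [].
rewrite (bigD1 (Ordinal sk')) //= (bigD1 (in_tuple s)) //= -addrA lerDl addr_ge0 //.
  by apply: sumr_ge0 => t _; exact: sqr_ge0.
by apply: sumr_ge0 => j _; apply: sumr_ge0 => t _; exact: sqr_ge0.
Qed.

Lemma approx_H0space k f : Hspace Omega k f -> (forall e : R, 0 < e ->
  exists2 phi, test_function Omega phi &
    forall s, (size s <= k)%N -> L2norm Omega (wD Omega s f \- pD s phi) <= e) ->
  H0space Omega k f.
Proof.
move=> Hf hf; split=> // e e0.
(* [N] counts the derivatives of order at most [k], and N (e / (N + 1))^2 < e^2 turns the large
   inequalities into a strict one. *)
pose N : R := \sum_(j < k.+1) \sum_(s : j.-tuple 'I_n) 1.
have N0 : 0 <= N by apply: sumr_ge0 => j _; apply: sumr_ge0.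
have N1 : 0 < N + 1 by rewrite ltr_wpDl.
have eN : 0 < e / (N + 1) by rewrite divr_gt0.
have [phi tphi dphi] := hf _ eN; exists phi => //.
rewrite -[ltRHS]gtr0_norm // -sqrtr_sqr ltr_sqrt ?exprn_gt0 //.
apply: (@le_lt_trans _ _ (N * (e / (N + 1)) ^+ 2)).
  rewrite mulr_suml ler_sum // => j _; rewrite mulr_suml ler_sum // => s _.
  rewrite mul1r lerXn2r ?nnegrE ?L2norm_ge0 ?(ltW eN) // dphi // size_tuple.
  by rewrite -ltnS.
rewrite expr_div_n mulrA mulrAC -[ltRHS]mul1r ltr_pM2r ?exprn_gt0 //.
by rewrite ltr_pdivrMr ?exprn_gt0 // mul1r; nra.
Qed.

Lemma H0space_comb k a f g : H0space Omega k f -> H0space Omega k g ->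
  H0space Omega k (a *: f + g).
Proof.
move=> Hf Hg; apply: approx_H0space; first by apply: Hspace_comb; [exact: Hf.1|exact: Hg.1].
move=> e e0; have a1 : 0 < `|a| + 1 by rewrite ltr_wpDl.
have ea : 0 < e / (`|a| + 1) by rewrite divr_gt0.
have [phi tphi dphi] := H0space_approx Hf ea.
have [psi tpsi dpsi] := H0space_approx Hg ea.
exists (a *: phi + psi) => [|s sk]; first exact: test_function_comb.
have Lf := Hspace_L2_wD Hf.1 sk; have Lg := Hspace_L2_wD Hg.1 sk.
have Lc := Hspace_L2_wD (Hspace_comb a Hf.1 Hg.1) sk.
have Lphi := L2_test s tphi; have Lpsi := L2_test s tpsi.
have subE u v : u \- v = - 1 *: v + u :> ('rV[R]_n -> R).
  by apply/funext => x; rewrite -[RHS]/(- 1 * v x + u x) /=; ring.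
have -> : L2norm Omega (wD Omega s (a *: f + g) \- pD s (a *: phi + psi)) =
    L2norm Omega (a *: (wD Omega s f \- pD s phi) + (wD Omega s g \- pD s psi)).
  have [[sphi _ _] [spsi _ _]] := (tphi, tpsi).
  rewrite pD_comb // !subE; apply: L2eq_norm.
  - by apply: L2_comb => //; exact: L2_comb.
  - by apply: L2_comb; exact: L2_comb.
  move=> z Lz; rewrite !dotL2_combl //; try exact: L2_comb.
  rewrite (wD_comb a Hf.1 Hg.1 sk Lz) (dotL2_combl a Lf Lg Lz).
  move: (dotL2 _ (pD s phi) z) (dotL2 _ (pD s psi) z) => x y.
  by move: (dotL2 _ (wD Omega s f) z) (dotL2 _ (wD Omega s g) z) => u v; ring.
apply: le_trans (L2norm_comb_le _ _ _) _; try by rewrite subE; exact: L2_comb.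
have -> : e = `|a| * (e / (`|a| + 1)) + e / (`|a| + 1) by field; rewrite gt_eqF.
apply: lerD; last exact/ltW/dpsi.
by apply: ler_wpM2l; [exact: normr_ge0|exact/ltW/dphi].
Qed.

Lemma small_eq0 (X C : R) : 0 <= C -> (forall e, 0 < e -> `|X| <= C * e) -> X = 0.
Proof.
move=> C0 h; apply/eqP; rewrite -normr_le0; apply/ler_addgt0Pl => e e0; rewrite addr0.
have C1 : 0 < C + 1 by rewrite ltr_wpDl.
apply: le_trans (h (e / (C + 1)) _) _; first by rewrite divr_gt0.
by rewrite mulrCA ger_pMr // ler_pdivrMr // mul1r lerDl.
Qed.

Lemma dotL2_dist u v w : L2 Omega u -> L2 Omega v -> L2 Omega w ->
  `|dotL2 Omega u v - dotL2 Omega u w| <= L2norm Omega u * L2norm Omega (v \- w).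
Proof.
move=> Lu Lv Lw.
have E : v \- w = - 1 *: w + v :> ('rV[R]_n -> R).
  by apply/funext => x; rewrite -[RHS]/(- 1 * w x + v x) /=; ring.
have Ld : L2 Omega (v \- w) by rewrite E; exact: L2_comb.
have := dotL2_cauchy_schwarz Lu Ld.
by rewrite {1}E (dotL2_combr (-1) Lw Lv Lu) mulN1r addrC.
Qed.

Lemma weak_derivative1 i f g phi : is_weak_derivative Omega [:: i] f g ->
  test_function Omega phi -> dotL2 Omega f (pD [:: i] phi) = - dotL2 Omega g phi.
Proof. by move=> [_ h] /h ->; rewrite expr1 mulN1r. Qed.

Lemma dist_swap_le (X Y X' Y' p q u v e : R) : `|X - Y| <= p * u -> `|X' - Y'| <= q * v ->
  Y = Y' -> u <= e -> v <= e -> 0 <= p -> 0 <= q -> `|X - X'| <= (p + q) * e.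
Proof.
move=> h1 h2 E ue ve p0 q0; have pu := ler_wpM2l p0 ue; have qv := ler_wpM2l q0 ve.
move: h1 h2; rewrite E => {E}.
rewrite !ler_norml => /andP[? ?] /andP[? ?]; rewrite mulrDl.
by apply/andP; split; lra.
Qed.

Lemma dist_coord_le (X Y Z Z' p q u v e : R) (c : bool) :
  `|X - Y| <= p * u -> `|Z - Z'| <= q * v -> Y = - (c%:R * Z') ->
  u <= e -> v <= e -> 0 <= p -> 0 <= q -> `|X + c%:R * Z| <= (p + q) * e.
Proof.
move=> h1 h2 E ue ve p0 q0; have pu := ler_wpM2l p0 ue; have qv := ler_wpM2l q0 ve.
move: h1 h2; rewrite E => {E}.
rewrite mulrDl !ler_norml => /andP[+ +] /andP[].
by case: c => /=; rewrite ?mul1r ?mul0r => *; apply/andP; split; lra.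
Qed.

(** If [g] is a test function, both sides equal minus the pairing of [f] with its mixed second
    derivative; density gives the rest. The boundary condition is asked of one factor only. *)
Lemma dotL2_wD_swap f g i j : Hspace Omega 1 f -> H0space Omega 1 g ->
  dotL2 Omega (wD Omega [:: i] f) (wD Omega [:: j] g) =
  dotL2 Omega (wD Omega [:: j] f) (wD Omega [:: i] g).
Proof.
move=> Hf Hg; apply/eqP; rewrite -subr_eq0; apply/eqP.
have Lf k : L2 Omega (wD Omega [:: k] f) by exact: Hspace_L2_wD Hf _.
have Lg k : L2 Omega (wD Omega [:: k] g) by exact: Hspace_L2_wD Hg.1 _.
apply: (@small_eq0 _ (L2norm Omega (wD Omega [:: i] f) + L2norm Omega (wD Omega [:: j] f))).
  by rewrite addr_ge0 ?L2norm_ge0.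
move=> e e0; have [phi tphi dphi] := H0space_approx Hg e0.
have Lphi k : L2 Omega (pD [:: k] phi) by exact: L2_test.
have E : dotL2 Omega (wD Omega [:: i] f) (pD [:: j] phi) =
         dotL2 Omega (wD Omega [:: j] f) (pD [:: i] phi).
  have wf k : is_weak_derivative Omega [:: k] f (wD Omega [:: k] f) by exact: Hspace_wD Hf _.
  have [sphi _ _] := tphi; apply: oppr_inj.
  have Ei := weak_derivative1 (wf i) (test_function_pD [:: j] tphi).
  have Ej := weak_derivative1 (wf j) (test_function_pD [:: i] tphi).
  exact: etrans (esym Ei) (etrans (congr1 (dotL2 Omega f) (pD_commute i j sphi)) Ej).
exact: dist_swap_le (dotL2_dist (Lf i) (Lg j) (Lphi j)) (dotL2_dist (Lf j) (Lg i) (Lphi i))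
  E (ltW (dphi [:: j] isT)) (ltW (dphi [:: i] isT)) (L2norm_ge0 _ _) (L2norm_ge0 _ _).
Qed.

Lemma weak_derivative_commute i j f g : is_weak_derivative Omega [:: i; j] f g ->
  is_weak_derivative Omega [:: j; i] f g.
Proof.
move=> [Lg h]; split; first exact: Lg.
move=> phi tphi; have [sphi _ _] := tphi.
exact: etrans (congr1 (dotL2 Omega f) (pD_commute j i sphi)) (h phi tphi).
Qed.

Lemma wD2_commute f i j : Hspace Omega 2 f ->
  L2eq Omega (wD Omega [:: i; j] f) (wD Omega [:: j; i] f).
Proof.
move=> Hf; apply: (@wD_unique 2) => //.
exact/weak_derivative_commute/(Hspace_wD Hf).
Qed.

(** [pD [:: i; j]] differentiates along j first, so moving d_i off [f] in a pairing with d_j phi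
    produces exactly this list. *)
Lemma wD_weak_derivative f i j : Hspace Omega 2 f ->
  is_weak_derivative Omega [:: j] (wD Omega [:: i] f) (wD Omega [:: i; j] f).
Proof.
move=> Hf; split=> [|phi tphi]; first exact: Hspace_L2_wD Hf _.
have wi : is_weak_derivative Omega [:: i] f (wD Omega [:: i] f) by exact: Hspace_wD Hf _.
have [_ wij] : is_weak_derivative Omega [:: i; j] f (wD Omega [:: i; j] f).
  exact: Hspace_wD Hf _.
have := weak_derivative1 wi (test_function_pD [:: j] tphi).
rewrite -pD_cat /= -[X in dotL2 _ f X]/(pD [:: i; j] phi) (wij _ tphi) sqrrN expr1n mul1r => ->.
by rewrite expr1 mulN1r opprK.
Qed.

Lemma Hspace_wD1 f i : Hspace Omega 2 f -> Hspace Omega 1 (wD Omega [:: i] f).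
Proof.
move=> Hf; have Li : L2 Omega (wD Omega [:: i] f) by exact: Hspace_L2_wD Hf _.
split=> // -[|j [|//]] _; first by exists (wD Omega [:: i] f); exact: weak_derivative_nil.
by exists (wD Omega [:: i; j] f); exact: wD_weak_derivative.
Qed.

Lemma wD_wD f i j : Hspace Omega 2 f ->
  L2eq Omega (wD Omega [:: j] (wD Omega [:: i] f)) (wD Omega [:: i; j] f).
Proof.
move=> Hf; apply: (@wD_unique 1) => //; first exact: Hspace_wD1.
exact: wD_weak_derivative.
Qed.

Lemma H0space_wD1 f i : H0space Omega 2 f -> H0space Omega 1 (wD Omega [:: i] f).
Proof.
move=> Hf; apply: approx_H0space; first exact: Hspace_wD1 Hf.1.
move=> e e0; have [phi tphi dphi] := H0space_approx Hf e0.
exists (pD [:: i] phi); first exact: test_function_pD.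
move=> [|j [|//]] _; first exact: ltW (dphi [:: i] isT).
(* Differentiating the approximant gives the reverse order of indices. *)
rewrite -pD_cat -[_ ++ _]/[:: j; i] pD_commute; last by case: tphi.
apply: le_trans (ltW (dphi [:: i; j] isT)).
have subE u v : u \- v = - 1 *: v + u :> ('rV[R]_n -> R).
  by apply/funext => x; rewrite -[RHS]/(- 1 * v x + u x) /=; ring.
have L1 := Hspace_L2_wD (Hspace_wD1 i Hf.1) (isT : (size [:: j] <= 1)%N).
have L2' := Hspace_L2_wD Hf.1 (isT : (size [:: i; j] <= 2)%N).
have L3 := L2_test [:: i; j] tphi.
rewrite !subE le_eqVlt; apply/orP; left; apply/eqP; apply: L2eq_norm.
- exact: L2_comb.
- exact: L2_comb.
move=> z Lz; rewrite (dotL2_combl _ L3 L1 Lz) (dotL2_combl _ L3 L2' Lz).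
by rewrite (wD_wD i j Hf.1 Lz).
Qed.

Lemma wD_L2eq f g i : Hspace Omega 1 f -> Hspace Omega 1 g -> L2eq Omega f g ->
  L2eq Omega (wD Omega [:: i] f) (wD Omega [:: i] g).
Proof.
move=> Hf Hg fg z Lz; apply/esym; move: z Lz; apply: (wD_unique (k := 1)) => //.
apply: weak_derivative_eq fg _ _ (Hspace_wD Hf _) => //.
exact: Hspace_L2_wD Hf _.
Qed.

Lemma is_derive_coord (i j : 'I_n) (x : 'rV[R]_n) :
  is_derive x (delta_mx ord0 j) (fun y : 'rV[R]_n => y ord0 i) ((i == j)%:R : R).
Proof.
pose l (s : R) := (i == j)%:R * s + x ord0 i.
have [dl dlE] : is_derive 0 (1 : R) l (i == j)%:R.
  rewrite (_ : l = (i == j)%:R \*: id + cst (x ord0 i)); last exact/funext.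
  by apply: is_derive_eq; rewrite addr0 [_ *: 1]mulr1.
have E (h : R) : (h *: delta_mx ord0 j + x) ord0 i = l (h *: 1 + 0).
  by rewrite delta_mxDE /l addr0 [h *: 1]mulr1 mulrC.
apply: DeriveDef; first exact: (derivable_slice (g := fun y : 'rV[R]_n => y ord0 i) E dl).
by rewrite -dlE; exact: (derive_slice (g := fun y : 'rV[R]_n => y ord0 i) E).
Qed.

Lemma continuous_mulD (u v w : 'rV[R]_n -> R) c : continuous u -> continuous v ->
  continuous w -> continuous (fun x => u x * v x + c * w x).
Proof.
move=> cu cv cw x.
apply: (@continuousD _ _ _ (fun x => u x * v x) (fun x => c * w x) x).
  by apply: continuousM; [exact: cu|exact: cv].
by apply: continuousM; [exact: cst_continuous|exact: cw].
Qed.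

(** The integral of d_j (x_i phi) is zero, since x_i phi has compact support. *)
Lemma dotL2_coord_test (i j : 'I_n) phi : test_function Omega phi ->
  dotL2 Omega (fun x => x ord0 i) (pD [:: j] phi) = - ((i == j)%:R * dotL2 Omega (cst 1) phi).
Proof.
move=> tphi; have [sphi _ _] := tphi; have [C vC] := test_function_vanishes_off tphi.
pose xi : 'rV[R]_n -> R := fun x => x ord0 i.
have cxi : continuous xi by exact: coord_continuous.
pose psi := xi * phi.
have dpsi x : is_derive x (delta_mx ord0 j) psi (xi x *: pD [:: j] phi x + phi x *: (i == j)%:R).
  apply: is_deriveM; first exact: is_derive_coord.
  by apply: derivableP; exact: (sphi [::]).2.
have DE x : 'D_(delta_mx ord0 j) psi x = xi x * pD [:: j] phi x + (i == j)%:R * phi x.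
  by rewrite (@derive_val _ _ _ _ _ _ _ (dpsi x)) [phi x *: _]mulrC.
have cphi := (sphi [::]).1; have cdphi := (sphi [:: j]).1.
have cD : continuous (fun x => 'D_(delta_mx ord0 j) psi x).
  rewrite (_ : (fun _ => _) =
    fun x => xi x * pD [:: j] phi x + (i == j)%:R * phi x); last exact/funext.
  exact: continuous_mulD cxi cdphi cphi.
have vpsi : vanishes_off C psi by move=> x k h; rewrite -[LHS]/(xi x * phi x) (vC _ _ h) mulr0.
have := integral_derive_eq0 _ (fun x => @ex_derive _ _ _ _ _ _ _ (dpsi x)) cD vpsi.
have -> : (\int[mu]_x ('D_(delta_mx ord0 j) psi x)%:E =
  \int[mu]_(x in Omega) (xi x * pD [:: j] phi x + (i == j)%:R * phi x)%:E)%E.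
  rewrite [RHS]integral_mkcond; apply: eq_integral => x _; rewrite patchE DE.
  case: ifPn => // /negP xO; have nO : ~ Omega x by move=> h; apply: xO; rewrite inE.
  rewrite (test_function_out tphi nO).
  by rewrite (test_function_out (test_function_pD [:: j] tphi) nO) !mulr0 addr0.
move=> h; have {h} := congr1 fine (h (fun x => continuousM (cxi x) (cphi x))).
rewrite -[X in X = _ -> _]/(\int[mu]_(x in Omega)
  (xi x * pD [:: j] phi x + (i == j)%:R * phi x)) /=.
rewrite RintegralD.
- rewrite -[X in X + _]/(dotL2 Omega xi (pD [:: j] phi)) => /eqP; rewrite addr_eq0 => /eqP ->.
  rewrite RintegralZl //.
  + by congr (- (_ * _)); rewrite /dotL2; apply: eq_Rintegral => x _; rewrite mul1r.
  + exact: domain_measurable.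
  + exact/L2_integrable/(L2_test [::]).
- exact: domain_measurable.
- apply/(integrable_mkcond _ domain_measurable).
  have := L2_mul_integrable (L2_coord i) (L2_test [:: j] tphi); apply: eq_integrable => // x _.
  by rewrite /= !patchE; case: ifP; rewrite /= ?mulr0.
have := integrableZl domain_measurable (i == j)%:R (L2_integrable (L2_test [::] tphi)).
by apply: eq_integrable; first exact: domain_measurable.
Qed.

Lemma dotL2_coord_wD (i j : 'I_n) f : H0space Omega 1 f ->
  dotL2 Omega (fun x => x ord0 i) (wD Omega [:: j] f) =
  - ((i == j)%:R * dotL2 Omega (cst 1) f).
Proof.
move=> Hf; apply/eqP; rewrite -subr_eq0 opprK; apply/eqP.
have Lj : L2 Omega (wD Omega [:: j] f) by exact: Hspace_L2_wD Hf.1 _.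
have Lx := L2_coord i; have L1 := L2_cst 1.
set xi := (fun x : 'rV[R]_n => x ord0 i) in Lx *.
apply: (@small_eq0 _ (L2norm Omega xi + L2norm Omega (cst 1))).
  by rewrite addr_ge0 ?L2norm_ge0.
move=> e e0; have [phi tphi dphi] := H0space_approx Hf e0.
exact: dist_coord_le (dotL2_dist Lx Lj (L2_test [:: j] tphi))
  (dotL2_dist L1 Hf.1.1 (L2_test [::] tphi)) (dotL2_coord_test i j tphi)
  (ltW (dphi [:: j] isT)) (ltW (dphi [::] isT)) (L2norm_ge0 _ _) (L2norm_ge0 _ _).
Qed.

End bounded_domain.

(** * Hahn-Banach with finitely many constraints *)

Section finite_hahn_banach.
Context {R : realType} {V : lmodType R}.
Variables (W : V -> Prop) (p : V -> R).
Hypothesis W_comb : forall a x y, W x -> W y -> W (a *: x + y).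
Hypothesis p_add : forall x y, W x -> W y -> p (x + y) <= p x + p y.
Hypothesis p_scale : forall a x, W x -> 0 < a -> p (a *: x) <= a * p x.

Definition linear_on (U : V -> Prop) (f : V -> R) :=
  forall a x y, U x -> U y -> f (a *: x + y) = a * f x + f y.

(** A constant works as soon as it separates the values T x - p x at l x = 1 from the values p y - T
    y at l y = -1. These are ordered because l (x + y) = 0, where the bound is known. *)
Lemma hahn_banach_step (U : V -> Prop) (T l : V -> R) :
  (forall a x y, U x -> U y -> U (a *: x + y)) -> U 0 -> (forall x, U x -> W x) ->
  linear_on U T -> linear_on U l ->
  (forall x, U x -> l x = 0 -> T x <= p x) ->
  exists c, forall x, U x -> T x - c * l x <= p x.
Proof.
move=> Uc U0 UW lT ll Tp.
have f0 f : linear_on U f -> f 0 = 0.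
  by move=> lf; have := lf 1 0 0 U0 U0; rewrite scaler0 addr0 mul1r; lra.
have fZ f a x : linear_on U f -> U x -> f (a *: x) = a * f x.
  by move=> lf Ux; have := lf a x 0 Ux U0; rewrite addr0 f0 // addr0.
have UZ a x : U x -> U (a *: x) by move=> Ux; rewrite -[_ *: _]addr0; exact: Uc.
have key x y : U x -> U y -> l x = 1 -> l y = -1 -> T x - p x <= p y - T y.
  move=> Ux Uy lx ly.
  have Uxy : U (x + y) by rewrite -[x]scale1r; exact: Uc.
  have fD f : linear_on U f -> f (x + y) = f x + f y.
    by move=> lf; have := lf 1 x y Ux Uy; rewrite scale1r mul1r.
  have := Tp _ Uxy; rewrite (fD T lT) (fD l ll) lx ly subrr => /(_ erefl).
  by have := p_add (UW _ Ux) (UW _ Uy); lra.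
(* If [l] vanishes on [U] there is nothing to correct. *)
have [[e [Ue le]]|none] := pselect (exists e, U e /\ l e != 0); last first.
  exists 0 => x Ux; rewrite mul0r subr0; apply: Tp => //.
  by apply/eqP/negPn/negP => lx; apply: none; exists x.
pose e1 := (l e)^-1 *: e.
have Ue1 : U e1 by exact: UZ.
have le1 : l e1 = 1 by rewrite fZ // mulVf.
have Ume1 : U (- 1 *: e1) by exact: UZ.
have lme1 : l (- 1 *: e1) = -1 by rewrite fZ // le1 mulr1.
pose A := [set T x - p x | x in [set x | U x /\ l x = 1]].
have supA : has_sup A.
  split; first by exists (T e1 - p e1), e1.
  by exists (p (- 1 *: e1) - T (- 1 *: e1)) => _ [x [Ux lx] <-]; exact: key.
exists (sup A) => x Ux.
(* Division by the absolute value of [l x] brings [x] to the level -1 or 1. *)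
have [lx|lx|lx] := ltgtP (l x) 0; last by rewrite lx mulr0 subr0; exact: Tp.
- have t0 : 0 < - (l x)^-1 by rewrite oppr_gt0 invr_lt0.
  have Uy : U (- (l x)^-1 *: x) by exact: UZ.
  have ly : l (- (l x)^-1 *: x) = -1 by rewrite fZ // mulNr mulVf // lt_eqF.
  have : sup A <= p (- (l x)^-1 *: x) - T (- (l x)^-1 *: x).
    apply: ge_sup; first by case: supA.
    by move=> _ [z [Uz lz] <-]; exact: key.
  have := p_scale (UW _ Ux) t0; rewrite (fZ T) //.
  set s := sup A; set P := p (_ *: _) => h1 h2.
  have h3 : s <= - (l x)^-1 * (p x - T x) by lra.
  have := ler_wnM2l (ltW lx) h3; rewrite mulNr mulrN mulrA mulfV ?lt_eqF // mul1r.
  lra.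
have t0 : 0 < (l x)^-1 by rewrite invr_gt0.
have Uy : U ((l x)^-1 *: x) by exact: UZ.
have ly : l ((l x)^-1 *: x) = 1 by rewrite fZ // mulVf // gt_eqF.
have : T ((l x)^-1 *: x) - p ((l x)^-1 *: x) <= sup A.
  by apply: ub_le_sup; [case: supA|exists ((l x)^-1 *: x)].
have := p_scale (UW _ Ux) t0; rewrite (fZ T) //.
set s := sup A; set P := p (_ *: _) => h1 h2.
have h3 : (l x)^-1 * (T x - p x) <= s by lra.
have := ler_wpM2l (ltW lx) h3; rewrite mulrA mulfV ?gt_eqF // mul1r.
lra.
Qed.

(** One functional at a time: on the common kernel of [r] the step corrects [T] by a multiple of
    [l i], and the corrected [T] meets the hypothesis for [r]. Without repetitions the multipliers
    can be a function of the index. *)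
Lemma hahn_banach_fin (I : eqType) (r : seq I) (l : I -> V -> R) (T : V -> R) :
  uniq r -> W 0 -> linear_on W T -> (forall i, linear_on W (l i)) ->
  (forall x, W x -> (forall i, i \in r -> l i x = 0) -> T x <= p x) ->
  exists c : I -> R, forall x, W x -> T x - \sum_(i <- r) c i * l i x <= p x.
Proof.
move=> + W0; elim: r T => [|i r IH] T /=.
  move=> _ lT ll h; exists (fun=> 0) => x Wx; rewrite big_nil subr0.
  by apply: h => // i; rewrite in_nil.
move=> /andP[ir ur] lT ll h.
pose U x := W x /\ forall j, j \in r -> l j x = 0.
have [||||||c0 hc0] := @hahn_banach_step U T (l i).
- move=> a x y [Wx lx] [Wy ly]; split; first exact: W_comb.
  by move=> j jr; rewrite ll // lx // ly // mulr0 addr0.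
- split=> // j jr; have := ll j 1 0 0 W0 W0; rewrite scaler0 addr0 mul1r; lra.
- by move=> x [].
- by move=> a x y [Wx _] [Wy _]; exact: lT.
- by move=> a x y [Wx _] [Wy _]; exact: ll.
- move=> x [Wx lx] lix; apply: h => // j; rewrite inE => /orP[/eqP->//|]; exact: lx.
have [|||c hc] := IH (fun x => T x - c0 * l i x) ur.
- by move=> a x y Wx Wy; rewrite lT // ll //; ring.
- exact: ll.
- by move=> x Wx lx; apply: hc0.
exists (fun j => if j == i then c0 else c j) => x Wx.
rewrite big_cons eqxx.
have -> : \sum_(j <- r) (if j == i then c0 else c j) * l j x = \sum_(j <- r) c j * l j x.
  apply: eq_big_seq => j jr; case: eqP => // ji; by rewrite -ji jr in ir.
by have := hc x Wx; lra.
Qed.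

End finite_hahn_banach.

(** * Codifferential of skew potentials *)

Section rotation_gram.
Context {R : realType} {n : nat}.
Variable Omega : set 'rV[R]_n.
Local Notation dot := (dotL2 Omega).

Lemma dotL2_suml (I : Type) (r : seq I) (F : I -> 'rV[R]_n -> R) z :
  (forall i, L2 Omega (F i)) -> L2 Omega z ->
  dot (\sum_(i <- r) F i) z = \sum_(i <- r) dot (F i) z.
Proof.
move=> LF Lz; elim: r => [|i r IH]; first by rewrite !big_nil dotL20l.
rewrite !big_cons -[F i]scale1r (dotL2_combl 1 (LF i) (L2_sum r LF) Lz).
by rewrite mul1r scale1r IH.
Qed.

Lemma dotL2_sumr (I : Type) (r : seq I) (F : I -> 'rV[R]_n -> R) z :
  (forall i, L2 Omega (F i)) -> L2 Omega z ->
  dot z (\sum_(i <- r) F i) = \sum_(i <- r) dot z (F i).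
Proof.
move=> LF Lz; rewrite dotL2C dotL2_suml //.
by apply: eq_bigr => i _; exact: dotL2C.
Qed.

Lemma dotL2_sqr3 f g h : L2 Omega f -> L2 Omega g -> L2 Omega h ->
  dot (1 *: f + (1 *: g + h)) (1 *: f + (1 *: g + h)) =
  dot f f + dot g g + dot h h + 2 * (dot f g + dot g h + dot h f).
Proof.
move=> Lf Lg Lh; have Lgh := L2_comb 1 Lg Lh.
rewrite (dotL2_sqr 1 Lf Lgh) (dotL2_sqr 1 Lg Lh) (dotL2_combr 1 Lg Lh Lf).
by rewrite (dotL2C Omega h f); ring.
Qed.

Lemma sum3_cycle (F : 'I_n -> 'I_n -> 'I_n -> R) :
  \sum_a \sum_b \sum_c F b c a = \sum_a \sum_b \sum_c F a b c.
Proof.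
rewrite exchange_big; apply: eq_bigr => b _ /=.
by rewrite exchange_big.
Qed.

Lemma sum3_cycle2 (F : 'I_n -> 'I_n -> 'I_n -> R) :
  \sum_a \sum_b \sum_c F c a b = \sum_a \sum_b \sum_c F a b c.
Proof. exact: esym (sum3_cycle (fun a b c => F c a b)). Qed.

Lemma sum3_rev (F : 'I_n -> 'I_n -> 'I_n -> R) :
  \sum_a \sum_b \sum_c F c b a = \sum_a \sum_b \sum_c F a b c.
Proof.
rewrite exchange_big /=; under eq_bigr do rewrite exchange_big.
by rewrite exchange_big.
Qed.

(* For a matrix-valued potential [Y b a j = d_b w^{a j}], antisymmetric in [a]
   and [j], this is the inequality [|d* w|^2 <= |grad w|^2] for 2-forms: the
   difference of the two sides is [|d w|^2]. *)
Lemma codifferential_le (Y : 'I_n -> 'I_n -> 'I_n -> 'rV[R]_n -> R) :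
  (forall b a j, L2 Omega (Y b a j)) ->
  (forall b a j, forall z, L2 Omega z -> dot (Y b a j) z = - dot (Y b j a) z) ->
  (forall b c a j a' j', dot (Y b a j) (Y c a' j') = dot (Y c a j) (Y b a' j')) ->
  \sum_a dot (\sum_j Y j a j) (\sum_j Y j a j) <=
  2^-1 * \sum_a \sum_b \sum_j dot (Y a b j) (Y a b j).
Proof.
move=> LY asym swap.
(* The cyclic sums are the components of dw; each of their squares has three diagonal terms and
   three cross terms. *)
pose Z a b c := 1 *: Y a b c + (1 *: Y b c a + Y c a b).
have : 0 <= \sum_a \sum_b \sum_c dot (Z a b c) (Z a b c).
  by do 3! (apply: sumr_ge0 => ? _); exact: dotL2_ge0.
pose N a b c := dot (Y a b c) (Y a b c).
pose G a b c := dot (Y a b c) (Y b c a).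
have E : \sum_a \sum_b \sum_c dot (Z a b c) (Z a b c) =
    3 * (\sum_a \sum_b \sum_c N a b c) + 6 * (\sum_a \sum_b \sum_c G a b c).
  transitivity (\sum_a \sum_b \sum_c (N a b c + N b c a + N c a b +
      2 * (G a b c + G b c a + G c a b))).
    by do 3! (apply: eq_bigr => ? _); rewrite dotL2_sqr3.
  transitivity ((\sum_a \sum_b \sum_c N a b c) + (\sum_a \sum_b \sum_c N b c a) +
     (\sum_a \sum_b \sum_c N c a b) + 2 * ((\sum_a \sum_b \sum_c G a b c) +
     (\sum_a \sum_b \sum_c G b c a) + (\sum_a \sum_b \sum_c G c a b))).
    rewrite -!big_split mulr_sumr -big_split; apply: eq_bigr => a _ /=.
    rewrite -!big_split mulr_sumr -big_split; apply: eq_bigr => b _ /=.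
    by rewrite -!big_split mulr_sumr -big_split; apply: eq_bigr => c _ /=.
  rewrite (sum3_cycle N) (sum3_cycle G) (sum3_cycle2 N) (sum3_cycle2 G); ring.
(* Antisymmetry gives the sign, and exchanging the two derivatives turns the products of divergences
   into the cross terms [G]. *)
have -> : \sum_a dot (\sum_j Y j a j) (\sum_j Y j a j) = - (\sum_a \sum_b \sum_c G a b c).
  rewrite -(sum3_rev G) -sumrN; apply: eq_bigr => a _.
  rewrite dotL2_suml //; last exact: L2_sum.
  rewrite -sumrN; apply: eq_bigr => j _; rewrite dotL2_sumr // -sumrN.
  apply: eq_bigr => k _; have -> : G k j a = dot (Y j j a) (Y k a k) by exact: swap.
  rewrite (asym j j a); last exact: LY.
  by rewrite opprK.
rewrite E; lra.
Qed.

End rotation_gram.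

(** * Linear structure of H^k_0 and the Dirichlet form *)

Section sobolev_algebra.
Context {R : realType} {n : nat}.
Variables (Omega : set 'rV[R]_n) (B : R).
Hypotheses (oO : open Omega) (bO : Omega `<=` cbox B).
Local Notation fct := ('rV[R]_n -> R).
Local Notation dot := (dotL2 Omega).
Implicit Types f g z : fct.

Lemma Hseminorm_ge0 k f : 0 <= Hseminorm Omega k f. Proof. exact: sqrtr_ge0. Qed.

Lemma HseminormF_ge0 (I : finType) k (v : I -> fct) : 0 <= HseminormF Omega k v.
Proof. exact: sqrtr_ge0. Qed.

Lemma Hseminorm_sqr k f : Hseminorm Omega k f ^+ 2 =
  \sum_(s : k.-tuple 'I_n) L2norm Omega (wD Omega s f) ^+ 2.
Proof. by rewrite sqr_sqrtr //; apply: sumr_ge0 => s _; exact: sqr_ge0. Qed.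

Lemma HseminormF_sqr (I : finType) k (v : I -> fct) :
  HseminormF Omega k v ^+ 2 = \sum_i Hseminorm Omega k (v i) ^+ 2.
Proof. by rewrite sqr_sqrtr //; apply: sumr_ge0 => s _; exact: sqr_ge0. Qed.

Lemma pD0 (s : seq 'I_n) : pD s (0 : fct) = 0.
Proof. by elim: s => //= i s ->; apply/funext => x; rewrite derive_cst. Qed.

Lemma weak_derivative0 s : is_weak_derivative Omega s (0 : fct) 0.
Proof.
split; first exact: L2_0.
move=> phi tphi; rewrite (dotL20l (L2_test oO bO s tphi)).
by rewrite (dotL20l (L2_test oO bO [::] tphi)) mulr0.
Qed.

Lemma H0space_Hspace k f : H0space Omega k f -> Hspace Omega k f. Proof. by case. Qed.

Lemma Hspace_L2 k f : Hspace Omega k f -> L2 Omega f. Proof. by case. Qed.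

Lemma zero_Hspace k : Hspace Omega k (0 : fct).
Proof. by split=> [|s _]; [exact: L2_0|exists 0; exact: weak_derivative0]. Qed.

Local Opaque wD dotL2 L2norm pD L2 Hseminorm HseminormF H0space Hspace
  test_function is_weak_derivative.

Lemma L2_scale a f : L2 Omega f -> L2 Omega (a *: f).
Proof.
move=> Lf; have -> : a *: f = (a - 1) *: f + f by rewrite scalerBl scale1r subrK.
exact: L2_comb.
Qed.

Lemma H0space_scale k a f : H0space Omega k f -> H0space Omega k (a *: f).
Proof.
move=> Hf; have -> : a *: f = (a - 1) *: f + f by rewrite scalerBl scale1r subrK.
exact: (H0space_comb oO bO).
Qed.

Lemma dotL2Zl a f z : L2 Omega f -> L2 Omega z -> dot (a *: f) z = a * dot f z.
Proof.
move=> Lf Lz; have -> : a *: f = (a - 1) *: f + f by rewrite scalerBl scale1r subrK.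
by rewrite (dotL2_combl _ Lf Lf Lz) mulrBl mul1r subrK.
Qed.

Lemma H0space0 k : H0space Omega k (0 : fct).
Proof.
have H0 := zero_Hspace k; apply: approx_H0space => // e e0.
exists 0 => [|s sk]; first exact: test_function0.
have L0 := Hspace_L2_wD H0 sk.
have -> : wD Omega s 0 \- pD s (0 : fct) = wD Omega s 0.
  by rewrite pD0; apply/funext => x; exact: subr0.
rewrite (L2eq_norm L0 (L2_0 _) (wD_unique oO bO H0 sk (weak_derivative0 s))).
suff -> : L2norm Omega (0 : fct) = 0 by exact: ltW.
by apply/eqP; rewrite -sqrf_eq0 (L2normE (L2_0 _)) (dotL20l (L2_0 _)).
Qed.

Lemma H0space_sum k (I : Type) (r : seq I) (F : I -> fct) :
  (forall i, H0space Omega k (F i)) -> H0space Omega k (\sum_(i <- r) F i).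
Proof.
move=> HF; elim: r => [|i r IH]; first by rewrite big_nil; exact: H0space0.
by rewrite big_cons -[F i]scale1r; exact: (H0space_comb oO bO 1 (HF i) IH).
Qed.

Lemma dotL2_wD_comb k s a f g z : Hspace Omega k f -> Hspace Omega k g -> (size s <= k)%N ->
  L2 Omega z -> dot (wD Omega s (a *: f + g)) z =
  a * dot (wD Omega s f) z + dot (wD Omega s g) z.
Proof.
move=> Hf Hg sk Lz; rewrite (wD_comb oO bO a Hf Hg sk Lz).
exact: dotL2_combl (Hspace_L2_wD Hf sk) (Hspace_L2_wD Hg sk) Lz.
Qed.

Lemma dotL2_wD0 k s z : (size s <= k)%N -> L2 Omega z -> dot (wD Omega s (0 : fct)) z = 0.
Proof.
move=> sk Lz.
rewrite (wD_unique oO bO (zero_Hspace k) sk (weak_derivative0 s) Lz).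
exact: dotL20l.
Qed.

Lemma dotL2_wD_sum k s (I : Type) (r : seq I) (F : I -> fct) z :
  (forall i, H0space Omega k (F i)) -> (size s <= k)%N -> L2 Omega z ->
  dot (wD Omega s (\sum_(i <- r) F i)) z = \sum_(i <- r) dot (wD Omega s (F i)) z.
Proof.
move=> HF sk Lz; elim: r => [|i r IH]; first by rewrite !big_nil (dotL2_wD0 sk Lz).
rewrite !big_cons -{1}[F i]scale1r.
have HS := H0space_Hspace (H0space_sum r HF).
by rewrite (dotL2_wD_comb 1 (H0space_Hspace (HF i)) HS sk Lz) mul1r IH.
Qed.

(** Serves both for the skew part of a tensor and for making a family of potentials
    antisymmetric. *)
Definition half_diff f g : fct := 2^-1 *: f + (- 2^-1) *: g.

Lemma H0space_half_diff k f g : H0space Omega k f -> H0space Omega k g ->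
  H0space Omega k (half_diff f g).
Proof. by move=> Hf Hg; exact: (H0space_comb oO bO _ Hf (H0space_scale _ Hg)). Qed.

Lemma dotL2_half_diff f g z : L2 Omega f -> L2 Omega g -> L2 Omega z ->
  dot (half_diff f g) z = 2^-1 * (dot f z - dot g z).
Proof.
move=> Lf Lg Lz; by rewrite (dotL2_combl _ Lf (L2_scale _ Lg) Lz) (dotL2Zl _ Lg Lz) mulNr mulrBr.
Qed.

Lemma dotL2_wD_scale k s a f z : H0space Omega k f -> (size s <= k)%N -> L2 Omega z ->
  dot (wD Omega s (a *: f)) z = a * dot (wD Omega s f) z.
Proof.
move=> Hf sk Lz; have -> : a *: f = (a - 1) *: f + f by rewrite scalerBl scale1r subrK.
by rewrite (dotL2_wD_comb _ (H0space_Hspace Hf) (H0space_Hspace Hf) sk Lz) mulrBl mul1r subrK.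
Qed.

Lemma dotL2_wD_half_diff k s f g z : H0space Omega k f -> H0space Omega k g ->
  (size s <= k)%N -> L2 Omega z ->
  dot (wD Omega s (half_diff f g)) z = 2^-1 * (dot (wD Omega s f) z - dot (wD Omega s g) z).
Proof.
move=> Hf Hg sk Lz.
rewrite (dotL2_wD_comb _ (H0space_Hspace Hf) (H0space_Hspace (H0space_scale _ Hg)) sk Lz).
by rewrite (dotL2_wD_scale _ Hg sk Lz) mulNr mulrBr.
Qed.

(** The gap between the two sides is a quarter of |f + g|^2. [h] is given by its pairings because it
    will be a chosen weak derivative of a half difference. *)
Lemma sqr_half_diff_le f g h : L2 Omega f -> L2 Omega g -> L2 Omega h ->
  (forall z, L2 Omega z -> dot h z = 2^-1 * (dot f z - dot g z)) ->
  dot h h <= 2^-1 * (dot f f + dot g g).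
Proof.
move=> Lf Lg Lh hE.
have E : dot h h = 2^-1 * (2^-1 * (dot f f - dot g f) - 2^-1 * (dot f g - dot g g)).
  by rewrite hE // (dotL2C Omega f h) (dotL2C Omega g h) !hE.
have := dotL2_ge0 Omega (1 *: f + g); rewrite (dotL2_sqr 1 Lf Lg).
move: E; rewrite (dotL2C Omega g f); move: (dot h h) (dot f f) (dot f g) (dot g g).
by move=> a b c d ->; lra.
Qed.

Lemma size1 (l : 'I_n) : (size [:: l] <= 1)%N. Proof. by []. Qed.

Lemma Hseminorm1E f : Hspace Omega 1 f ->
  Hseminorm Omega 1 f ^+ 2 = \sum_l dot (wD Omega [:: l] f) (wD Omega [:: l] f).
Proof.
move=> Hf; rewrite Hseminorm_sqr.
rewrite (reindex (fun l : 'I_n => [tuple l])) /=.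
  by apply: eq_bigr => l _; rewrite (L2normE (Hspace_L2_wD Hf (size1 l))).
exists (fun t : 1.-tuple 'I_n => thead t) => [l _|t _]; first by rewrite theadE.
by case/tupleP: t => x t; rewrite theadE (tuple0 t).
Qed.

Lemma Hseminorm2E f : Hspace Omega 2 f ->
  Hseminorm Omega 2 f ^+ 2 =
  \sum_i \sum_j dot (wD Omega [:: i; j] f) (wD Omega [:: i; j] f).
Proof.
move=> Hf; rewrite Hseminorm_sqr.
rewrite pair_bigA (reindex (fun p : 'I_n * 'I_n => [tuple p.1; p.2])) /=.
  apply: eq_bigr => p _.
  by rewrite (L2normE (Hspace_L2_wD Hf (isT : (size [:: p.1; p.2] <= 2)%N))).
exists (fun t : 2.-tuple 'I_n => (thead t, thead [tuple of behead t])) => [[i j] _|t _].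
  by rewrite /= !theadE.
case/tupleP: t => x t; case/tupleP: t => y t; rewrite (tuple0 t).
by apply: val_inj.
Qed.

Lemma sum_pair (F : 'I_n * 'I_n -> R) : \sum_p F p = \sum_i \sum_j F (i, j).
Proof. by rewrite pair_bigA; apply: eq_bigr => -[]. Qed.

Section tensors.
Variable I : finType.
Implicit Types Phi Psi : I -> fct.

(** Polarisation of the squared H^1 seminorm; it yields the triangle inequality that Hahn-Banach
    requires. *)
Definition dirichlet Phi Psi : R :=
  \sum_p \sum_l dot (wD Omega [:: l] (Phi p)) (wD Omega [:: l] (Psi p)).

Definition H10 Phi := forall p, H0space Omega 1 (Phi p).

Lemma H10_comb a Phi Psi : H10 Phi -> H10 Psi -> H10 (a *: Phi + Psi).
Proof. by move=> HP HQ p; exact: (H0space_comb oO bO). Qed.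

Lemma HseminormF1E Phi : H10 Phi -> HseminormF Omega 1 Phi ^+ 2 = dirichlet Phi Phi.
Proof.
move=> HP; rewrite HseminormF_sqr.
by apply: eq_bigr => p _; rewrite (Hseminorm1E (H0space_Hspace (HP p))).
Qed.

Lemma dirichletC Phi Psi : dirichlet Phi Psi = dirichlet Psi Phi.
Proof. by apply: eq_bigr => p _; apply: eq_bigr => l _; exact: dotL2C. Qed.

Lemma dirichlet_combl a Phi Psi Xi : H10 Phi -> H10 Psi -> H10 Xi ->
  dirichlet (a *: Phi + Psi) Xi = a * dirichlet Phi Xi + dirichlet Psi Xi.
Proof.
move=> HP HQ HX; rewrite mulr_sumr -big_split; apply: eq_bigr => p _ /=.
rewrite mulr_sumr -big_split; apply: eq_bigr => l _ /=.
exact: (dotL2_wD_comb a (H0space_Hspace (HP p)) (H0space_Hspace (HQ p)) (size1 l)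
  (Hspace_L2_wD (H0space_Hspace (HX p)) (size1 l))).
Qed.

Lemma dirichlet_ge0 Phi : 0 <= dirichlet Phi Phi.
Proof. by do 2! (apply: sumr_ge0 => ? _); exact: dotL2_ge0. Qed.

Lemma dirichlet_sqr a Phi Psi : H10 Phi -> H10 Psi ->
  dirichlet (a *: Phi + Psi) (a *: Phi + Psi) =
  a ^+ 2 * dirichlet Phi Phi + 2 * a * dirichlet Phi Psi + dirichlet Psi Psi.
Proof.
move=> HP HQ; have HC := H10_comb a HP HQ.
rewrite (dirichlet_combl a HP HQ HC) (dirichletC Phi) (dirichletC Psi).
rewrite (dirichlet_combl a HP HQ HP) (dirichlet_combl a HP HQ HQ) (dirichletC Psi Phi).
by move: (dirichlet Phi Phi) (dirichlet Phi Psi) (dirichlet Psi Psi) => x y z; ring.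
Qed.

Local Opaque dirichlet.

Lemma quadratic_triangle (F X G S p q s : R) : p ^+ 2 = F -> q ^+ 2 = G -> s ^+ 2 = S ->
  0 <= p -> 0 <= q -> 0 <= s -> S = 1 ^+ 2 * F + 2 * 1 * X + G ->
  (forall t, 0 <= t ^+ 2 * F + 2 * t * X + G) -> s <= p + q.
Proof.
move=> EF EG ES p0 q0 s0 E h.
have F0 : 0 <= F by rewrite -EF sqr_ge0.
have X2 := discriminant_le0 h F0.
have Xpq : X <= p * q.
  apply: le_trans (ler_norm _) _.
  by rewrite -ler_sqr ?nnegrE ?mulr_ge0 // real_normK ?num_real // exprMn EF EG.
rewrite -ler_sqr ?nnegrE ?addr_ge0 // ES E -EF -EG sqrrD expr1n mul1r mulr1 lerD2r lerD2l.
by rewrite mulr2n mulrDl !mul1r lerD.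
Qed.

Lemma HseminormF_add Phi Psi : H10 Phi -> H10 Psi ->
  HseminormF Omega 1 (Phi + Psi) <= HseminormF Omega 1 Phi + HseminormF Omega 1 Psi.
Proof.
move=> HP HQ; have HPQ := H10_comb 1 HP HQ; rewrite -{1}[Phi]scale1r.
apply: (quadratic_triangle (HseminormF1E HP) (HseminormF1E HQ) (HseminormF1E HPQ)
  (HseminormF_ge0 _ _) (HseminormF_ge0 _ _) (HseminormF_ge0 _ _) (dirichlet_sqr 1 HP HQ)).
by move=> t; have := dirichlet_ge0 (t *: Phi + Psi); rewrite (dirichlet_sqr t HP HQ).
Qed.

Lemma H10_scale a Phi : H10 Phi -> H10 (a *: Phi).
Proof. by move=> HP p; exact: H0space_scale. Qed.

Lemma HseminormFZ a Phi : H10 Phi -> HseminormF Omega 1 (a *: Phi) = `|a| * HseminormF Omega 1 Phi.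
Proof.
move=> HP; have E : a *: Phi = (a - 1) *: Phi + Phi by rewrite scalerBl scale1r subrK.
have := HseminormF1E (H10_scale a HP); rewrite {2 3}E (dirichlet_sqr _ HP HP).
have := HseminormF1E HP; have := HseminormF_ge0 1 Phi; have := HseminormF_ge0 1 (a *: Phi).
move: (HseminormF Omega 1 (a *: Phi)) (HseminormF Omega 1 Phi) => s p s0 p0 <- E'.
apply/eqP; rewrite -(@eqrXn2 _ 2) ?mulr_ge0 //.
by rewrite E' exprMn real_normK ?num_real //; apply/eqP; ring.
Qed.

End tensors.

Lemma oppr_comb (a x y t : R) : t = a * x + y -> - t = a * - x - y.
Proof. by move=> ->; rewrite mulrN opprD. Qed.

Lemma dist_partial_comb j v a f g : L2 Omega v -> H0space Omega 1 f -> H0space Omega 1 g ->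
  dist_partial Omega j v (a *: f + g) = a * dist_partial Omega j v f + dist_partial Omega j v g.
Proof.
move=> Lv Hf Hg; rewrite /dist_partial !(dotL2C Omega v).
exact: oppr_comb (dotL2_wD_comb a (H0space_Hspace Hf) (H0space_Hspace Hg) (size1 j) Lv).
Qed.

Lemma dist_partial_combl j v w a f : L2 Omega v -> L2 Omega w -> H0space Omega 1 f ->
  dist_partial Omega j (a *: v + w) f = a * dist_partial Omega j v f + dist_partial Omega j w f.
Proof.
move=> Lv Lw Hf; rewrite /dist_partial.
exact: oppr_comb (dotL2_combl a Lv Lw (Hspace_L2_wD (H0space_Hspace Hf) (size1 j))).
Qed.

End sobolev_algebra.

(** * The gradient against the symmetric gradient *)

Section main_estimate.
Context {R : realType} {n : nat}.
Variables (Omega : set 'rV[R]_n) (B : R).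
Hypotheses (oO : open Omega) (bO : Omega `<=` cbox B).
Local Notation fct := ('rV[R]_n -> R).
Local Notation dot := (dotL2 Omega).

Local Opaque wD dotL2 L2norm pD L2 Hseminorm HseminormF H0space Hspace
  test_function is_weak_derivative dirichlet half_diff.

Lemma Hseminorm_half_diff k (f g : fct) : H0space Omega k f -> H0space Omega k g ->
  Hseminorm Omega k (half_diff f g) ^+ 2 <=
  2^-1 * (Hseminorm Omega k f ^+ 2 + Hseminorm Omega k g ^+ 2).
Proof.
move=> Hf Hg; have Hh := H0space_half_diff oO bO Hf Hg.
rewrite [X in X <= _]Hseminorm_sqr [X in _ <= _ * (X + _)]Hseminorm_sqr.
rewrite [X in _ <= _ * (_ + X)]Hseminorm_sqr.
rewrite -big_split mulr_sumr; apply: ler_sum => s _ /=.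
have sk : (size s <= k)%N by rewrite size_tuple.
have Lf := Hspace_L2_wD (H0space_Hspace Hf) sk.
have Lg := Hspace_L2_wD (H0space_Hspace Hg) sk.
have Lh := Hspace_L2_wD (H0space_Hspace Hh) sk.
have := sqr_half_diff_le Lf Lg Lh (fun z Lz => dotL2_wD_half_diff oO bO Hf Hg sk Lz).
by rewrite -(L2normE Lf) -(L2normE Lg) -(L2normE Lh).
Qed.

Lemma sum4_shuffle (F : 'I_n -> 'I_n -> 'I_n -> 'I_n -> R) :
  \sum_b \sum_j \sum_l \sum_a F l a b j = \sum_l \sum_a \sum_b \sum_j F l a b j.
Proof.
under eq_bigr do rewrite exchange_big; rewrite exchange_big /=; apply: eq_bigr => l _.
under eq_bigr => b _ do rewrite exchange_big.
by rewrite exchange_big.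
Qed.

Lemma sum_symmetrize (q : 'I_n -> 'I_n -> R) :
  \sum_i \sum_j q i j = \sum_i \sum_j 2^-1 * (q i j + q j i).
Proof.
have -> : \sum_i \sum_j 2^-1 * (q i j + q j i) =
    \sum_i \sum_j 2^-1 * q i j + \sum_i \sum_j 2^-1 * q i j.
  rewrite [X in _ = _ + X]exchange_big -big_split; apply: eq_bigr => i _ /=.
  by rewrite -big_split; apply: eq_bigr => j _ /=; rewrite mulrDr.
rewrite -big_split; apply: eq_bigr => i _ /=.
by rewrite -big_split; apply: eq_bigr => j _ /=; move: (q i j) => x; field.
Qed.

(** Here p, q are the seminorms of Phi, Psi; q <= K p / sqrt 2 gives 2 q <= sqrt 2 K p. *)
Lemma grad_bound (T E E' p q m K : R) : T = E + 2 * E' -> E <= m * p -> E' <= m * q ->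
  q ^+ 2 <= 2^-1 * (K * p) ^+ 2 -> 0 <= p -> 0 <= q -> 0 <= m -> 0 <= K ->
  T <= m * (1 + Num.sqrt 2 * K) * p.
Proof.
move=> -> h1 h2 pq p0 q0 m0 K0.
have s2 : (Num.sqrt 2 : R) ^+ 2 = 2 by rewrite sqr_sqrtr.
have s0 : 0 <= (Num.sqrt 2 : R) by exact: sqrtr_ge0.
have q2 : 2 * q <= Num.sqrt 2 * K * p.
  rewrite -ler_sqr ?nnegrE ?mulr_ge0 // !exprMn s2.
  by move: pq; rewrite exprMn; lra.
have := ler_wpM2l m0 q2; move: (Num.sqrt 2) => s h3; lra.
Qed.

Lemma sum3_swap (F : 'I_n -> 'I_n -> 'I_n -> R) :
  \sum_i \sum_j \sum_k F i j k = \sum_i \sum_k \sum_j F i j k.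
Proof. by apply: eq_bigr => i _; rewrite exchange_big. Qed.

Section codifferential.
Variable w : 'I_n -> 'I_n -> 'I_n -> fct.
Hypothesis Hw : forall i j k, H0space Omega 2 (w i j k).
Hypothesis w_anti : forall i j k s z, (size s <= 2)%N -> L2 Omega z ->
  dot (wD Omega s (w i j k)) z = - dot (wD Omega s (w j i k)) z.

(** For each fixed last index, [w] is a 2-form in its first two indices; the divergence is taken in
    the second of these. *)
Definition codifferential (p : 'I_n * 'I_n) : fct :=
  \sum_j wD Omega [:: j] (w p.1 j p.2).

Let S b l i j k := wD Omega [:: b; l] (w i j k).

Let LS b l i j k : L2 Omega (S b l i j k).
Proof. exact: Hspace_L2_wD (H0space_Hspace (Hw i j k)) _. Qed.

Let S_anti b l i j k z : L2 Omega z -> dot (S b l i j k) z = - dot (S b l j i k) z.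
Proof. exact: w_anti. Qed.

Let S_sym b l i j k z : L2 Omega z -> dot (S b l i j k) z = dot (S l b i j k) z.
Proof. exact: (wD2_commute oO bO b l (H0space_Hspace (Hw i j k))). Qed.

Let DS b l i j k z : L2 Omega z ->
  dot (wD Omega [:: l] (wD Omega [:: b] (w i j k))) z = dot (S b l i j k) z.
Proof. exact: (wD_wD oO bO b l (H0space_Hspace (Hw i j k))). Qed.

Let HD b i j k : H0space Omega 1 (wD Omega [:: b] (w i j k)).
Proof. exact: (H0space_wD1 oO bO). Qed.

Lemma codifferential_H10 : H10 Omega codifferential.
Proof. by move=> p; apply: (H0space_sum oO bO) => j; exact: HD. Qed.

Lemma dotL2_wD_codifferential a k l z : L2 Omega z ->
  dot (wD Omega [:: l] (codifferential (a, k))) z = \sum_j dot (S j l a j k) z.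
Proof.
move=> Lz; rewrite (dotL2_wD_sum oO bO (index_enum _) (fun j => HD j a j k) (size1 l) Lz).
by apply: eq_bigr => j _; exact: DS.
Qed.

Lemma codifferential_dirichlet : dirichlet Omega codifferential codifferential =
  \sum_k \sum_l \sum_a dot (\sum_j S l j a j k) (\sum_j S l j a j k).
Proof.
rewrite [LHS]sum_pair exchange_big; apply: eq_bigr => k _ /=.
rewrite exchange_big; apply: eq_bigr => l _ /=; apply: eq_bigr => a _.
have LP : L2 Omega (wD Omega [:: l] (codifferential (a, k))).
  exact: Hspace_L2_wD (H0space_Hspace (codifferential_H10 _)) (size1 l).
have LSs : L2 Omega (\sum_j S l j a j k) by apply: L2_sum => j; exact: LS.
have E z : L2 Omega z -> dot (wD Omega [:: l] (codifferential (a, k))) z =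
    dot (\sum_j S l j a j k) z.
  move=> Lz; rewrite (dotL2_wD_codifferential a k l Lz).
  rewrite (dotL2_suml (index_enum _) (fun j => LS l j a j k) Lz).
  by apply: eq_bigr => j _; exact: S_sym.
exact: etrans (E _ LP) (etrans (dotL2C _ _ _) (E _ LSs)).
Qed.

(** For each k and l, [codifferential_le] is applied to the gradient of the 2-form d_l w_ajk; since
    this form lies in H^1_0, [dotL2_wD_swap] provides the exchange of derivatives. *)
Lemma codifferential_norm : HseminormF Omega 1 codifferential ^+ 2 <=
  2^-1 * \sum_a \sum_j \sum_k Hseminorm Omega 2 (w a j k) ^+ 2.
Proof.
rewrite (HseminormF1E codifferential_H10) codifferential_dirichlet.
have -> : \sum_a \sum_j \sum_k Hseminorm Omega 2 (w a j k) ^+ 2 =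
    \sum_k \sum_l \sum_a \sum_b \sum_j dot (S l a b j k) (S l a b j k).
  transitivity (\sum_k \sum_a \sum_j Hseminorm Omega 2 (w a j k) ^+ 2).
    exact: esym (sum3_cycle (fun a j k => Hseminorm Omega 2 (w a j k) ^+ 2)).
  apply: eq_bigr => k _.
  transitivity (\sum_b \sum_j \sum_l \sum_a dot (S l a b j k) (S l a b j k)).
    apply: eq_bigr => b _; apply: eq_bigr => j _.
    exact: Hseminorm2E (H0space_Hspace (Hw b j k)).
  exact: (sum4_shuffle (fun l a b j => dot (S l a b j k) (S l a b j k))).
rewrite mulr_sumr; apply: ler_sum => k _; rewrite mulr_sumr; apply: ler_sum => l _.
apply: (@codifferential_le R n Omega (fun b a j => S l b a j k)).
- by move=> b a j; exact: LS.
- by move=> b a j z Lz; exact: S_anti.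
move=> b c a j a' j'.
have E b' a1 j1 z : L2 Omega z ->
    dot (S l b' a1 j1 k) z = dot (wD Omega [:: b'] (wD Omega [:: l] (w a1 j1 k))) z.
  by move=> Lz; exact: esym (DS _ _ _ _ _ Lz).
have LD b' a1 j1 : L2 Omega (wD Omega [:: b'] (wD Omega [:: l] (w a1 j1 k))).
  exact: Hspace_L2_wD (H0space_Hspace (HD _ _ _ _)) (size1 b').
have E2 b' c' a1 j1 a2 j2 : dot (S l b' a1 j1 k) (S l c' a2 j2 k) =
    dot (wD Omega [:: b'] (wD Omega [:: l] (w a1 j1 k)))
        (wD Omega [:: c'] (wD Omega [:: l] (w a2 j2 k))).
  apply: etrans (E _ _ _ _ (LS _ _ _ _ _)) _; apply: etrans (dotL2C _ _ _) _.
  by apply: etrans (E _ _ _ _ (LD _ _ _)) _; exact: dotL2C.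
apply: etrans (E2 b c a j a' j') _; apply: etrans _ (esym (E2 c b a j a' j')).
exact: (dotL2_wD_swap oO bO b c (H0space_Hspace (HD l a j k)) (HD l a' j' k)).
Qed.

Variable v : 'I_n -> fct.
Hypothesis Lv : forall i, L2 Omega (v i).

(** One half of the symmetrised pairing vanishes: d_a d_j is symmetric and w_ajk antisymmetric in a,
    j, so each column of the codifferential is divergence free. *)
Lemma codifferential_pairing :
  2 * \sum_p dist_sym_grad Omega v p (codifferential p) =
  - \sum_i \sum_j \sum_k dot (S k j i j k) (v i).
Proof.
pose C a k j := dot (S j a a j k) (v k).
have C0 : \sum_a \sum_k \sum_j C a k j = 0.
  have E : \sum_a \sum_k \sum_j C a k j = - \sum_a \sum_k \sum_j C a k j.
    rewrite -[in RHS](sum3_rev C) -sumrN; apply: eq_bigr => a _.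
    rewrite -sumrN; apply: eq_bigr => k _; rewrite -sumrN; apply: eq_bigr => j _.
    exact: etrans (S_anti _ _ _ _ _ (Lv k)) (congr1 -%R (S_sym _ _ _ _ _ (Lv k))).
  by move: E; move: (\sum_a _) => x; lra.
pose A a k j := dot (S j k a j k) (v a).
have -> : \sum_i \sum_j \sum_k dot (S k j i j k) (v i) = \sum_a \sum_k \sum_j A a k j.
  apply: etrans (sum3_swap (fun i j k => dot (S k j i j k) (v i))) _.
  by do 3! (apply: eq_bigr => ? _); apply: S_sym; exact: Lv.
have -> : \sum_p dist_sym_grad Omega v p (codifferential p) =
    \sum_a \sum_k 2^-1 * (- (\sum_j A a k j) - \sum_j C a k j).
  rewrite sum_pair; apply: eq_bigr => a _; apply: eq_bigr => k _.
  rewrite /dist_sym_grad /dist_partial /=; congr (_ * (- _ - _)).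
    exact: etrans (dotL2C _ _ _) (dotL2_wD_codifferential a k k (Lv a)).
  exact: etrans (dotL2C _ _ _) (dotL2_wD_codifferential a k a (Lv k)).
rewrite -[RHS]subr0 -[X in - _ - X]C0 -!sumrN -big_split mulr_sumr; apply: eq_bigr => a _ /=.
rewrite -!sumrN -big_split mulr_sumr; apply: eq_bigr => k _ /=.
by move: (\sum_j A a k j) (\sum_j C a k j) => x y; by field.
Qed.

End codifferential.

Variable v : 'I_n -> fct.
Hypothesis Lv : forall i, L2 Omega (v i).
Variables (m K : R).
Hypotheses (m0 : 0 <= m) (K0 : 0 <= K).
Hypothesis sym_grad_le : forall Psi : 'I_n * 'I_n -> fct, H10 Omega Psi ->
  \sum_p dist_sym_grad Omega v p (Psi p) <= m * HseminormF Omega 1 Psi.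
Hypothesis div_inverse : forall f, H0space Omega 1 f -> dot f (cst 1) = 0 ->
  exists u : 'I_n -> fct, [/\ forall i, H0space Omega 2 (u i),
    forall z, L2 Omega z -> dot (\sum_i wD Omega [:: i] (u i)) z = dot f z
    & HseminormF Omega 2 u <= K * Hseminorm Omega 1 f].

(** [P] and [Q] stand for the pairings of [v] with Phi and with its transpose; the two terms are the
    symmetric and the skew contributions. *)
Lemma skew_pairing (P Q : 'I_n -> 'I_n -> R) : \sum_i \sum_j - P i j =
  \sum_i \sum_j 2^-1 * (- P i j - Q j i) - \sum_i \sum_j 2^-1 * (P i j - Q i j).
Proof.
have -> : \sum_i \sum_j 2^-1 * (- P i j - Q j i) =
    \sum_i \sum_j 2^-1 * (- P i j) + \sum_i \sum_j 2^-1 * (- Q i j).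
  rewrite [X in _ = _ + X]exchange_big -big_split; apply: eq_bigr => i _ /=.
  by rewrite -big_split; apply: eq_bigr => j _ /=; rewrite -mulrDr.
rewrite -sumrN -!big_split; apply: eq_bigr => i _ /=.
rewrite -sumrN -!big_split; apply: eq_bigr => j _ /=.
by move: (P i j) (Q i j) => x y; field.
Qed.

Lemma sum_dist_sym_grad (Phi : 'I_n * 'I_n -> fct) :
  \sum_p dist_sym_grad Omega v p (Phi p) =
  \sum_i \sum_j 2^-1 * (- dot (v i) (wD Omega [:: j] (Phi (i, j))) -
                        dot (v j) (wD Omega [:: i] (Phi (i, j)))).
Proof. by rewrite sum_pair. Qed.

(* The antisymmetric part of [Phi] is the divergence of some antisymmetric [w],
   and its pairing with [grad v] is that of [2 codifferential w] with [grad_S v]. *)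
Lemma grad_le (Phi : 'I_n * 'I_n -> fct) : H10 Omega Phi ->
  (forall i j, dot (Phi (i, j)) (cst 1) = dot (Phi (j, i)) (cst 1)) ->
  \sum_p dist_partial Omega p.2 (v p.1) (Phi p) <=
  m * (1 + Num.sqrt 2 * K) * HseminormF Omega 1 Phi.
Proof.
move=> HP sP.
pose f (p : 'I_n * 'I_n) : fct := half_diff (Phi (p.1, p.2)) (Phi (p.2, p.1)).
have LP p : L2 Omega (Phi p) by exact: Hspace_L2 (H0space_Hspace (HP p)).
have L1 := L2_cst oO bO 1.
have Hf p : H0space Omega 1 (f p) by exact: (H0space_half_diff oO bO).
have f0 p : dot (f p) (cst 1) = 0.
  apply: etrans (dotL2_half_diff (LP _) (LP _) L1) _.
  by rewrite sP subrr mulr0.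
have /choice[U HU] := fun p => div_inverse (Hf p) (f0 p).
have HU2 p k : H0space Omega 2 (U p k) by case: (HU p).
(* The solutions for (i, j) and (j, i) are chosen independently, so they need not be opposite. Their
   half difference is antisymmetric and keeps the divergence, [f] being skew. *)
pose w i j k : fct := half_diff (U (i, j) k) (U (j, i) k).
have Hw i j k : H0space Omega 2 (w i j k) by exact: (H0space_half_diff oO bO).
have wE i j k s z : (size s <= 2)%N -> L2 Omega z -> dot (wD Omega s (w i j k)) z =
    2^-1 * (dot (wD Omega s (U (i, j) k)) z - dot (wD Omega s (U (j, i) k)) z).
  by move=> sk Lz; exact: (dotL2_wD_half_diff oO bO).
have w_anti i j k s z : (size s <= 2)%N -> L2 Omega z ->
    dot (wD Omega s (w i j k)) z = - dot (wD Omega s (w j i k)) z.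
  move=> sk Lz; apply: etrans (wE _ _ _ _ _ sk Lz) _.
  apply: etrans _ (congr1 -%R (esym (wE _ _ _ _ _ sk Lz))).
  by rewrite -mulrN opprB.
pose Psi := codifferential w.
have HPsi : H10 Omega Psi by exact: codifferential_H10 Hw.
have LD i (u : fct) : H0space Omega 2 u -> L2 Omega (wD Omega [:: i] u).
  by move=> Hu; exact: Hspace_L2_wD (H0space_Hspace Hu) _.
have fw i j z : L2 Omega z -> dot (f (i, j)) z = dot (\sum_k wD Omega [:: k] (w i j k)) z.
  move=> Lz; apply: etrans _ (esym (dotL2_suml (index_enum _) (fun k => LD k _ (Hw i j k)) Lz)).
  have divE p : \sum_k dot (wD Omega [:: k] (U p k)) z = dot (f p) z.
    have [_ dU _] := HU p.
    exact: etrans (esym (dotL2_suml (index_enum _) (fun k => LD k _ (HU2 p k)) Lz)) (dU z Lz).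
  have fE p : dot (f p) z = 2^-1 * (dot (Phi (p.1, p.2)) z - dot (Phi (p.2, p.1)) z).
    exact: dotL2_half_diff.
  have -> : \sum_k dot (wD Omega [:: k] (w i j k)) z =
      2^-1 * (dot (f (i, j)) z - dot (f (j, i)) z).
    rewrite -(divE (i, j)) -(divE (j, i)) -sumrB mulr_sumr; apply: eq_bigr => k _.
    exact: wE.
  rewrite !fE /=; move: (dot (Phi (i, j)) z) (dot (Phi (j, i)) z) => x y; by field.
have Dfw i j z : L2 Omega z ->
    dot (wD Omega [:: j] (f (i, j))) z = \sum_k dot (wD Omega [:: k; j] (w i j k)) z.
  move=> Lz; have HDw k : H0space Omega 1 (wD Omega [:: k] (w i j k)) by exact: (H0space_wD1 oO bO).
  have Hs := H0space_sum oO bO (index_enum _) HDw.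
  apply: etrans (wD_L2eq oO bO j (H0space_Hspace (Hf (i, j))) (H0space_Hspace Hs) (fw i j) Lz) _.
  apply: etrans (dotL2_wD_sum oO bO (index_enum _) HDw (size1 j) Lz) _.
  by apply: eq_bigr => k _; exact: (wD_wD oO bO k j (H0space_Hspace (Hw i j k)) Lz).
have Epair : \sum_p dist_partial Omega p.2 (v p.1) (Phi p) =
    \sum_p dist_sym_grad Omega v p (Phi p) + 2 * \sum_p dist_sym_grad Omega v p (Psi p).
  apply: etrans (sum_pair _) _.
  apply: etrans (skew_pairing (fun i j => dot (v i) (wD Omega [:: j] (Phi (i, j))))
    (fun i j => dot (v i) (wD Omega [:: j] (Phi (j, i))))) _.
  apply: esym; apply: congr2; first exact: sum_dist_sym_grad.
  apply: etrans (codifferential_pairing Hw w_anti Lv) _; congr (- _).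
  apply: eq_bigr => i _; apply: eq_bigr => j _; apply: etrans (esym (Dfw i j _ (Lv i))) _.
  apply: etrans (dotL2_wD_half_diff oO bO (HP (i, j)) (HP (j, i)) (size1 j) (Lv i)) _.
  by congr (_ * (_ - _)); exact: dotL2C.
(* Chain of sums of squares: |Psi|_1^2 <= 1/2 |w|_2^2 <= 1/2 |U|_2^2 <= 1/2 K^2 |f|_1^2 <= 1/2 K^2
   |Phi|_1^2. *)
have normPsi : HseminormF Omega 1 Psi ^+ 2 <= 2^-1 * (K * HseminormF Omega 1 Phi) ^+ 2.
  apply: le_trans (codifferential_norm Hw w_anti) _.
  rewrite ler_pM2l ?invr_gt0 //.
  pose q i j := \sum_k Hseminorm Omega 2 (U (i, j) k) ^+ 2.
  apply: (@le_trans _ _ (\sum_i \sum_j q i j)).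
    rewrite [leRHS](sum_symmetrize q).
    apply: ler_sum => i _; apply: ler_sum => j _; rewrite /q -big_split mulr_sumr.
    by apply: ler_sum => k _; exact: Hseminorm_half_diff (HU2 _ _) (HU2 _ _).
  have qE i j : q i j = HseminormF Omega 2 (U (i, j)) ^+ 2 by rewrite HseminormF_sqr.
  pose g i j := Hseminorm Omega 1 (Phi (i, j)) ^+ 2.
  have -> : (K * HseminormF Omega 1 Phi) ^+ 2 = \sum_i \sum_j K ^+ 2 * (2^-1 * (g i j + g j i)).
    rewrite exprMn HseminormF_sqr sum_pair; apply: etrans (congr1 _ (sum_symmetrize g)) _.
    by rewrite mulr_sumr; apply: eq_bigr => i _; rewrite mulr_sumr.
  apply: ler_sum => i _; apply: ler_sum => j _; rewrite qE.
  have [_ _ hU] := HU (i, j).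
  apply: (@le_trans _ _ ((K * Hseminorm Omega 1 (f (i, j))) ^+ 2)).
    by rewrite lerXn2r ?nnegrE ?mulr_ge0 ?HseminormF_ge0 ?Hseminorm_ge0.
  rewrite exprMn ler_wpM2l ?sqr_ge0 //; exact: Hseminorm_half_diff (HP _) (HP _).
exact: (grad_bound Epair (sym_grad_le HP) (sym_grad_le HPsi) normPsi
  (HseminormF_ge0 _ _ _) (HseminormF_ge0 _ _ _) m0 K0).
Qed.

End main_estimate.

(** * Skew linear fields and the correction by an infinitesimal rotation *)

Section rotation.
Context {R : realType} {n : nat}.
Variables (Omega : set 'rV[R]_n) (B : R).
Hypotheses (oO : open Omega) (bO : Omega `<=` cbox B).
Local Notation fct := ('rV[R]_n -> R).
Local Notation dot := (dotL2 Omega).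

Local Opaque wD dotL2 L2norm pD L2 Hseminorm HseminormF H0space Hspace
  test_function is_weak_derivative dirichlet half_diff.

Definition coord (i : 'I_n) : fct := fun x => x ord0 i.

Definition linear_field (k : 'I_n -> 'I_n -> R) (i : 'I_n) : fct := \sum_j k i j *: coord j.

Lemma L2_linear_field k i : L2 Omega (linear_field k i).
Proof. by apply: L2_sum => j; apply: L2_scale; exact: (L2_coord oO bO). Qed.

Lemma dist_partial_linear_field k i j f : H0space Omega 1 f ->
  dist_partial Omega j (linear_field k i) f = k i j * dot f (cst 1).
Proof.
move=> Hf; have LD : L2 Omega (wD Omega [:: j] f).
  exact: Hspace_L2_wD (H0space_Hspace Hf) (size1 j).
have Lx m := L2_coord oO bO m.
have E m : dot (k i m *: coord m) (wD Omega [:: j] f) = - (k i m * (m == j)%:R * dot f (cst 1)).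
  apply: etrans (dotL2Zl _ (Lx m) LD) _.
  rewrite -mulrA -mulrN; congr (_ * _); apply: etrans (dotL2_coord_wD oO bO m j Hf) _.
  by congr (- (_ * _)); exact: dotL2C.
rewrite /dist_partial (dotL2_suml (index_enum _) (fun m => L2_scale (k i m) (Lx m)) LD).
rewrite (eq_bigr _ (fun m _ => E m)) sumrN opprK (bigD1 j) //= eqxx mulr1 big1 ?addr0 //.
by move=> m /negPf->; rewrite mulr0 mul0r.
Qed.

Definition grad_pairing (v : 'I_n -> fct) (Phi : 'I_n * 'I_n -> fct) : R :=
  \sum_p dist_partial Omega p.2 (v p.1) (Phi p).

Lemma grad_pairing_comb v a Phi Psi : (forall i, L2 Omega (v i)) -> H10 Omega Phi ->
  H10 Omega Psi ->
  grad_pairing v (a *: Phi + Psi) = a * grad_pairing v Phi + grad_pairing v Psi.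
Proof.
move=> Lv HP HQ; rewrite /grad_pairing mulr_sumr -big_split; apply: eq_bigr => p _ /=.
exact: (dist_partial_comb oO bO).
Qed.

(** The gradient of the linear field is the constant matrix [k], which sees only the integrals of
    [Phi]: these give the functionals that Hahn-Banach subtracts. *)
Lemma grad_pairing_skew v k Phi : (forall i, L2 Omega (v i)) -> H10 Omega Phi ->
  grad_pairing (fun i => -1 *: linear_field k i + v i) Phi =
  grad_pairing v Phi - \sum_p k p.1 p.2 * dot (Phi p) (cst 1).
Proof.
move=> Lv HP; rewrite /grad_pairing -sumrB; apply: eq_bigr => p _.
apply: etrans (dist_partial_combl p.2 (-1) (L2_linear_field k p.1) (Lv p.1) (HP p)) _.
rewrite mulN1r addrC; congr (_ - _); exact: dist_partial_linear_field.
Qed.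

Lemma sum_skew (c x : 'I_n * 'I_n -> R) : \sum_p c p * (x p - x (p.2, p.1)) =
  \sum_p (c (p.1, p.2) - c (p.2, p.1)) * x p.
Proof.
rewrite !sum_pair.
have -> : \sum_i \sum_j c (i, j) * (x (i, j) - x (j, i)) =
   \sum_i \sum_j c (i, j) * x (i, j) - \sum_i \sum_j c (j, i) * x (i, j).
  rewrite [X in _ - X]exchange_big -sumrB; apply: eq_bigr => i _ /=.
  by rewrite -sumrB; apply: eq_bigr => j _; rewrite -mulrBr.
rewrite -sumrB; apply: eq_bigr => i _; rewrite -sumrB; apply: eq_bigr => j _.
by rewrite -mulrBl.
Qed.

(* The bound holds on the common kernel of the functionals
   [int (Phi_ij - Phi_ji)], so Hahn-Banach extends it after subtracting a
   combination of them, which is the pairing with the gradient of a skew linear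
   field. *)
Lemma skew_correction v (M : R) : (forall i, L2 Omega (v i)) -> 0 <= M ->
  (forall Phi, H10 Omega Phi ->
    (forall i j, dot (Phi (i, j)) (cst 1) = dot (Phi (j, i)) (cst 1)) ->
    grad_pairing v Phi <= M * HseminormF Omega 1 Phi) ->
  exists2 k : 'I_n -> 'I_n -> R, (forall i j, k i j = - k j i) &
    forall Phi, H10 Omega Phi ->
      grad_pairing (fun i => -1 *: linear_field k i + v i) Phi <= M * HseminormF Omega 1 Phi.
Proof.
move=> Lv M0 le_sym.
pose l (p : 'I_n * 'I_n) (Phi : 'I_n * 'I_n -> fct) :=
  dot (Phi p) (cst 1) - dot (Phi (p.2, p.1)) (cst 1).
have L1 := L2_cst oO bO 1.
have LH Phi p : H10 Omega Phi -> L2 Omega (Phi p).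
  by move=> HP; exact: Hspace_L2 (H0space_Hspace (HP p)).
have := @hahn_banach_fin R _ (@H10 R n Omega _) (fun Phi => M * HseminormF Omega 1 Phi)
  _ _ _ _ (enum {: 'I_n * 'I_n}) l (grad_pairing v).
case.
- by move=> a Phi Psi; exact: (H10_comb oO bO).
- move=> Phi Psi HP HQ; rewrite -mulrDr; apply: ler_wpM2l => //.
  exact: (HseminormF_add oO bO).
- move=> a Phi HP a0; rewrite mulrCA; apply: ler_wpM2l => //.
  by rewrite (HseminormFZ oO bO _ HP) gtr0_norm.
- exact: enum_uniq.
- by move=> p; exact: (H0space0 oO bO).
- by move=> a Phi Psi HP HQ; exact: grad_pairing_comb.
- move=> p a Phi Psi HP HQ; rewrite /l.
  have E q : dot ((a *: Phi + Psi) q) (cst 1) = a * dot (Phi q) (cst 1) + dot (Psi q) (cst 1).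
    exact: (@dotL2_combl R n Omega a (Phi q) (Psi q) (cst 1) (LH _ _ q HP) (LH _ _ q HQ) L1).
  by rewrite !E mulrBr opprD addrACA.
- move=> Phi HP l0; apply: le_sym => // i j.
  by have := l0 (i, j); rewrite mem_enum /l => /(_ isT)/eqP; rewrite subr_eq0 => /eqP.
(* Collecting the coefficient of each integral of Phi_ij antisymmetrises the multipliers. *)
move=> c Hc; exists (fun i j => c (i, j) - c (j, i)); first by move=> i j; rewrite opprB.
move=> Phi HP; apply: le_trans (Hc Phi HP).
set x := grad_pairing _ Phi.
suff -> : x = grad_pairing v Phi - \sum_(p <- enum {: 'I_n * 'I_n}) c p * l p Phi by [].
rewrite {}/x big_enum /=.
rewrite (sum_skew c (fun p => dot (Phi p) (cst 1))).
exact: grad_pairing_skew.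
Qed.

End rotation.

(** * H^-1 norms as bounds on pairings *)

Section dual_norms.
Context {R : realType} {n : nat}.
Variables (Omega : set 'rV[R]_n) (B : R).
Hypotheses (oO : open Omega) (bO : Omega `<=` cbox B).
Local Notation fct := ('rV[R]_n -> R).
Local Notation dot := (dotL2 Omega).

Local Opaque wD dotL2 L2norm pD L2 Hseminorm HseminormF H0space Hspace
  test_function is_weak_derivative dirichlet half_diff.

Lemma dist_partial_scale j v a f : L2 Omega v -> H0space Omega 1 f ->
  dist_partial Omega j v (a *: f) = a * dist_partial Omega j v f.
Proof.
move=> Lv Hf; rewrite /dist_partial mulrN; congr (- _).
apply: etrans (dotL2C _ _ _) _.
apply: etrans (dotL2_wD_scale oO bO a Hf (size1 j) Lv) _.
by congr (_ * _); exact: dotL2C.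
Qed.

(** The supremum in [Hm1norm] leaves out null fields; this covers them. *)
Lemma dist_partial_null j v f : L2 Omega v -> H0space Omega 1 f -> L2norm Omega f = 0 ->
  dist_partial Omega j v f = 0.
Proof.
move=> Lv Hf f0; rewrite /dist_partial; apply/eqP; rewrite oppr_eq0; apply/eqP.
apply: etrans (dotL2C _ _ _) _.
have Lf := Hspace_L2 (H0space_Hspace Hf).
apply: etrans (wD_L2eq oO bO j (H0space_Hspace Hf) (zero_Hspace oO bO 1) (L2norm_eq0 Lf f0) Lv) _.
exact: (dotL2_wD0 oO bO (size1 j) Lv).
Qed.

Lemma sum_sqr_eq0 (I : finType) (x : I -> R) : Num.sqrt (\sum_i x i ^+ 2) = 0 <->
  forall i, x i = 0.
Proof.
split=> [/eqP|x0]; last first.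
  by rewrite big1 ?sqrtr0 // => i _; rewrite x0 expr0n.
rewrite sqrtr_eq0 => S0 i; apply/eqP; rewrite -sqrf_eq0.
have := @psumr_eq0P _ _ xpredT (fun i => x i ^+ 2) (fun i _ => sqr_ge0 (x i)).
move=> /(_ _ i isT)/eqP; apply; apply/le_anti/andP; split => //.
by apply: sumr_ge0 => j _; exact: sqr_ge0.
Qed.

Lemma Hm1norm_ge (I : finType) (T : I -> fct -> R) Phi :
  (forall i, H0space Omega 1 (Phi i)) -> L2normF Omega Phi != 0 ->
  (((\sum_i T i (Phi i)) / HseminormF Omega 1 Phi)%:E <= Hm1norm Omega T)%E.
Proof. by move=> HP P0; apply: ereal_sup_ubound; exists Phi. Qed.

Lemma lt_Hm1norm (I : finType) (T : I -> fct -> R) (b : R) :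
  (forall i a f, H0space Omega 1 f -> T i (a *: f) = a * T i f) ->
  0 < b -> (b%:E < Hm1norm Omega T)%E ->
  exists Phi, [/\ forall i, H0space Omega 1 (Phi i), HseminormF Omega 1 Phi = b
    & b ^+ 2 <= \sum_i T i (Phi i)].
Proof.
move=> TZ b0 /ereal_sup_gt[_ [Phi [HP _] <-]]; rewrite lte_fin.
have := HseminormF_ge0 Omega 1 Phi.
(* With zero seminorm the quotient is 0 by convention, which is not above [b]. *)
rewrite le_eqVlt => /predU1P[<-|h0]; first by rewrite invr0 mulr0 ltNge (ltW b0).
move: h0; set h := HseminormF _ _ _ => h0 bh.
exists ((b / h) *: Phi); split.
- by move=> i; exact: (H10_scale oO bO).
- by rewrite (HseminormFZ oO bO _ HP) -/h ger0_norm ?divr_ge0 ?ltW // divfK ?gt_eqF.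
rewrite (eq_bigr (fun i => b / h * T i (Phi i))) => [|i _]; last exact: TZ.
rewrite -mulr_sumr expr2 -mulrA ler_pM2l // mulrC ltW //.
Qed.

(* The scalar inequalities give near-extremal [phi i], which are scaled to have
   seminorm proportional to [|w_i - avg w_i|]: Cauchy-Schwarz is then an
   equality for the tensor they form. *)
Lemma vector_necas_lions (C M : R) (w : 'I_n -> fct) : 0 < C -> 0 <= M ->
  (forall f, L2 Omega f -> ((L2norm Omega (fun x => f x - average Omega f))%:E
     <= C%:E * Hm1norm Omega (dist_grad Omega f))%E) ->
  (forall i, L2 Omega (w i)) ->
  (forall Phi, H10 Omega Phi -> grad_pairing Omega w Phi <= M * HseminormF Omega 1 Phi) ->
  L2normF Omega (fun i x => w i x - average Omega (w i)) <= C * M.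
Proof.
move=> C0 M0 NL Lw HM.
pose a i := L2norm Omega (fun x => w i x - average Omega (w i)).
have a0 i : 0 <= a i by exact: L2norm_ge0.
(* The supremum defining the H^-1 norm need not be attained: a factor t < 1 makes each level [b i]
   strictly smaller than the norm of the gradient of [w i]. *)
have key (t : R) : 0 < t < 1 -> t * Num.sqrt (\sum_i a i ^+ 2) <= C * M.
  move=> /andP[t0 t1]; pose b i := t * a i / C.
  have b0 i : 0 <= b i by apply: divr_ge0; [apply: mulr_ge0; [exact: ltW|exact: a0]|exact: ltW].
  have /choice[phi Hphi] : forall i, exists phi : 'I_n -> fct,
      [/\ forall j, H0space Omega 1 (phi j), HseminormF Omega 1 phi = b i
        & b i ^+ 2 <= \sum_j dist_grad Omega (w i) j (phi j)].
    (* A component equal to its average contributes the zero field, since [lt_Hm1norm] asks for a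
       positive level. *)
    move=> i; have [ai0|ai0] := eqVneq (a i) 0.
      have bi0 : b i = 0 by rewrite /b ai0 mulr0 mul0r.
      have H0 : H0space Omega 1 (0 : fct) by exact: (H0space0 oO bO).
      exists (fun=> 0 *: 0); split.
      - by move=> j; exact: (H0space_scale oO bO).
      - by rewrite bi0 (HseminormFZ oO bO) ?normr0 ?mul0r.
      - rewrite bi0 expr0n /= big1 // => j _.
        by apply: etrans (dist_partial_scale _ _ (Lw i) _) (mul0r _).
    have ai1 : 0 < a i by rewrite lt0r ai0 a0.
    apply: lt_Hm1norm.
    - by move=> j c f; exact: dist_partial_scale.
    - by rewrite /b divr_gt0 // mulr_gt0.
    rewrite -(@lte_pmul2l _ C%:E) ?lte_fin //; apply: lt_le_trans (NL _ (Lw i)).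
    rewrite -EFinM lte_fin /b mulrC divfK ?gt_eqF //.
    by rewrite gtr_pMl.
  pose Phi (p : 'I_n * 'I_n) := phi p.1 p.2.
  have HP : H10 Omega Phi by move=> p; have [h _ _] := Hphi p.1; exact: h.
  have NP : HseminormF Omega 1 Phi = Num.sqrt (\sum_i b i ^+ 2).
    rewrite -[LHS](ger0_norm (HseminormF_ge0 _ _ _)) -sqrtr_sqr; congr Num.sqrt.
    rewrite HseminormF_sqr sum_pair; apply: eq_bigr => i _.
    by have [_ <- _] := Hphi i; rewrite HseminormF_sqr.
  have := HM Phi HP; rewrite NP /grad_pairing sum_pair.
  have Sb : \sum_i b i ^+ 2 <= \sum_i \sum_j dist_partial Omega j (w i) (phi i j).
    by apply: ler_sum => i _; have [_ _ h] := Hphi i.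
  move=> /(le_trans Sb); rewrite -[X in X <= _ -> _]sqr_sqrtr; last first.
    by apply: sumr_ge0 => i _; exact: sqr_ge0.
  have <- : C * Num.sqrt (\sum_i b i ^+ 2) = t * Num.sqrt (\sum_i a i ^+ 2).
    have -> : \sum_i b i ^+ 2 = (t / C) ^+ 2 * \sum_i a i ^+ 2.
      by rewrite mulr_sumr; apply: eq_bigr => i _; rewrite -exprMn /b mulrAC.
    rewrite sqrtrM ?sqr_ge0 // sqrtr_sqr ger0_norm ?divr_ge0 ?ltW //.
    by rewrite mulrA; congr (_ * _); rewrite mulrC divfK ?gt_eqF.
  rewrite ler_pM2l //; have := sqrtr_ge0 (\sum_i b i ^+ 2).
  rewrite le_eqVlt => /predU1P[<- //|s0].
  by rewrite expr2 ler_pM2r.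
rewrite leNgt; apply/negP; rewrite /L2normF -/a.
have CM : 0 <= C * M by rewrite mulr_ge0 // ltW.
move: CM key; move: (C * M) (Num.sqrt _) => c s c0 key cs.
have s0 : 0 < s by exact: le_lt_trans cs.
(* This t makes t s the midpoint of c and s, which lies above c. *)
have /key : 0 < (s + c) / (2 * s) < 1.
  by rewrite divr_gt0 ?ltr_pdivrMr //=; lra.
have -> : (s + c) / (2 * s) * s = (s + c) / 2 by field; rewrite gt_eqF.
lra.
Qed.

(** The quotient bounds the pairing when the seminorm is nonzero; the Poincare inequality shows that
    it is zero only for null fields, on which [T] vanishes. *)
Lemma Hm1norm_le (I : finType) (T : I -> fct -> R) (m c : R) :
  (forall f, H0space Omega 1 f -> L2norm Omega f <= c * Hseminorm Omega 1 f) ->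
  (forall i f, H0space Omega 1 f -> L2norm Omega f = 0 -> T i f = 0) ->
  Hm1norm Omega T = m%:E -> 0 <= m ->
  forall Phi, H10 Omega Phi -> \sum_i T i (Phi i) <= m * HseminormF Omega 1 Phi.
Proof.
move=> poincare Tnull mE m0 Phi HP.
have [P0|P0] := eqVneq (L2normF Omega Phi) 0.
  have N0 := (sum_sqr_eq0 (fun i => L2norm Omega (Phi i))).1 P0.
  rewrite big1 => [|i _]; first by rewrite mulr_ge0 ?HseminormF_ge0.
  exact: Tnull (HP i) (N0 i).
have := Hm1norm_ge T HP P0; rewrite mE lee_fin ler_pdivrMr // lt0r HseminormF_ge0 andbT.
apply: contraNneq P0 => h0; apply/eqP; apply/sum_sqr_eq0 => i.
have hi := (sum_sqr_eq0 (fun i => Hseminorm Omega 1 (Phi i))).1 h0 i.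
apply/eqP; rewrite eq_le L2norm_ge0 andbT; apply: le_trans (poincare _ (HP i)) _.
by rewrite hi mulr0.
Qed.

(** Test with a field and its opposite. One nonzero field must exist, the supremum of the empty set
    being -oo. *)
Lemma Hm1norm_ge0 (I : finType) (T : I -> fct -> R) (i0 : I) phi :
  (forall i a f, H0space Omega 1 f -> T i (a *: f) = a * T i f) ->
  H0space Omega 1 phi -> L2norm Omega phi != 0 -> (0 <= Hm1norm Omega T)%E.
Proof.
move=> TZ Hphi phi0.
have pair a : `|a| = 1 ->
    (((a * \sum_i T i phi) / HseminormF Omega 1 (fun _ : I => phi))%:E <= Hm1norm Omega T)%E.
  move=> a1; have H1 : H10 Omega (fun _ : I => phi) by [].
  have H2 : H10 Omega (a *: (fun _ : I => phi)) by exact: (H10_scale oO bO).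
  have N2 : L2normF Omega (a *: (fun _ : I => phi)) != 0.
    apply: contraNneq phi0 => /sum_sqr_eq0/(_ i0) N.
    have Lphi := Hspace_L2 (H0space_Hspace Hphi).
    have Laphi := L2_scale a Lphi.
    have E : dot phi phi = a * dot (a *: phi) phi.
      rewrite (dotL2Zl _ Lphi Lphi) mulrA -expr2 -real_normK ?num_real // a1.
      by rewrite expr1n mul1r.
    rewrite -sqrf_eq0 (L2normE Lphi) E (L2norm_eq0 Laphi N Lphi).
    by rewrite (dotL20l Lphi) mulr0.
  have := Hm1norm_ge T H2 N2; rewrite (HseminormFZ oO bO _ H1) a1 mul1r mulr_sumr.
  by congr ((_ / _)%:E <= _)%E; apply: eq_bigr => i _; exact: TZ.
have := pair (-1); have := pair 1; rewrite normrN normr1 mulN1r mul1r mulNr.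
move=> /(_ erefl) le1 /(_ erefl) le2.
move: le1 le2; move: (_ / _) => x le1 le2.
have [x0|/ltW x0] := leP 0 x; first by apply: le_trans le1; rewrite lee_fin.
by apply: le_trans le2; rewrite lee_fin oppr_ge0.
Qed.

(** Otherwise every H^-1 norm would be -oo, and the Necas-Lions inequality would fail already for
    the zero function; no explicit bump has to be produced. *)
Lemma nonzero_H0space (C : R) : 0 < C ->
  (forall f, L2 Omega f -> ((L2norm Omega (fun x => f x - average Omega f))%:E
     <= C%:E * Hm1norm Omega (dist_grad Omega f))%E) ->
  exists2 phi, H0space Omega 1 phi & L2norm Omega phi != 0.
Proof.
move=> C0 NL; apply: contrapT => none.
have := NL _ (L2_0 Omega).
rewrite /Hm1norm (_ : [set _ | _ in _] = set0); last first.
  apply/seteqP; split => // x [Phi [HP /eqP P0] _]; apply: none.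
  apply: contrapT => none; apply: P0; apply/sum_sqr_eq0 => i.
  by apply: contrapT => /eqP Pi; apply: none; exists (Phi i).
by rewrite ereal_sup0 gt0_muleNy ?lte_fin // leeNy_eq.
Qed.

Lemma dist_sym_grad_scale v p a f : (forall i, L2 Omega (v i)) -> H0space Omega 1 f ->
  dist_sym_grad Omega v p (a *: f) = a * dist_sym_grad Omega v p f.
Proof.
move=> Lv Hf; rewrite /dist_sym_grad.
rewrite (dist_partial_scale p.2 a (Lv p.1) Hf) (dist_partial_scale p.1 a (Lv p.2) Hf).
by rewrite -mulrDr mulrCA.
Qed.

Lemma dist_sym_grad_null v p f : (forall i, L2 Omega (v i)) -> H0space Omega 1 f ->
  L2norm Omega f = 0 -> dist_sym_grad Omega v p f = 0.
Proof.
move=> Lv Hf f0; rewrite /dist_sym_grad.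
rewrite (dist_partial_null p.2 (Lv p.1) Hf f0) (dist_partial_null p.1 (Lv p.2) Hf f0).
by rewrite addr0 mulr0.
Qed.

End dual_norms.

(** * Rigid motions *)

Section rigid_motions.
Context {R : realType}.

Lemma linear_fieldE n (k : 'I_n -> 'I_n -> R) i x :
  linear_field k i x = \sum_j k i j * x ord0 j.
Proof. by rewrite /linear_field fct_sumE. Qed.

Definition affine_field n (a : 'I_n -> R) (k : 'I_n -> 'I_n -> R) (i : 'I_n) : 'rV[R]_n -> R :=
  a i *: cst 1 + linear_field k i.

Lemma affine_fieldE n (a : 'I_n -> R) k i x :
  affine_field a k i x = a i + \sum_j k i j * x ord0 j.
Proof. by rewrite -linear_fieldE -[X in X + _]mulr1. Qed.

Lemma ord2P (P : 'I_2 -> Prop) : P 0 -> P 1 -> forall i, P i.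
Proof.
move=> P0 P1 [[|[|//]] lt]; [move: P0|move: P1]; congr P; exact: val_inj.
Qed.

Lemma ord3P (P : 'I_3 -> Prop) : P 0 -> P 1 -> P 2 -> forall i, P i.
Proof.
move=> P0 P1 P2 [[|[|[|//]]] lt]; [move: P0|move: P1|move: P2]; congr P; exact: val_inj.
Qed.

Lemma sum_ord2 (F : 'I_2 -> R) : \sum_i F i = F 0 + F 1.
Proof.
by rewrite !big_ord_recl big_ord0 addr0; congr (F _ + F _); exact: val_inj.
Qed.

Lemma sum_ord3 (F : 'I_3 -> R) : \sum_i F i = F 0 + F 1 + F 2.
Proof.
by rewrite !big_ord_recl big_ord0 addr0 addrA; congr (F _ + F _ + F _); exact: val_inj.
Qed.

Lemma RM_affine n p : n = 2%N \/ n = 3%N -> RM p -> exists a k, p = @affine_field n a k.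
Proof.
case=> nE; move: p; rewrite {}nE => p /=.
  move=> [alpha [b ->]].
  exists (fun i => alpha 0 i).
  exists (fun i j => b * ((i == 0)%:R * (j == 1)%:R - (i == 1)%:R * (j == 0)%:R)).
  apply/funext => i; apply/funext => x; rewrite affine_fieldE sum_ord2 /components !mxE.
  by move: i; apply: ord2P => /=; congr (_ + _); ring.
move=> [alpha [u ->]].
(* The columns of the matrix are the images of the basis vectors under the cross product with
   [u]. *)
exists (fun i => alpha 0 i), (fun i j => cross3 u (delta_mx 0 j) 0 i).
apply/funext => i; apply/funext => x; rewrite affine_fieldE sum_ord3 /components !mxE.
by move: i; apply: ord3P => /=; congr (_ + _); rewrite /=; ring.
Qed.

Lemma affine_RM n (a : 'I_n -> R) k : n = 2%N \/ n = 3%N -> (forall i j, k i j = - k j i) ->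
  RM (affine_field a k).
Proof.
case=> nE; move: a k; rewrite {}nE => a k kS /=.
  exists (\row_i a i), (k 0 1).
  have k0 i : k i i = 0 by have := kS i i; lra.
  apply/funext => i; apply/funext => x; rewrite affine_fieldE sum_ord2 /components !mxE.
  move: i; apply: ord2P => /=; congr (_ + _); rewrite k0 ?(kS 1 0); ring.
(* Axial vector of the skew matrix [k]: its cross product with x is k x. *)
exists (\row_i a i), (\row_i [:: - k 1 2; k 0 2; - k 0 1]`_i).
have k0 i : k i i = 0 by have := kS i i; lra.
apply/funext => i; apply/funext => x; rewrite affine_fieldE sum_ord3 /components !mxE.
by move: i; apply: ord3P => /=; congr (_ + _); rewrite k0 ?(kS 1 0) ?(kS 2 0) ?(kS 2 1); ring.
Qed.

End rigid_motions.

(** * Best approximation by rigid motions *)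

Section projection.
Context {R : realType} {n : nat}.
Variables (Omega : set 'rV[R]_n) (B : R).
Hypotheses (oO : open Omega) (bO : Omega `<=` cbox B).
Local Notation fct := ('rV[R]_n -> R).
Local Notation dot := (dotL2 Omega).

Local Opaque dotL2 L2norm L2.

Lemma L2_affine_field a k i : L2 Omega (affine_field a k i).
Proof. exact: L2_comb (L2_cst oO bO 1) (L2_linear_field oO bO k i). Qed.

(** Pythagoras for v - q = (v - p) + (p - q); the cross terms cancel only after summation over the
    components. *)
Lemma projection_optimal (v p q : 'I_n -> fct) : (forall i, L2 Omega (v i)) ->
  (forall i, L2 Omega (p i)) -> (forall i, L2 Omega (q i)) ->
  dotL2F Omega (fun i => v i \- p i) p = 0 -> dotL2F Omega (fun i => v i \- p i) q = 0 ->
  L2normF Omega (fun i => v i \- p i) <= L2normF Omega (fun i => v i \- q i).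
Proof.
move=> Lv Lp Lq vp vq; apply: ler_wsqrtr.
pose e i : fct := v i \- p i; pose d i : fct := -1 *: q i + p i.
have Ld i : L2 Omega (d i) by exact: L2_comb.
have Le i : L2 Omega (e i).
  have -> : e i = -1 *: p i + v i by apply/funext => x; rewrite /e -[RHS]/(-1 * _ + _) mulN1r addrC.
  exact: L2_comb.
have E i : v i \- q i = 1 *: e i + d i.
  apply/funext => x; rewrite -[RHS]/(1 * (v i x - p i x) + (-1 * q i x + p i x)) /=.
  by ring.
have N i : L2norm Omega (v i \- q i) ^+ 2 =
    L2norm Omega (e i) ^+ 2 + 2 * (dot (e i) (p i) - dot (e i) (q i)) + L2norm Omega (d i) ^+ 2.
  rewrite E (L2normE (L2_comb 1 (Le i) (Ld i))) (L2normE (Le i)) (L2normE (Ld i)).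
  rewrite (dotL2_sqr 1 (Le i) (Ld i)) (dotL2_combr (-1) (Lq i) (Lp i) (Le i)).
  by move: (dot (e i) (e i)) (dot (e i) (q i)) (dot (e i) (p i)) (dot (d i) (d i)) => *; ring.
rewrite (eq_bigr _ (fun i _ => N i)) !big_split /= -mulr_sumr sumrB.
rewrite /dotL2F in vp vq; rewrite vp vq subrr mulr0 addr0.
by rewrite lerDl; apply: sumr_ge0 => i _; exact: sqr_ge0.
Qed.

End projection.

(** * Boundedness of the domain *)

Section domains.
Context {R : realType} {n : nat}.

Lemma coord_le_enorm (x : 'rV[R]_n) i : `|x ord0 i| <= enorm x.
Proof.
rewrite -sqrtr_sqr; apply: ler_wsqrtr; rewrite (bigD1 i) //= lerDl.
by apply: sumr_ge0 => j _; exact: sqr_ge0.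
Qed.

Lemma star_domain_bounded (r rho : R) (Omega : set 'rV[R]_n) : star_domain r rho Omega ->
  0 <= r /\ exists B, Omega `<=` cbox B.
Proof.
move=> [_ _ [x0 Ox0] dE _].
have le x y : Omega x -> Omega y -> enorm (x - y) <= r.
  move=> Ox Oy; rewrite -lee_fin -dE; apply: ereal_sup_ubound.
  by exists x => //; exists y.
split; first exact: le_trans (sqrtr_ge0 _) (le _ _ Ox0 Ox0).
exists (enorm x0 + r) => x Ox i.
have -> : x ord0 i = x0 ord0 i + (x - x0) ord0 i by rewrite !mxE addrCA subrr addr0.
apply: le_trans (ler_normD _ _) _; apply: lerD; first exact: coord_le_enorm.
exact: le_trans (coord_le_enorm _ _) (le _ _ Ox Ox0).
Qed.

End domains.

(** * Assembly of the estimate *)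

Section final_estimate.
Context {R : realType} {n : nat}.
Variables (Omega : set 'rV[R]_n) (B : R).
Hypotheses (oO : open Omega) (bO : Omega `<=` cbox B).
Local Notation fct := ('rV[R]_n -> R).
Local Notation dot := (dotL2 Omega).

Local Opaque wD dotL2 L2norm pD L2 Hseminorm HseminormF H0space Hspace
  test_function is_weak_derivative dirichlet half_diff.

(** The Poincare inequality absorbs the L2 term of the bound, leaving the single constant K = CA c +
    CB. *)
Lemma divergence_inverse (CA CB c : R) : are_divergence_constants Omega CA CB ->
  (forall f, H0space Omega 1 f -> L2norm Omega f <= c * Hseminorm Omega 1 f) ->
  forall f, H0space Omega 1 f -> dot f (cst 1) = 0 ->
  exists u : 'I_n -> fct, [/\ forall i, H0space Omega 2 (u i),
    forall z, L2 Omega z -> dot (\sum_i wD Omega [:: i] (u i)) z = dot f z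
    & HseminormF Omega 2 u <= (CA * c + CB) * Hseminorm Omega 1 f].
Proof.
move=> [CA0 CB0 H] poincare f Hf f0.
have Lf := Hspace_L2 (H0space_Hspace Hf).
have If : \int[lebesgueV R n]_(x in Omega) f x = 0.
  by rewrite -dotL2_cst1.
have [u [Hu du nu]] := H f Hf If.
exists u; split => //.
  have LD i : L2 Omega (wD Omega [:: i] (u i)).
    by exact: Hspace_L2_wD (H0space_Hspace (Hu i)) _.
  apply: L2eq_ae => //; first exact: L2_sum.
  have -> : \sum_i wD Omega [:: i] (u i) = div Omega u by rewrite /div fct_sumE.
  exact: du.
apply: le_trans nu _; rewrite mulrDl lerD2r -mulrA ler_pM2l //; exact: poincare.
Qed.

Lemma rigid_motion_estimate (C CA CB c : R) (v p : 'I_n -> fct) : n = 2%N \/ n = 3%N ->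
  0 < C -> 0 <= c ->
  (forall f, L2 Omega f -> ((L2norm Omega (fun x => f x - average Omega f))%:E
     <= C%:E * Hm1norm Omega (dist_grad Omega f))%E) ->
  (forall f, H0space Omega 1 f -> L2norm Omega f <= c * Hseminorm Omega 1 f) ->
  are_divergence_constants Omega CA CB ->
  (forall i, L2 Omega (v i)) -> is_RM_projection Omega v p ->
  ((L2normF Omega (fun i => v i \- p i))%:E <=
    (C * (1 + Num.sqrt 2 * (CA * c + CB)))%:E * Hm1norm Omega (dist_sym_grad Omega v))%E.
Proof.
move=> hn C0 c0 NL poincare divO Lv [RMp p_orth].
have [CA0 CB0 _] := divO.
have K0 : 0 <= CA * c + CB by apply: addr_ge0; [apply: mulr_ge0 => //|]; exact: ltW.
have K1 : 0 < 1 + Num.sqrt 2 * (CA * c + CB).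
  by apply: ltr_pwDl => //; rewrite mulr_ge0 // sqrtr_ge0.
have [i0 _] : exists i0 : 'I_n, True by case: hn => ->; exists ord0.
have [phi Hphi phi0] := nonzero_H0space C0 NL.
have E0 : (0 <= Hm1norm Omega (dist_sym_grad Omega v))%E.
  apply: (Hm1norm_ge0 oO bO (i0, i0) _ Hphi phi0) => q a f Hf.
  exact: (dist_sym_grad_scale oO bO q a Lv Hf).
(* If the norm is +oo, so is the right-hand side, its constant being positive. *)
case mE : (Hm1norm Omega (dist_sym_grad Omega v)) E0 => [m||] // m0; last first.
  by rewrite gt0_muley ?leey // lte_fin mulr_gt0.
rewrite lee_fin in m0; rewrite -EFinM lee_fin.
have sym_le : forall Psi, H10 Omega Psi ->
    \sum_q dist_sym_grad Omega v q (Psi q) <= m * HseminormF Omega 1 Psi.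
  apply: (Hm1norm_le poincare _ mE m0) => q f Hf f0.
  exact: (dist_sym_grad_null oO bO q Lv Hf f0).
have M0 : 0 <= m * (1 + Num.sqrt 2 * (CA * c + CB)) by rewrite mulr_ge0 // ltW.
have [k kS Hk] := skew_correction oO bO Lv M0
  (grad_le oO bO Lv m0 K0 sym_le (divergence_inverse divO poincare)).
set w := fun i => _ in Hk.
have Lw i : L2 Omega (w i) by exact: L2_comb (L2_linear_field oO bO k i) (Lv i).
(* The affine form of the projection shows that it lies in L2. *)
have [a' [k' pE]] := RM_affine hn RMp.
(* This rigid motion is chosen so that [v - q] is [w] minus its average. *)
pose q := affine_field (fun i => average Omega (w i)) k.
have vq : (fun i => v i \- q i) = (fun i x => w i x - average Omega (w i)).
  apply/funext => i; apply/funext => x.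
  rewrite -[LHS]/(v i x - (average Omega (w i) * 1 + linear_field k i x)).
  rewrite -[RHS]/(-1 * linear_field k i x + v i x - average Omega (w i)).
  by move: (average _ _) (linear_field _ _ _) => y z; ring.
have Lq i : L2 Omega (q i) by exact: (L2_affine_field oO bO).
have Lp i : L2 Omega (p i) by rewrite pE; exact: (L2_affine_field oO bO).
have RMq : RM q by exact: affine_RM.
apply: le_trans (projection_optimal Lv Lp Lq (p_orth _ RMp) (p_orth _ RMq)) _.
rewrite vq -mulrA (mulrC _ m).
exact: (vector_necas_lions oO bO C0 M0 NL Lw Hk).
Qed.

End final_estimate.

Theorem theorem1p4 (R : realType) (n : nat) (hn : n = 2%N \/ n = 3%N) :
  exists Cstar : R -> R -> R -> R -> R -> R,
  forall CP : R, is_poincare_constant n CP ->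
  forall (r rho : R) (Omega : set 'rV[R]_n), star_domain r rho Omega ->
  forall CNL CA CB : R,
    is_necas_lions_constant Omega CNL ->
    are_divergence_constants Omega CA CB ->
  0 < Cstar r CNL CA CB CP /\
  forall v : 'I_n -> 'rV[R]_n -> R, (forall i, L2 Omega (v i)) ->
  forall Pv : 'I_n -> 'rV[R]_n -> R, is_RM_projection Omega v Pv ->
    ((L2normF Omega (fun i => v i \- Pv i))%:E
       <= (Cstar r CNL CA CB CP)%:E * Hm1norm Omega (dist_sym_grad Omega v))%E /\
    ((Cstar r CNL CA CB CP)%:E * Hm1norm Omega (dist_sym_grad Omega v)
       <= (CNL * (1 + Num.sqrt 2 * (CA * CP * r + CB)))%:E
          * Hm1norm Omega (dist_sym_grad Omega v))%E.
Proof.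
(* C* is taken to be the explicit constant itself, so the second inequality is an equality. *)
exists (fun r CNL CA CB CP => CNL * (1 + Num.sqrt 2 * (CA * CP * r + CB))).
move=> CP [CP0 poincare] r rho Omega starO CNL CA CB [CNL0 NL _] divO.
have [oO _ _ _ _] := starO; have [r0 [B bO]] := star_domain_bounded starO.
have [CA0 CB0 _] := divO.
have K0 : 0 <= CA * (CP * r) + CB.
  by apply: addr_ge0; [rewrite !mulr_ge0 // ltW|exact: ltW].
rewrite -(mulrA CA); have C0 : 0 < CNL * (1 + Num.sqrt 2 * (CA * (CP * r) + CB)).
  rewrite mulr_gt0 //; apply: ltr_pwDl => //; rewrite mulr_ge0 //; exact: sqrtr_ge0.
split=> // v Lv Pv [RMP PvO]; split; last exact: lexx.
exact: (rigid_motion_estimate oO bO hn CNL0 (mulr_ge0 (ltW CP0) r0) NL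
  (poincare _ _ _ starO) divO Lv (conj RMP PvO)).
Qed.
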